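(* Let $n\ge 2$ and $0<\lambda\le\Lambda<\infty$. There is a constant $A>1$ depending only on $n,\lambda,\Lambda$ such that the following hold. (a) Let $(a_{ij})$ be coefficients on $B_1$ satisfying the uniform ellipticity condition with constants $\lambda,\Lambda$, and let $u$ be a nonnegative subsolution of $Lu=-D_j(a_{ij}(x)D_iu)=0$ in $B_1$. Put $$m=\left(\frac1{|B_1|}\int_{B_1}u^2\,dx\right)^{1/2}.$$ Then $v=(u-Am)^+$ satisfies $$\left(\frac1{|B_{1/2}|}\int_{B_{1/2}}v^2\,dx\right)^{1/2}\le\frac12\left(\frac1{|B_1|}\int_{B_1}u^2\,dx\right)^{1/2}.$$ (b) Let $r>0$, let $(a_{ij})$ be coefficients on $B_r$ satisfying the uniform ellipticity condition with constants $\lambda,\Lambda$, and let $u$ be a nonnegative subsolution of $Lu=0$ in $B_r$. Put $$m=\left(\frac1{|B_r|}\int_{B_r}u^2\,dx\right)^{1/2}.$$ Then $v=(u-Am)^+$ satisfies $$\left(\frac1{|B_{r/2}|}\int_{B_{r/2}}v^2\,dx\right)^{1/2}\le\frac12\left(\frac1{|B_r|}\int_{B_r}u^2\,dx\right)^{1/2}.$$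
   Context: $B_r$ is the ball of radius $r$ centered at $0$ in $\mathbb R^n$, $|E|$ is the Lebesgue measure of $E$, $s^+=\max(s,0)$, $D_i=\partial/\partial x_i$, and repeated indices are summed from $1$ to $n$. Uniform ellipticity condition with constants $0<\lambda\le\Lambda<\infty$: the $a_{ij}$ are real measurable functions with $\lambda|\xi|^2\le a_{ij}(x)\xi_i\xi_j\le\Lambda|\xi|^2$ for all $\xi\in\mathbb R^n$ and $|a_{ij}(x)|\le\Lambda$ for all $i,j$ (symmetry is not assumed). Subsolution: $u\in H^1(B_r)$ is a subsolution of $Lu=-D_j(a_{ij}D_iu)=0$ in $B_r$ if $\int_{B_r} a_{ij}D_iu\,D_jv\,dx\le 0$ for every nonnegative $v\in H^1_0(B_r)$. *)

(* Defs.v *)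
From HB Require Import structures.
From mathcomp Require Import all_boot all_order all_algebra.
From mathcomp Require Import all_classical all_reals all_analysis.

Set Implicit Arguments.
Unset Strict Implicit.
Unset Printing Implicit Defensive.

Import Order.TTheory GRing.Theory Num.Theory.
Import numFieldNormedType.Exports.

Local Open Scope classical_set_scope.
Local Open Scope ring_scope.

(* The product (= Borel) sigma-algebra on R^n, generated by the coordinates. *)
Definition rV_display : measure_display -> measure_display.
Proof. exact. Qed.

Section rV_measurable.
Context {R : realType} {n : nat}.

Definition rV_coord (i : 'I_n) (x : 'rV[R]_n) : measurableTypeR R := x ord0 i.

Let rV_measurable0 : g_sigma_preimage rV_coord set0.
Proof. exact: sigma_algebra0. Qed.

Let rV_measurableC A :
  g_sigma_preimage rV_coord A -> g_sigma_preimage rV_coord (~` A).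
Proof. exact: sigma_algebraC. Qed.

Let rV_measurable_bigcup (F : (set 'rV[R]_n)^nat) :
  (forall i, g_sigma_preimage rV_coord (F i)) ->
  g_sigma_preimage rV_coord (\bigcup_i F i).
Proof. exact: sigma_algebra_bigcup. Qed.

HB.instance Definition _ :=
  @isMeasurable.Build (rV_display default_measure_display) 'rV[R]_n
    (g_sigma_preimage rV_coord)
    rV_measurable0 rV_measurableC rV_measurable_bigcup.

Lemma measurable_rV_coord i : measurable_fun [set: 'rV[R]_n] (rV_coord i).
Proof.
move=> _ Y mY; rewrite setTI; apply: sub_sigma_algebra => /=.
rewrite -bigcup_seq/=; exists i => /=; first by rewrite mem_index_enum.
by exists Y => //; rewrite setTI.
Qed.

Lemma measurable_rV_coordP d (T : measurableType d) (f : T -> 'rV[R]_n) :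
  (forall i, measurable_fun [set: T] (rV_coord i \o f)) ->
  measurable_fun [set: T] f.
Proof.
move=> mf _ A mA; rewrite setTI.
have : preimage_set_system [set: T] f (g_sigma_preimage rV_coord) (f @^-1` A).
  by exists A => //; rewrite setTI.
rewrite -g_sigma_preimage_comp; apply: smallest_sub.
  exact: sigma_algebra_measurable.
rewrite -bigcup_seq; apply: bigcup_sub => i _ B [C mC <-].
exact: mf.
Qed.

End rV_measurable.

Section rV_lebesgue.
Context {R : realType}.

Definition rV_cons n (p : measurableTypeR R * 'rV[R]_n) : 'rV[R]_n.+1 :=
  row_mx (p.1%:M : 'M[R]_1) p.2.

Definition rV_uncons n (x : 'rV[R]_n.+1) : measurableTypeR R * 'rV[R]_n :=
  (x ord0 ord0, rsubmx (x : 'M[R]_(1, 1 + n))).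

Lemma rV_cons0 n p : @rV_cons n p ord0 ord0 = p.1.
Proof.
rewrite /rV_cons; have -> : ord0 = lshift n (ord0 : 'I_1) :> 'I_(1 + n).
  exact: val_inj.
by rewrite (@row_mxEl _ 1 1 n) mxE eqxx mulr1n.
Qed.

Lemma rV_consS n p i : @rV_cons n p ord0 (lift ord0 i) = p.2 ord0 i.
Proof.
rewrite /rV_cons; have -> : lift ord0 i = rshift 1 i :> 'I_(1 + n).
  exact: val_inj.
by rewrite (@row_mxEr _ 1 1 n).
Qed.

Lemma rV_consK n : cancel (@rV_cons n) (@rV_uncons n).
Proof.
move=> p; rewrite /rV_uncons rV_cons0 /rV_cons.
by rewrite (@row_mxKr _ 1 1 n); case: p.
Qed.

Lemma rV_unconsK n : cancel (@rV_uncons n) (@rV_cons n).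
Proof.
move=> x; apply/rowP => i; have [->|[j ->]] : i = ord0 \/ exists j, i = lift ord0 j.
- by case: (unliftP ord0 i) => [j ->|->]; [right; exists j|left].
- by rewrite rV_cons0.
- by rewrite rV_consS /= mxE; congr (x _ _); exact: val_inj.
Qed.

Lemma measurable_rV_cons n : measurable_fun setT (@rV_cons n).
Proof.
apply: measurable_rV_coordP => i.
case: (unliftP ord0 i) => [j ->|->].
- rewrite (_ : _ \o _ = rV_coord j \o snd).
    by apply: measurableT_comp => //; exact: measurable_rV_coord.
  by apply/funext => p; exact: rV_consS.
- rewrite (_ : _ \o _ = fst) //.
  by apply/funext => p; exact: rV_cons0.
Qed.

Lemma measurable_rV_uncons n : measurable_fun setT (@rV_uncons n).
Proof.
apply/measurable_fun_pair; first exact: (@measurable_rV_coord R n.+1 ord0).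
apply: measurable_rV_coordP => i /=.
rewrite (_ : _ \o _ = rV_coord (lift ord0 i)); first exact: measurable_rV_coord.
by apply/funext => x /=; rewrite /rV_coord mxE; congr (x _ _); exact: val_inj.
Qed.

Section lebesgue_cons.
Context {n : nat}.
Variable m : {sigma_finite_measure set 'rV[R]_n -> \bar R}.
Let P := (@lebesgue_measure R \x m)%E.

Definition lebesgue_cons : set 'rV[R]_n.+1 -> \bar R :=
  pushforward P (@rV_cons n).

Let lebesgue_cons0 : lebesgue_cons set0 = 0%E.
Proof. by rewrite /lebesgue_cons /pushforward /P preimage_set0 measure0. Qed.

Let lebesgue_cons_ge0 A : (0 <= lebesgue_cons A)%E.
Proof. by rewrite /lebesgue_cons /pushforward /P measure_ge0. Qed.

Let lebesgue_cons_sigma_additive : semi_sigma_additive lebesgue_cons.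
Proof.
move=> F mF tF mUF; rewrite /lebesgue_cons /pushforward preimage_bigcup.
apply: measure_semi_sigma_additive.
- by move=> k; rewrite -[X in measurable X]setTI; exact: measurable_rV_cons.
- apply/trivIsetP => /= i j _ _ ij; rewrite -preimage_setI.
  by move/trivIsetP : tF => /(_ _ _ _ _ ij) ->//; rewrite preimage_set0.
- rewrite -preimage_bigcup -[X in measurable X]setTI.
  exact: measurable_rV_cons.
Qed.

HB.instance Definition _ := isMeasure.Build _ _ _ lebesgue_cons
  lebesgue_cons0 lebesgue_cons_ge0 lebesgue_cons_sigma_additive.

Let lebesgue_cons_sigma_finite : sigma_finite setT lebesgue_cons.
Proof.
have /sigma_finiteP[F [TF ndF Foo]] := sigma_finiteT (@lebesgue_measure R).
have /sigma_finiteP[G [TG ndG Goo]] := sigma_finiteT m.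
exists (fun k => @rV_uncons n @^-1` (F k `*` G k)).
  rewrite -preimage_bigcup -(preimage_setT (@rV_uncons n)); congr (_ @^-1` _).
  apply/esym; rewrite -subTset => -[x y] _.
  have [k _ Fkx] : (\bigcup_k F k) x by rewrite -TF.
  have [l _ Gly] : (\bigcup_k G k) y by rewrite -TG.
  exists (maxn k l) => //; split => /=.
  - by move: x Fkx; exact/subsetPset/ndF/leq_maxl.
  - by move: y Gly; exact/subsetPset/ndG/leq_maxr.
move=> k; have [mF Fk] := Foo k; have [mG Gk] := Goo k; split.
  rewrite -[X in measurable X]setTI; apply: measurable_rV_uncons => //.
  exact: measurableX.
rewrite /lebesgue_cons /pushforward -comp_preimage.
rewrite (_ : @rV_uncons n \o @rV_cons n = id); last first.
  by apply/funext => p /=; rewrite rV_consK.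
by rewrite preimage_id /P product_measure1E// lte_mul_pinfty// ge0_fin_numE.
Qed.

HB.instance Definition _ := Measure_isSigmaFinite.Build _ _ _ lebesgue_cons
  lebesgue_cons_sigma_finite.

End lebesgue_cons.

(* The n-fold product of one-dimensional Lebesgue measure, on Borel sets. *)
Fixpoint borel_lebesgue (n : nat) :
    {sigma_finite_measure set 'rV[R]_n -> \bar R} :=
  match n with
  | 0 => dirac (0 : 'rV[R]_0)
  | k.+1 => lebesgue_cons (borel_lebesgue k)
  end.

End rV_lebesgue.

(* R^n with the sigma-algebra of all Lebesgue measurable sets, on which the
   completion of the product measure is the n-dimensional Lebesgue measure. *)
Definition Rn (R : realType) (n : nat) : measurableType _ :=
  caratheodory_type ((@borel_lebesgue R n)^*)%mu.

Definition lebesgue (R : realType) (n : nat) : {measure set (Rn R n) -> \bar R} :=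
  @completed_measure_extension _ _ _ (@borel_lebesgue R n).

Section sobolev.
Context {R : realType} {n : nat}.
Local Notation mu := (lebesgue R n).
Implicit Types (D : set 'rV[R]_n) (f g u v phi : 'rV[R]_n -> R) (r : R).

(* The norm of the normed module 'rV[R]_n is the sup norm. *)
Definition enorm (x : 'rV[R]_n) : R := Num.sqrt (\sum_(i < n) x 0 i ^+ 2).

(* The open Euclidean ball centered at 0. *)
Definition eball r : set 'rV[R]_n := [set x | enorm x < r].

Definition integral_mean D f : R :=
  (fine (mu D))^-1 * \int[mu]_(x in D) f x.

Definition partial (i : 'I_n) f : 'rV[R]_n -> R := 'D_(delta_mx 0 i) f.

Definition smooth f : Prop :=
  forall s : seq 'I_n, let g := foldr partial f s in
    continuous g /\ forall x i, derivable g x (delta_mx 0 i).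

(* phi \in C_c^\infty(D) *)
Definition test_function D phi : Prop :=
  [/\ smooth phi, compact (closure [set x | phi x != 0]) &
      closure [set x | phi x != 0] `<=` D].

(* Elements of L^2(D) and H^1(D) are represented by functions on the whole
   space, of which only the values almost everywhere on D are relevant. *)
Definition L2 D f : Prop :=
  measurable_fun (D : set (Rn R n)) f /\
  (\int[mu]_(x in D) (f x ^+ 2)%:E < +oo)%E.

Definition is_weak_partial D (i : 'I_n) u g : Prop :=
  L2 D g /\ forall phi, test_function D phi ->
    \int[mu]_(x in D) (u x * partial i phi x) =
    - \int[mu]_(x in D) (g x * phi x).

Definition H1 D u : Prop :=
  L2 D u /\ forall i, exists g, is_weak_partial D i u g.

(* Weak partial derivatives are unique up to equality a.e. on D; one is chosen. *)
Definition weak_partial D (i : 'I_n) u : 'rV[R]_n -> R :=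
  xget (fun=> 0) [set g | is_weak_partial D i u g].

Definition H1norm D u : R :=
  Num.sqrt (\int[mu]_(x in D) (u x ^+ 2) +
            \sum_(i < n) \int[mu]_(x in D) (weak_partial D i u x ^+ 2)).

Definition H10 D v : Prop :=
  H1 D v /\ exists phi : nat -> 'rV[R]_n -> R,
    (forall k, test_function D (phi k)) /\
    H1norm D (fun x => phi k x - v x) @[k --> \oo] --> 0.

Definition nonneg_on D u : Prop := {ae mu, forall x, D x -> 0 <= u x}.

(* No symmetry of a is assumed; the pointwise bounds are required a.e. on D. *)
Definition uniformly_elliptic D (lam Lam : R) (a : 'rV[R]_n -> 'M[R]_n) : Prop :=
  (forall i j, measurable_fun (D : set (Rn R n)) (fun x => a x i j)) /\
  {ae mu, forall x, D x ->
    (forall xi : 'rV[R]_n,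
      lam * enorm xi ^+ 2 <= \sum_(i < n) \sum_(j < n) a x i j * xi 0 i * xi 0 j
        <= Lam * enorm xi ^+ 2) /\
    (forall i j, `|a x i j| <= Lam)}.

Definition subsolution D (a : 'rV[R]_n -> 'M[R]_n) u : Prop :=
  H1 D u /\ forall v, H10 D v -> nonneg_on D v ->
    \int[mu]_(x in D) (\sum_(i < n) \sum_(j < n)
      a x i j * weak_partial D i u x * weak_partial D j v x) <= 0.

End sobolev.

(* Main.v *)
Require Import Defs.
From HB Require Import structures.
From mathcomp Require Import all_boot all_order all_algebra.
From mathcomp Require Import all_classical all_reals all_analysis.
From mathcomp Require Import measurable_realfun.
From mathcomp Require Import ring lra.
From mathcomp Require finmap.

(** Let [M] be the quadratic mean of [u] over the ball of radius [r] and put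
[U = {u > A M}].  The truncation [v = (u - A M)^+] vanishes off [U] and lies
between 0 and [u] on [U], so it is enough to know that [u] carries only a small
part of its square integral on [U] intersected with the half ball.  Three facts
combine.

- Energy.  Testing the subsolution inequality with [eta^2 u], for a smooth
  cutoff [eta] bounded below on the half ball, bounds the square integral of the
  gradient of [eta u] by [C / r^2] times that of [u] ([caccioppoli],
  [cutoff_energy]).

- Small sets.  For each [e > 0] there is [d > 0] such that, on every set of
  measure at most [d r^n], the integral of [phi^2] is at most [e] times the
  integral of [phi^2 + r^2 |grad phi|^2] over the whole space
  ([small_set_energy]).  This qualitative form of the Sobolev inequality is
  proved by induction on the dimension.  Slice the set by hyperplanes.  Slices of
  small measure are handled by induction; by Fubini the other slices have
  parameters in a set of length at most [(e / 2) r], and on any single slice the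
  integral of [phi^2] is bounded by the energy in the transversal direction,
  because in dimension one a square is at most an integral of
  [g^2 / r + r g'^2] ([sqr_le_line_integral], [integral_slice_sqr_le]).

- Chebyshev.  If [M > 0], the measure of [U] is at most that of the ball divided
  by [A^2].

The constants are chosen in the order [e], [d], [A]: first [e] so small that the
small-set bound, multiplied by the constants of the energy estimate, the cutoff
and the volume ratio of the two balls, gives a quarter; then [d] from the
small-set estimate; then [A] so large that [U] has measure at most
[(d / 2) r^n].  All inequalities scale with [r], so [A] depends on [n], [lam] and
[Lam] only, and the statement in the unit ball is the case [r = 1].

The facts above concern smooth functions, whereas [u] is only in [H^1].  The
bridge is [cutoff_approx]: mollifying [zeta u], for a cutoff [zeta] supported
well inside the ball, gives test functions of the ball that converge to [zeta u]
in square mean together with their gradients.  It shows that [eta^2 u] belongs to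
[H^1_0] ([cutoff_H10]) and transfers the small-set estimate to [eta u]
([cutoff_small_set]).  It rests on the convergence in square mean of
mollifications of a square integrable function ([L2b_mollifiable]):
Young's inequality makes the good functions a closed class, which contains the
continuous ones, then indicators of Borel sets, of Lebesgue measurable sets,
simple functions, and finally all square integrable functions of bounded
support. *)

Set Implicit Arguments.
Unset Strict Implicit.
Unset Printing Implicit Defensive.

Import Order.TTheory GRing.Theory Num.Theory.
Import numFieldNormedType.Exports.

Local Open Scope classical_set_scope.
Local Open Scope ring_scope.

(** * Borel and Lebesgue measure on R^n *)

Section borel_measurability.
Context {R : realType} {n : nat}.

Lemma mx_norm_coord (x : 'rV[R]_n) i : `|x 0 i| <= `|x|.
Proof.
rewrite [leRHS]/Num.norm/= mx_normrE.
exact: (@le_bigmax _ _ _ 0 (fun j : 'I_1 * 'I_n => `|x j.1 j.2|) (0, i)).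
Qed.

Lemma mx_norm_le (x : 'rV[R]_n) e : 0 <= e -> (forall i, `|x 0 i| <= e) -> `|x| <= e.
Proof.
move=> e0 xe; rewrite [leLHS]/Num.norm/= mx_normrE; apply: bigmax_le => // -[i j] _ /=.
by rewrite ord1.
Qed.

Let grid (k : nat) (x : 'rV[R]_n) : 'rV[int]_n :=
  \row_i Num.floor (k.+1%:R * x 0 i).

Let ungrid (k : nat) (z : 'rV[int]_n) : 'rV[R]_n :=
  \row_i (k.+1%:R^-1 * (z 0 i)%:~R).

Let grid_measurable k (z : 'rV[int]_n) :
  measurable [set x : 'rV[R]_n | grid k x = z].
Proof.
rewrite (_ : [set _ | _] = \bigcap_(i in [set: 'I_n])
  (rV_coord i @^-1` [set t | Num.floor (k.+1%:R * t) = z 0 i])); last first.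
  apply/seteqP; split => x /=.
    by move=> <- i _; rewrite /= mxE.
  by move=> h; apply/rowP => i; rewrite mxE; exact: h.
apply: fin_bigcap_measurable => // i _; rewrite -[X in measurable X]setTI.
apply: measurable_rV_coord => //.
rewrite (_ : [set t | _] =
  `[k.+1%:R^-1 * (z 0 i)%:~R, k.+1%:R^-1 * (z 0 i + 1)%:~R[%classic) //.
apply/seteqP; split => t /=; rewrite in_itv/= ler_pdivrMl// ltr_pdivlMl// -floor_eq.
  by move=> ->.
by move=> /eqP.
Qed.

(** The sigma-algebra is generated by the coordinates, so openness of preimages
does not help directly.  A continuous function is instead the pointwise limit of
its compositions with rounding to the grid of mesh [1 / (k + 1)], and these take
countably many values on cells that are products of intervals. *)
Lemma continuous_rV_measurable (f : 'rV[R]_n -> R) :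
  continuous f -> measurable_fun setT f.
Proof.
move=> cf.
apply: (@measurable_fun_cvg _ _ _ _ (fun k x => f (ungrid k (grid k x)))).
  move=> k _ Y _; rewrite setTI.
  rewrite (_ : _ @^-1` _ = \bigcup_(z : 'rV[int]_n)
      [set x | grid k x = z /\ Y (f (ungrid k z))]); last first.
    apply/seteqP; split => x /=; first by move=> h; exists (grid k x).
    by move=> [z _ /= [<-]].
  apply: countable_bigcupT_measurable => [|z]; first exact: countableP.
  have [Yz|nYz] := pselect (Y (f (ungrid k z))).
    rewrite (_ : [set _ | _] = [set x | grid k x = z]) //.
    by apply/seteqP; split => x /= => [[]|].
  rewrite (_ : [set _ | _] = set0) //.
  by apply/seteqP; split => x //= [].
move=> x _; apply: (continuous_cvg _ (cf x)).
apply/cvgrPdist_le => e e0.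
near=> k.
apply: mx_norm_le => [|i]; first exact: ltW.
rewrite !mxE; set t := x 0 i.
have k0 : 0 < k.+1%:R :> R by [].
have -> : t - k.+1%:R^-1 * (Num.floor (k.+1%:R * t))%:~R =
          k.+1%:R^-1 * (k.+1%:R * t - (Num.floor (k.+1%:R * t))%:~R).
  by rewrite mulrBr mulKf// gt_eqF.
rewrite normrM ger0_norm ?invr_ge0//.
have /andP[h1 h2] := floor_itv (k.+1%:R * t).
apply: (@le_trans _ _ (k.+1%:R^-1)).
  rewrite ler_piMr// ger0_norm ?subr_ge0//.
  by move: h2; rewrite intrD; lra.
by near: k; apply: filterS (near_infty_natSinv_lt (PosNum e0)) => k /ltW.
Unshelve. all: by end_near. Qed.

End borel_measurability.

Section lebesgue_transfer.
Context {R : realType} {n : nat}.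
Local Notation mu := (lebesgue R n).
Local Notation m := (@borel_lebesgue R n).

Lemma borel_Rn_measurable (A : set 'rV[R]_n) :
  measurable A -> measurable (A : set (Rn R n)).
Proof. exact: caratheodory_measurable_mu_ext. Qed.

Lemma borel_Rn_measurable_fun d (T : measurableType d) (f : 'rV[R]_n -> T) :
  measurable_fun setT f -> measurable_fun (setT : set (Rn R n)) f.
Proof.
by move=> mf _ Y mY; apply: borel_Rn_measurable; apply: mf.
Qed.

Lemma lebesgueE (A : set 'rV[R]_n) : measurable A -> mu A = m A.
Proof. exact: measurable_mu_extE. Qed.

Let Rn_id (x : Rn R n) : 'rV[R]_n := x.

Let measurable_Rn_id : measurable_fun setT Rn_id.
Proof. by move=> _ Y mY; rewrite setTI; exact: borel_Rn_measurable. Qed.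

(** The completed measure has more measurable sets but agrees with the product
measure on Borel sets; pushing forward along the identity from [Rn] to the Borel
space transfers integrals. *)
Lemma ge0_integral_lebesgueE (D : set 'rV[R]_n) (f : 'rV[R]_n -> \bar R) :
  measurable D -> measurable_fun D f -> (forall x, (0 <= f x)%E) ->
  (\int[mu]_(x in D) f x = \int[m]_(x in D) f x)%E.
Proof.
move=> mD mf f0.
have := @ge0_integral_pushforward _ _ _ _ _ Rn_id measurable_Rn_id mu D f mD mf
  (fun x _ => f0 x).
rewrite preimage_id => <-.
by apply: eq_measure_integral => A mA _; exact: lebesgueE.
Qed.

(** The measure of [E] is an infimum over countable Borel covers. *)
Lemma lebesgue_outer_approx (E : set (Rn R n)) e : 0 < e ->
  (mu E < +oo)%E ->
  exists B : set 'rV[R]_n, [/\ measurable B, E `<=` B & (m B <= mu E + e%:E)%E].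
Proof.
move=> e0 Efin.
have : mu E \is a fin_num by rewrite ge0_fin_numE.
move/lb_ereal_inf_adherent => /(_ _ e0).
case => _ [F [mF EF] <-] h.
exists (\bigcup_k F k); split => //.
  exact: bigcupT_measurable.
apply: le_trans (ltW h).
by apply: measure_sigma_subadditive => //; exact: bigcupT_measurable.
Qed.

End lebesgue_transfer.

Section borel_lebesgue_theory.
Context {R : realType}.
Local Notation m n := (@borel_lebesgue R n).

Lemma lebesgue_measure_refl (c : R) (A : set (measurableTypeR R)) : measurable A ->
  pushforward (@lebesgue_measure R) (fun t : R => c - t : measurableTypeR R) A = lebesgue_measure A.
Proof.
have mf : measurable_fun setT (fun t : R => c - t : measurableTypeR R).
  exact: measurable_funB.
move=> mA; apply/esym/lebesgue_measure_unique => //= _ [[a b]] _ <-.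
rewrite /pushforward.
rewrite (_ : _ @^-1` _ = `[c - b, c - a[%classic); last first.
  apply/seteqP; split => t /=; rewrite !in_itv/=.
    by move=> /andP[h1 h2]; apply/andP; split; lra.
  by move=> /andP[h1 h2]; apply/andP; split; lra.
rewrite !lebesgue_measure_itv/= !lte_fin.
rewrite (_ : (c - b < c - a) = (a < b)); last by apply/idP/idP; lra.
by case: ifP => // _; rewrite -!EFinB; congr EFin; lra.
Qed.

Lemma ge0_integral_refl (c : R) (f : R -> \bar R) :
  measurable_fun setT f -> (forall t, (0 <= f t)%E) ->
  (\int[lebesgue_measure]_t f (c - t)%R = \int[lebesgue_measure]_t f t)%E.
Proof.
move=> mf f0.
have mc : @measurable_fun _ _ (measurableTypeR R) (measurableTypeR R) setT (fun t : R => c - t).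
  exact: measurable_funB.
have := @ge0_integral_pushforward _ _ _ _ _ _ mc (@lebesgue_measure R) setT f
  measurableT mf (fun x _ => f0 x).
rewrite preimage_setT => <-.
by apply: eq_measure_integral => A mA _; exact: lebesgue_measure_refl.
Qed.

Lemma borel_lebesgueS n (A : set 'rV[R]_n.+1) : measurable A ->
  (m n.+1 A = \int[lebesgue_measure]_t m n [set y | A (rV_cons (t, y))])%E.
Proof.
move=> mA.
rewrite [LHS]/= /lebesgue_cons /pushforward /product_measure1/=.
apply: eq_integral => t _; congr (borel_lebesgue _ _).
by apply/seteqP; split => y; rewrite /xsection/= inE.
Qed.

Lemma ge0_integral_borelS n (f : 'rV[R]_n.+1 -> \bar R) :
  measurable_fun setT f -> (forall x, (0 <= f x)%E) ->
  (\int[m n.+1]_x f x =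
   \int[lebesgue_measure]_t \int[m n]_y f (rV_cons (t, y)))%E.
Proof.
move=> mf f0.
rewrite [LHS](_ : _ = \int[pushforward (lebesgue_measure \x m n)%E (@rV_cons R n)]_x f x)%E//.
rewrite ge0_integral_pushforward//; last exact: measurable_rV_cons.
rewrite preimage_setT fubini_tonelli1//.
  by apply: measurableT_comp => //; exact: measurable_rV_cons.
by move=> p; exact: f0.
Qed.

Lemma measurable_slice n (A : set 'rV[R]_n.+1) : measurable A ->
  measurable [set p | A (@rV_cons R n p)].
Proof.
by move=> mA; rewrite -[X in measurable X]setTI; exact: measurable_rV_cons.
Qed.

Lemma measurable_rV_refl n (x : 'rV[R]_n) : measurable_fun setT (fun y : 'rV[R]_n => x - y).
Proof.
apply: measurable_rV_coordP => i.
rewrite (_ : _ \o _ = (fun y => x 0 i - rV_coord i y)); last first.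
  by apply/funext => y; rewrite /= /rV_coord !mxE.
by apply: measurable_funB => //; exact: measurable_rV_coord.
Qed.

Lemma rV_subE n (x y : 'rV[R]_n) i : (x - y) 0 i = x 0 i - y 0 i.
Proof. by rewrite !mxE. Qed.

Lemma rV_cons_sub n (x : 'rV[R]_n.+1) t y :
  x - rV_cons (t, y) = rV_cons (x 0 0 - t, (rV_uncons x).2 - y).
Proof.
rewrite -[x in LHS]rV_unconsK; apply/rowP => i.
rewrite rV_subE; case: (unliftP ord0 i) => [j ->|->].
  by rewrite !rV_consS rV_subE.
by rewrite !rV_cons0.
Qed.

(** Reflection [y |-> x - y] rather than translation is what a convolution needs;
it follows slice by slice from dimension one. *)
Lemma borel_lebesgue_refl n (x : 'rV[R]_n) A : measurable A ->
  m n [set y | A (x - y)] = m n A.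
Proof.
elim: n x A => [x A mA|n IHn x A mA].
  congr (borel_lebesgue _ _); apply/seteqP.
  by split => y /=; rewrite (thinmx0 (x - y)) (thinmx0 y).
rewrite !borel_lebesgueS//; last first.
  by rewrite -[X in measurable X]setTI; exact: measurable_rV_refl.
transitivity (\int[lebesgue_measure]_t (fun t => m n [set y | A (rV_cons (t, y))]) (x 0 0 - t)%R)%E.
  apply: eq_integral => t _ /=.
  rewrite -[RHS](IHn (rV_uncons x).2); last first.
    have := measurable_xsection (x 0 0 - t) (measurable_slice mA).
    by rewrite /xsection/=; under eq_set do rewrite inE/=.
  by congr (borel_lebesgue _ _); apply/seteqP; split => y /=; rewrite rV_cons_sub.
apply: ge0_integral_refl => //.
have := measurable_fun_xsection (m n) (measurable_slice mA).
apply: eq_measurable_fun => t _ /=; congr (borel_lebesgue _ _).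
by apply/seteqP; split => y /=; rewrite /xsection/= inE.
Qed.

Lemma borel_lebesgue_box n (a : R) : 0 < a ->
  measurable [set x : 'rV[R]_n | forall i, `|x 0 i| < a] /\
  m n [set x | forall i, `|x 0 i| < a] = ((2 * a) ^+ n)%:E.
Proof.
move=> a0.
have mB k : measurable [set x : 'rV[R]_k | forall i, `|x 0 i| < a].
  rewrite (_ : [set _ | _] = \bigcap_(i in [set: 'I_k])
     (rV_coord i @^-1` [set t | `|t| < a])); last first.
    by apply/seteqP; split => x /= h i; [move=> _|]; exact: h.
  apply: fin_bigcap_measurable => // i _; rewrite -[X in measurable X]setTI.
  apply: measurable_rV_coord => //.
  rewrite (_ : [set t | _] = `]-a, a[%classic) //.
  by apply/seteqP; split => t /=; rewrite in_itv/= ltr_norml.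
split=> //; elim: n => [|n IHn].
  rewrite expr0 /= diracE mem_set// => i; case: i => //.
rewrite borel_lebesgueS//.
transitivity (\int[lebesgue_measure]_(t in [set t : R | (`|t| < a)%R]) ((2 * a) ^+ n)%R%:E)%E.
  rewrite [RHS]integral_mkcond; apply: eq_integral => t _ /=.
  rewrite patchE; case: ifPn => [|/negP].
    rewrite inE/= => ta; rewrite -IHn.
    congr (borel_lebesgue _ _); apply/seteqP; split => y /= h i.
      by have := h (lift ord0 i); rewrite rV_consS.
    by case: (unliftP ord0 i) => [j ->|->]; rewrite ?rV_consS ?rV_cons0.
  rewrite inE/= => ta.
  rewrite (_ : [set _ | _] = set0) ?measure0//.
  by apply/seteqP; split => y //= /(_ ord0); rewrite rV_cons0.
have -> : [set t : R | `|t| < a] = `]-a, a[%classic.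
  by apply/seteqP; split => t /=; rewrite in_itv/= ltr_norml.
rewrite integral_cst//= lebesgue_measure_itv/= lte_fin ifT; last lra.
by rewrite -EFinB -EFinM exprS; congr EFin; ring.
Qed.

End borel_lebesgue_theory.

Section lebesgue_theory.
Context {R : realType} {n : nat}.
Local Notation mu := (lebesgue R n).
Local Notation m := (@borel_lebesgue R n).

HB.instance Definition _ := Measure_isSigmaFinite.Build _ _ _
  (@completed_measure_extension _ _ _ m)
  (@completed_measure_extension_sigma_finite _ _ _ m (sigma_finiteT m)).

(** The same measure with its sigma-finite structure, which Tonelli's theorem
asks for. *)
Definition lebesgue_sf : {sigma_finite_measure set (Rn R n) -> \bar R} :=
  @completed_measure_extension _ _ _ m.

Lemma ge0_integral_lebesgue_refl (x : 'rV[R]_n) (f : 'rV[R]_n -> \bar R) :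
  measurable_fun setT f -> (forall x, (0 <= f x)%E) ->
  (\int[mu]_y f (x - y)%R = \int[mu]_y f y)%E.
Proof.
move=> mf f0; rewrite [RHS]ge0_integral_lebesgueE//.
have mphi : @measurable_fun _ _ (Rn R n) 'rV[R]_n setT (fun y => x - y).
  by apply: borel_Rn_measurable_fun; exact: measurable_rV_refl.
have := @ge0_integral_pushforward _ _ _ _ _ _ mphi mu setT f measurableT mf
  (fun x _ => f0 x).
rewrite preimage_setT => <-.
apply: eq_measure_integral => A mA _.
transitivity (m [set y | A (x - y)]); last exact: borel_lebesgue_refl.
apply: lebesgueE.
by rewrite -[X in measurable X]setTI; exact: measurable_rV_refl.
Qed.

Lemma Rintegral_lebesgue_refl (x : 'rV[R]_n) (f : 'rV[R]_n -> R) :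
  measurable_fun setT f -> mu.-integrable setT (EFin \o f) ->
  \int[mu]_y f (x - y) = \int[mu]_y f y.
Proof.
move=> mf intf.
have mEf : measurable_fun setT (EFin \o f) by exact/measurable_EFinP.
have mphi : @measurable_fun _ _ (Rn R n) 'rV[R]_n setT (fun y => x - y).
  by apply: borel_Rn_measurable_fun; exact: measurable_rV_refl.
have mid : @measurable_fun _ _ (Rn R n) 'rV[R]_n setT (fun y => y).
  exact: borel_Rn_measurable_fun.
congr fine.
have := @integral_pushforward _ _ _ _ _ _ mid mu setT (EFin \o f) mEf intf measurableT.
rewrite preimage_setT => <-.
have int2 : mu.-integrable ((fun y : 'rV[R]_n => x - y) @^-1` setT)
    ((EFin \o f) \o (fun y => x - y)).
  rewrite preimage_setT; apply/integrableP; split.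
    by apply: measurableT_comp => //.
  move/integrableP : intf => [_]; apply: le_lt_trans.
  rewrite (ge0_integral_lebesgue_refl x (f := fun y => `|(f y)%:E|%E))//.
  by apply: measurableT_comp.
have := @integral_pushforward _ _ _ _ _ _ mphi mu setT (EFin \o f) mEf int2 measurableT.
rewrite preimage_setT => <-.
apply: eq_measure_integral => A mA _.
transitivity (m A); last exact/esym/lebesgueE.
transitivity (m [set y | A (x - y)]); last exact: borel_lebesgue_refl.
apply: lebesgueE.
by rewrite -[X in measurable X]setTI; exact: measurable_rV_refl.
Qed.

Lemma lebesgue_tonelli (f : Rn R n * Rn R n -> \bar R) :
  measurable_fun setT f -> (forall p, (0 <= f p)%E) ->
  (\int[mu]_x \int[mu]_y f (x, y) = \int[mu]_y \int[mu]_x f (x, y))%E.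
Proof. by move=> mf f0; exact: (@fubini_tonelli _ _ _ _ _ lebesgue_sf lebesgue_sf). Qed.

Definition nsq (x : 'rV[R]_n) : R := \sum_(i < n) x 0 i ^+ 2.

Lemma nsq_ge0 x : 0 <= nsq x.
Proof. by apply: sumr_ge0 => i _; exact: sqr_ge0. Qed.

Lemma eballE r : 0 < r -> eball r = [set x | nsq x < r ^+ 2].
Proof.
move=> r0; apply/seteqP; split => x /= h.
  rewrite -[nsq x]sqr_sqrtr ?nsq_ge0//.
  by rewrite ltr_sqr// nnegrE ?sqrtr_ge0// ltW.
rewrite (_ : r = Num.sqrt (r ^+ 2)); last by rewrite sqrtr_sqr ger0_norm// ltW.
by rewrite /eball/= /enorm ltr_sqrt// exprn_gt0.
Qed.

Lemma measurable_nsq : measurable_fun setT nsq.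
Proof.
apply: measurable_sum => i.
by apply: measurable_funX; exact: measurable_rV_coord.
Qed.

Lemma measurable_eball r : 0 < r -> measurable (@eball R n r).
Proof.
move=> r0; rewrite eballE// -[X in measurable X]setTI.
have := measurable_nsq measurableT (measurable_itv `]-oo, (r ^+ 2)[).
by rewrite (_ : nsq @^-1` _ = [set x | nsq x < r ^+ 2])//; apply/seteqP; split => x /=; rewrite in_itv.
Qed.

Lemma coord_le_nsq (x : 'rV[R]_n) i : x 0 i ^+ 2 <= nsq x.
Proof.
by rewrite /nsq (bigD1 i)//= lerDl; apply: sumr_ge0 => j _; exact: sqr_ge0.
Qed.

Lemma mx_norm_nsq (x : 'rV[R]_n) r : 0 <= r -> nsq x <= r ^+ 2 -> `|x| <= r.
Proof.
move=> r0 h; apply: mx_norm_le => // i.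
rewrite -ler_sqr ?nnegrE// real_normK ?num_real//.
exact: le_trans (coord_le_nsq _ _) h.
Qed.

Lemma nsqD (x y : 'rV[R]_n) : nsq (x + y) <= 2 * nsq x + 2 * nsq y.
Proof.
rewrite /nsq !mulr_sumr -big_split/=; apply: ler_sum => i _.
by rewrite mxE; have := sqr_ge0 (x 0 i - y 0 i); rewrite !expr2; lra.
Qed.

Lemma nsqN (x : 'rV[R]_n) : nsq (- x) = nsq x.
Proof. by apply: eq_bigr => i _; rewrite mxE sqrrN. Qed.

Lemma lebesgue_eball_le r : 0 < r -> (mu (eball r) <= ((2 * r) ^+ n)%:E)%E.
Proof.
move=> r0; have [mB <-] := @borel_lebesgue_box R n r r0.
rewrite lebesgueE; last exact: measurable_eball.
apply: le_measure; rewrite ?inE//; first exact: measurable_eball.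
rewrite eballE// => x /= h i.
rewrite -ltr_sqr ?nnegrE ?(ltW r0)// real_normK ?num_real//.
exact: le_lt_trans (coord_le_nsq _ _) h.
Qed.

(** The ball contains the cube of half side [r / n], since [n (r / n)^2 <= r^2]. *)
Lemma lebesgue_eball_ge r : (0 < n)%N -> 0 < r ->
  (((2 * (r / n%:R)) ^+ n)%:E <= mu (eball r))%E.
Proof.
move=> n0 r0.
have n0' : 0 < n%:R :> R by rewrite ltr0n.
have [mB <-] := @borel_lebesgue_box R n (r / n%:R) (divr_gt0 r0 n0').
rewrite lebesgueE; last exact: measurable_eball.
apply: le_measure; rewrite ?inE//; first exact: measurable_eball.
rewrite eballE// => x /= h.
have : nsq x < \sum_(i < n) (r / n%:R) ^+ 2.
  apply: ltr_sum; first by apply/hasP; exists (Ordinal n0).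
  move=> i _; rewrite -[x 0 i ^+ 2]real_normK ?num_real//.
  by rewrite ltr_sqr ?nnegrE ?divr_ge0 ?(ltW r0).
move/lt_le_trans; apply.
rewrite sumr_const card_ord -[_ *+ n]mulr_natr exprMn -mulrA ler_piMr ?sqr_ge0//.
rewrite exprVn expr2 invfM -mulrA mulVf ?gt_eqF// mulr1 invf_le1//.
by rewrite ler1n.
Qed.

Definition cube (a : R) : set 'rV[R]_n := [set x | `|x| <= a].

Lemma measurable_cube a : measurable (cube a).
Proof.
have mn : measurable_fun setT (fun x : 'rV[R]_n => `|x|).
  exact: continuous_rV_measurable (@norm_continuous _ _).
rewrite -[X in measurable X]setTI.
rewrite (_ : cube a = (fun x : 'rV[R]_n => `|x|) @^-1` `]-oo, a]%classic).
  exact: mn.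
by apply/seteqP; split => x /=; rewrite in_itv.
Qed.

Lemma lebesgue_cube_lty a : (mu (cube a) < +oo)%E.
Proof.
have a0 : 0 < `|a| + 1 by rewrite ltr_wpDl.
have [mB mBE] := @borel_lebesgue_box R n _ a0.
rewrite lebesgueE; last exact: measurable_cube.
apply: (@le_lt_trans _ _ (((2 * (`|a| + 1)) ^+ n)%:E)); last exact: ltry.
rewrite -mBE; apply: le_measure; rewrite ?inE//; first exact: measurable_cube.
move=> x /= xa i; apply: le_lt_trans (mx_norm_coord _ _) _.
by apply: le_lt_trans xa _; rewrite (le_lt_trans (ler_norm _))// ltrDl.
Qed.

End lebesgue_theory.

(** * Smooth functions and their partial derivatives *)

Section smooth_calculus.
Context {R : realType} {n : nat}.
Local Notation V := 'rV[R]_n.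
Implicit Types (f g : V -> R) (x : V).

(** Smoothness quantifies over all iterated partial derivatives; it suffices to
exhibit a class of continuous differentiable functions stable under partial
derivatives. *)
Lemma smooth_coind (S : set (V -> R)) :
  (forall f, S f -> continuous f /\
    forall i, (forall x, derivable f x (delta_mx 0 i)) /\ S (partial i f)) ->
  forall f, S f -> smooth f.
Proof.
move=> HS f Sf s.
have Sg : S (foldr partial f s) by elim: s => //= i s /HS[_ /(_ i)[]].
by have [c d] := HS _ Sg; split => // x i; exact: (d i).1.
Qed.

Lemma smooth_continuous f : smooth f -> continuous f.
Proof. by move=> /(_ [::])[]. Qed.

Lemma smooth_derivable f x i : smooth f -> derivable f x (delta_mx 0 i).
Proof. by move=> /(_ [::])[_ +]; apply. Qed.

Lemma smooth_partial f i : smooth f -> smooth (partial i f).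
Proof. by move=> sf s; have := sf (rcons s i); rewrite foldr_rcons. Qed.

Lemma partialM f g i : (forall x, derivable f x (delta_mx 0 i)) ->
  (forall x, derivable g x (delta_mx 0 i)) ->
  partial i (fun x => f x * g x) = (fun x => f x * partial i g x + partial i f x * g x).
Proof.
move=> df dg; apply/funext => x.
rewrite /partial (_ : (fun x => f x * g x) = f * g)//.
by rewrite deriveM// /GRing.scale/= [g x * _]mulrC.
Qed.

Lemma partialD f g i : (forall x, derivable f x (delta_mx 0 i)) ->
  (forall x, derivable g x (delta_mx 0 i)) ->
  partial i (fun x => f x + g x) = (fun x => partial i f x + partial i g x).
Proof. by move=> df dg; apply/funext => x; exact: deriveD. Qed.

Lemma partial_cst c i : partial i (cst c) = cst 0 :> (V -> R).
Proof. by apply/funext => x; exact: derive_cst. Qed.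

(** By the Leibniz rule, the functions generated by [G] under sums and products
are stable under partial derivatives as soon as the partial derivatives of the
generators are among them.  All smoothness proofs for explicit functions go
through this closure. *)
Inductive alg_closure (G : set (V -> R)) : (V -> R) -> Prop :=
| alg_closure_sub f : G f -> alg_closure G f
| alg_closure_cst c : alg_closure G (fun=> c)
| alg_closureD f g : alg_closure G f -> alg_closure G g ->
    alg_closure G (fun x => f x + g x)
| alg_closureM f g : alg_closure G f -> alg_closure G g ->
    alg_closure G (fun x => f x * g x).

Lemma alg_closure_smooth (G : set (V -> R)) :
  (forall f, G f -> continuous f /\
    forall i, (forall x, derivable f x (delta_mx 0 i)) /\
      alg_closure G (partial i f)) ->
  forall f, alg_closure G f -> smooth f.
Proof.
move=> HG; apply: smooth_coind => f; elim=> {f}.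
- by move=> f /HG.
- move=> c; split; first exact: cst_continuous.
  move=> i; split => [x|]; first exact: derivable_cst.
  by rewrite (partial_cst c); exact: alg_closure_cst.
- move=> f g _ [cf df] _ [cg dg]; split.
    by move=> x; exact: (cvgD (cf x) (cg x)).
  move=> i; split => [x|].
    exact: (derivableD ((df i).1 x) ((dg i).1 x)).
  rewrite partialD; [|exact: (df i).1|exact: (dg i).1].
  by apply: alg_closureD; [exact: (df i).2|exact: (dg i).2].
- move=> f g Sf [cf df] Sg [cg dg]; split.
    by move=> x; exact: (cvgM (cf x) (cg x)).
  move=> i; split => [x|].
    exact: (derivableM ((df i).1 x) ((dg i).1 x)).
  rewrite partialM; [|exact: (df i).1|exact: (dg i).1].
  by apply: alg_closureD; apply: alg_closureM => //; [exact: (dg i).2|exact: (df i).2].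
Qed.

Let smooth_closure f : alg_closure (@smooth R n) f -> smooth f.
Proof.
apply: alg_closure_smooth => {}f sf; split; first exact: smooth_continuous.
move=> i; split=> [x|]; first exact: smooth_derivable.
exact/alg_closure_sub/smooth_partial.
Qed.

Lemma smooth_cst (c : R) : smooth ((fun=> c) : V -> R).
Proof. exact/smooth_closure/alg_closure_cst. Qed.

Lemma smoothM f g : smooth f -> smooth g -> smooth (fun x => f x * g x).
Proof. by move=> sf sg; apply/smooth_closure/alg_closureM; exact: alg_closure_sub. Qed.

Lemma smoothN f : smooth f -> smooth (fun x => - f x).
Proof.
move=> sf; rewrite (_ : (fun x => - f x) = (fun x => -1 * f x)).
  by apply: smoothM => //; exact: (smooth_cst (-1)).
by apply/funext => x /=; rewrite mulN1r.
Qed.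

Lemma is_derive_line f z v : (forall x, derivable f x v) ->
  forall t : R, is_derive t 1 (fun t : R => f (t *: v + z)) ('D_v f (t *: v + z)).
Proof.
move=> df t.
have E : (fun h : R => h^-1 *: (f ((h *: 1 + t) *: v + z) - f (t *: v + z)))
    = (fun h => h^-1 *: (f (h *: v + (t *: v + z)) - f (t *: v + z))).
  by apply/funext => h; rewrite scalerDl addrA /GRing.scale/= mulr1.
split; first by rewrite /derivable E; exact: df.
by rewrite /derive E.
Qed.

Let refl_line f z i (df : forall x, derivable f x (delta_mx 0 i)) x :
  is_derive x (delta_mx 0 i) (fun y => f (z - y)) (- partial i f (z - x)).
Proof.
set v := delta_mx 0 i.
pose g (t : R) := f (t *: v + (z - x)).
have dg : is_derive (0 : R) 1 (g \o -%R) ('D_v f (z - x) * -1).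
  apply: is_derive1_comp; rewrite oppr0.
  by have := is_derive_line (z - x) df 0; rewrite scale0r add0r.
have E : (fun h : R => h^-1 *: (f (z - (h *: v + x)) - f (z - x))) =
         (fun h : R => h^-1 *: ((g \o -%R) (h *: 1 + 0) - (g \o -%R) 0)).
  apply/funext => h; rewrite /g/= oppr0 scale0r add0r addr0 /GRing.scale/= mulr1.
  congr (_ * (f _ - _)).
  rewrite [RHS](_ : _ = (- h) *: v + (z - x))// scaleNr opprD.
  exact: addrCA.
case: dg => d1 d2.
split; first by rewrite /derivable E; exact: d1.
by rewrite /derive E; move: d2; rewrite /derive => ->; rewrite mulrN1.
Qed.

Lemma partial_refl f z i : smooth f ->
  partial i (fun y => f (z - y)) = (fun y => - partial i f (z - y)).
Proof.
move=> sf; apply/funext => x.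
have df y : derivable f y (delta_mx 0 i) by exact: smooth_derivable.
by case: (refl_line z df x).
Qed.

Lemma smooth_refl f z : smooth f -> smooth (fun y => f (z - y)).
Proof.
move=> sf.
apply: (@smooth_coind [set f | exists2 g, smooth g & f = fun y => g (z - y)]);
  last by exists f.
move=> _ [g sg ->]; split.
  move=> x.
  have cz : {for x, continuous (fun y : V => z - y)}.
    exact: (@cvgB _ V _ (nbhs x) _ (cst z) id z x (cvg_cst z) cvg_id).
  exact: (continuous_comp cz (@smooth_continuous g sg (z - x))).
move=> i; split => [x|].
  have dg y : derivable g y (delta_mx 0 i) by exact: smooth_derivable.
  by case: (refl_line z dg x).
rewrite partial_refl//; exists (fun y => - partial i g y) => //.
exact/smoothN/smooth_partial.
Qed.

Lemma line_lipschitz f v C : (forall x, derivable f x v) ->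
  (forall x, `|'D_v f x| <= C) ->
  forall z (t : R), `|f (t *: v + z) - f z| <= C * `|t|.
Proof.
move=> df dC.
have main z (t : R) : 0 < t -> `|f (t *: v + z) - f z| <= C * `|t|.
  move=> t0.
  have [c _] := @MVT_segment R (fun t : R => f (t *: v + z)) (fun t : R => 'D_v f (t *: v + z))
    0 t (ltW t0) (fun s _ => is_derive_line z df s)
    (derivable_within_continuous (fun s _ =>
       @ex_derive _ _ _ _ _ _ _ (is_derive_line z df s))).
  rewrite scale0r add0r subr0 => ->.
  by rewrite normrM ler_wpM2r.
move=> z t; case: (ltgtP t 0) => [t0|/main//|->]; last first.
  by rewrite scale0r add0r subrr !normr0 mulr0.
have := main (t *: v + z) (- t); rewrite oppr_gt0 => /(_ t0).
by rewrite scaleNr addKr distrC normrN.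
Qed.

End smooth_calculus.

(** * Smooth radial bumps *)

Section flat.
Context {R : realType}.

(** The family [t^-k exp(-1/t)], extended by 0 to [t <= 0], is stable under
derivation up to linear combinations ([is_derive_flat]); hence its members are
smooth. *)
Definition flat (k : nat) (t : R) : R :=
  if 0 < t then t^-1 ^+ k * expR (- t^-1) else 0.

Lemma flat_ge0 k t : 0 <= flat k t.
Proof.
rewrite /flat; case: ifP => // t0.
by rewrite mulr_ge0 ?expR_ge0// exprn_ge0// invr_ge0 ltW.
Qed.

Lemma flat0_gt0 t : 0 < t -> 0 < flat 0 t.
Proof. by move=> t0; rewrite /flat t0 expr0 mul1r expR_gt0. Qed.

Lemma flat0_le1 t : flat 0 t <= 1.
Proof.
rewrite /flat; case: ifP => // t0; rewrite expr0 mul1r.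
by rewrite -expR0 ler_expR oppr_le0 invr_ge0 ltW.
Qed.

Lemma flat0_le (s t : R) : s <= t -> flat 0 s <= flat 0 t.
Proof.
move=> st; rewrite {1}/flat; case: ifP => [s0|_]; last exact: flat_ge0.
have t0 := lt_le_trans s0 st.
by rewrite /flat t0 !expr0 !mul1r ler_expR lerN2 lef_pV2.
Qed.

(** Linear smallness at 0 of the whole family gives differentiability at 0: the
difference quotient of [flat k] at 0 is [flat k.+1].  It comes from the term of
order [k + 1] of the exponential series. *)
Lemma flat_le k t : `|flat k t| <= (k.+1)`!%:R * `|t|.
Proof.
rewrite ger0_norm ?flat_ge0// /flat; case: ifP => [t0|_]; last first.
  by rewrite mulr_ge0.
have s0 : 0 <= t^-1 by rewrite invr_ge0 ltW.
have f0 : 0 < (k.+1)`!%:R :> R by rewrite ltr0n fact_gt0.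
have := expR_ge1Dxn k s0 => h.
have {}h : t^-1 ^+ k.+1 / (k.+1)`!%:R <= expR t^-1.
  by apply: le_trans h; rewrite lerDr.
rewrite expRN ler_pdivrMr ?expR_gt0// gtr0_norm//.
rewrite ler_pdivrMr// in h.
rewrite -(ler_pM2l (_ : 0 < t^-1)) ?invr_gt0// -exprS.
apply: le_trans h _.
rewrite [leRHS](_ : _ = (t^-1 * t) * (expR t^-1 * k.+1`!%:R)); last by ring.
by rewrite mulVf ?mul1r ?gt_eqF.
Qed.

Lemma is_derive_flat k t :
  is_derive t (1 : R) (flat k) (- k%:R * flat k.+1 t + flat k.+2 t).
Proof.
have [t0|t0|->] := ltgtP t 0.
- apply: (@near_eq_is_derive _ _ _ (cst 0)).
    have : t \in `]-oo, 0%R[ by rewrite in_itv.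
    move/near_in_itvNyo; apply: filterS => s; rewrite in_itv/= => s0.
    by rewrite /flat ltNge ltW.
  by rewrite /flat ltNge ltW//= mulr0 addr0; exact: is_derive_cst.
- apply: (@near_eq_is_derive _ _ _ (fun s : R => s^-1 ^+ k * expR (- s^-1))).
    have : t \in `]0%R, +oo[ by rewrite in_itv/= t0.
    move/near_in_itvoy; apply: filterS => s; rewrite in_itv/= andbT => s0.
    by rewrite /flat s0.
  have t1 : t != 0 by rewrite gt_eqF.
  rewrite /flat t0.
  have dV : is_derive t (1 : R) (fun s : R => s^-1) (- t ^- 2).
    have h := @is_deriveV R id t 1 1 t1 (is_derive_id _ _).
    by apply: (is_derive_eq h); rewrite /GRing.scale/= mulr1.
  have dX : is_derive t (1 : R) (fun s : R => s^-1 ^+ k) (k%:R * t^-1 ^+ k.-1 * (- t ^- 2)).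
    have := is_deriveX k dV; rewrite exprfctE => h.
    by apply: (is_derive_eq h).
  have dN : is_derive t (1 : R) (fun s : R => - s^-1) (t ^- 2).
    by have h := is_deriveN dV; apply: (is_derive_eq h); rewrite opprK.
  have dE : is_derive t (1 : R) (fun s : R => expR (- s^-1)) (expR (- t^-1) * t ^- 2).
    exact: (@is_derive1_comp R expR (fun s : R => - s^-1) t _ _ (is_derive_expR _) dN).
  have h := is_deriveM dX dE.
  apply: (is_derive_eq h); rewrite /GRing.scale/=.
  have E2 : t ^- 2 = t^-1 ^+ 2 by rewrite exprVn.
  case: k {dX h} => [|k]; rewrite E2 !exprS/=; ring.
- rewrite /flat ltxx mulr0 addr0.
  have H : (fun h : R => h^-1 *: (flat k (h *: 1 + 0) - flat k 0)) @ 0^' --> (0 : R).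
    rewrite (_ : (fun h => _) = flat k.+1); last first.
      apply/funext => h; rewrite /flat addr0 ltxx subr0 /GRing.scale/= mulr1.
      by case: ifP => _; rewrite ?mulr0// mulrA -exprS.
    apply/cvgrPdist_le => e e0.
    near=> h; rewrite sub0r normrN (le_trans (flat_le _ _))//.
    rewrite -ler_pdivlMl ?ltr0n ?fact_gt0//.
    by near: h; apply: cvg_within; apply: (@nbhs0_le _ R); rewrite mulr_gt0 ?invr_gt0 ?ltr0n ?fact_gt0.
  split; first by apply/cvg_ex; exists 0.
  exact: cvg_lim H.
Unshelve. all: by end_near. Qed.

Lemma flat_derivable k t : derivable (flat k) t 1.
Proof. by case: (is_derive_flat k t). Qed.

Lemma flat_continuous k : continuous (flat k).
Proof. by move=> t; exact/differentiable_continuous/derivable1_diffP/flat_derivable. Qed.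

End flat.

Section flat_bump_smooth.
Context {R : realType} {n : nat}.
Local Notation V := 'rV[R]_n.
Implicit Types (f g : V -> R) (x : V).

Lemma is_derive_coord x v i : is_derive x v (fun x => x 0 i) (v 0 i).
Proof.
have H : (fun h : R => h^-1 *: ((h *: v + x) 0 i - x 0 i)) @ 0^' --> (v 0 i).
  apply: (@cvg_trans _ ((fun=> v 0 i) @ (0 : R)^')); last exact: cvg_cst.
  apply: near_eq_cvg; near=> h.
  rewrite !mxE addrK /GRing.scale/= mulKf//.
  by near: h; exact: nbhs_dnbhs_neq.
split; first by apply/cvg_ex; exists (v 0 i).
exact: cvg_lim H.
Unshelve. all: by end_near. Qed.

Lemma is_derive_nsq x v : is_derive x v (@nsq R n) (\sum_(i < n) 2 * x 0 i * v 0 i).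
Proof.
rewrite (_ : @nsq R n = \sum_(i < n) (fun x : V => x 0 i) ^+ 2); last first.
  apply/funext => y; rewrite /nsq fct_sumE; apply: eq_bigr => i _.
  by rewrite exprfctE.
have h := is_derive_sum (fun i => is_deriveX 2 (is_derive_coord x v i)).
by apply: (is_derive_eq h).
Qed.

Lemma continuous_nsq : continuous (@nsq R n).
Proof.
rewrite /nsq; apply: continuous_big => [|i _ x]; first exact: add_continuous.
have c : {for x, continuous (fun y : V => y 0 i)} by exact: coord_continuous.
exact: (cvgM c c).
Qed.

Definition flat_bump k (c a : R) x : R := flat k (c - a * nsq x).

(** A directional derivative is the derivative at 0 of a function of one real
variable, which reduces the claim to the one-variable chain rule. *)
Lemma is_derive_comp1 f (g : R -> R) x v df dg : is_derive x v f df ->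
  is_derive (f x) (1 : R) g dg -> is_derive x v (g \o f) (dg * df).
Proof.
move=> [d1 d2] hg.
pose F (t : R) := f (t *: v + x).
have E0 : (fun h : R => h^-1 *: (F (h *: 1 + 0) - F 0)) =
          (fun h => h^-1 *: (f (h *: v + x) - f x)).
  by apply/funext => h; rewrite /F scale0r add0r addr0 /GRing.scale/= mulr1.
have dF : is_derive (0 : R) (1 : R) F df.
  split; first by rewrite /derivable E0; exact: d1.
  by rewrite /derive E0; exact: d2.
have F0 : F 0 = f x by rewrite /F scale0r add0r.
rewrite -F0 in hg.
have [e1 e2] := is_derive1_comp hg dF.
have E1 : (fun h : R => h^-1 *: ((g \o F) (h *: 1 + 0) - (g \o F) 0)) =
          (fun h => h^-1 *: ((g \o f) (h *: v + x) - (g \o f) x)).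
  by apply/funext => h; rewrite /F/= scale0r add0r addr0 /GRing.scale/= mulr1.
split; first by move: e1; rewrite /derivable E1.
by move: e2; rewrite /derive E1.
Qed.

Lemma is_derive_flat_bump k c a x i : is_derive x (delta_mx 0 i) (flat_bump k c a)
  ((k%:R * flat_bump k.+1 c a x - flat_bump k.+2 c a x) * (2 * a * x 0 i)).
Proof.
have dn : is_derive x (delta_mx 0 i) (fun x => c - a * nsq x) (- (2 * a * x 0 i)).
  have h := is_deriveB (is_derive_cst c x (delta_mx 0 i)) (is_deriveZ a (is_derive_nsq x (delta_mx 0 i))).
  apply: (is_derive_eq h); rewrite sub0r; congr (- _).
  rewrite (bigD1 i)//= big1 ?addr0; last first.
    by move=> j ji; rewrite mxE eqxx (negbTE ji) mulr0.
  by rewrite mxE !eqxx mulr1 /GRing.scale/=; ring.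
have h := is_derive_comp1 dn (is_derive_flat k _).
by apply: (is_derive_eq h); rewrite /flat_bump; ring.
Qed.

Lemma continuous_flat_bump k c a : continuous (flat_bump k c a).
Proof.
move=> x.
have cz : {for x, continuous (fun y : V => c - a * nsq y)}.
  apply: (@cvgB _ R^o _ (nbhs x) _ (cst c)); first exact: cvg_cst.
  by apply: (@cvgMr _ _ (nbhs x)); exact: continuous_nsq.
exact: (continuous_comp cz (@flat_continuous R k _)).
Qed.

Let gen : set (V -> R) :=
  [set f | (exists i, f = fun x => x 0 i) \/ exists k c a, f = flat_bump k c a].

Lemma smooth_flat_bump k c a : smooth (flat_bump k c a : V -> R).
Proof.
apply: (@alg_closure_smooth _ _ gen); last first.
  by apply: alg_closure_sub; right; exists k, c, a.
move=> _ [[i ->]|[{}k [{}c [{}a ->]]]].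
  split; first exact: coord_continuous.
  move=> j; split => [x|]; first by case: (is_derive_coord x (delta_mx 0 j) i).
  rewrite (_ : partial j _ = (fun=> (delta_mx 0 j : V) 0 i)).
    exact: alg_closure_cst.
  by apply/funext => x; case: (is_derive_coord x (delta_mx 0 j) i).
split; first exact: continuous_flat_bump.
move=> i; split => [x|]; first by case: (is_derive_flat_bump k c a x i).
rewrite (_ : partial i _ = (fun x =>
    (k%:R * flat_bump k.+1 c a x + (- 1) * flat_bump k.+2 c a x) * (2 * a * x 0 i))).
  have gb j : alg_closure gen (flat_bump j c a).
    by apply: alg_closure_sub; right; exists j, c, a.
  apply: alg_closureM.
    by apply: alg_closureD; apply: alg_closureM => //; exact: alg_closure_cst.
  apply: alg_closureM; first exact: alg_closure_cst.
  by apply: alg_closure_sub; left; exists i.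
apply/funext => x; case: (is_derive_flat_bump k c a x i) => _.
by rewrite /partial => ->; rewrite mulN1r.
Qed.

End flat_bump_smooth.

(** * Smooth functions with bounded support *)

Section compact_support.
Context {R : realType} {n : nat}.
Local Notation V := 'rV[R]_n.
Local Notation mu := (lebesgue R n).
Implicit Types (f g k : V -> R) (x : V).

(** With respect to the sup norm; in finite dimension, compact support. *)
Definition bsupp f := exists M : R, forall x, f x != 0 -> `|x| <= M.

Definition testfun f := smooth f /\ bsupp f.

Lemma closed_cube (M : R) : closed (@cube R n M).
Proof.
rewrite (_ : cube M = (fun x : V => `|x|) @^-1` [set t | t <= M])//.
by apply: closed_comp => [x _|]; [exact: norm_continuous|exact: closed_le].
Qed.

Lemma compact_cube (M : R) : compact (@cube R n M).
Proof.
apply: bounded_closed_compact; last exact: closed_cube.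
exists M; split; first exact: num_real.
by move=> N MN x /= xM; exact: le_trans xM (ltW MN).
Qed.

Lemma bsupp_bounded f : continuous f -> bsupp f ->
  exists2 C, 0 <= C & forall x, `|f x| <= C.
Proof.
move=> cf [M fM].
have /compact_bounded[C [_ HC]] : compact (f @` cube M).
  by apply: continuous_compact; [exact: continuous_subspaceT|exact: compact_cube].
exists (`|C| + 1); first by rewrite addr_ge0.
move=> x; have [->|fx] := eqVneq (f x) 0; first by rewrite normr0 addr_ge0.
apply: HC; first by rewrite (le_lt_trans (ler_norm _))// ltrDl.
by exists x => //; exact: fM.
Qed.

(** Closedness matters: at a point off [K] the function vanishes in a
neighbourhood, so its derivative vanishes too. *)
Lemma partial_supp f (K : set V) i : closed K -> (forall x, f x != 0 -> K x) ->
  forall x, partial i f x != 0 -> K x.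
Proof.
move=> cK fK x; apply: contraPP => nKx.
have oK : open (~` K) by exact: closed_openC.
apply/negP; rewrite negbK; apply/eqP.
rewrite /partial -[RHS](@derive_cst _ V R^o 0 x (delta_mx 0 i)).
apply: near_eq_derive.
have : \forall y \near x, (~` K) y by exact: open_nbhs_nbhs.
apply: filterS => y nKy /=.
by apply/eqP; apply: contra_notT nKy; exact: fK.
Qed.

Lemma testfun_partial f i : testfun f -> testfun (partial i f).
Proof.
move=> [sf [M fM]]; split; first exact: smooth_partial.
by exists M; apply: partial_supp; [exact: closed_cube|exact: fM].
Qed.

Lemma testfunM f g : smooth f -> testfun g -> testfun (fun x => f x * g x).
Proof.
move=> sf [sg [M gM]]; split; first exact: smoothM.
by exists M => x; rewrite mulf_eq0 negb_or => /andP[_ /gM].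
Qed.

Lemma testfun_refl f z : testfun f -> testfun (fun y => f (z - y)).
Proof.
move=> [sf [M fM]]; split; first exact: smooth_refl.
exists (M + `|z|) => y /fM h.
by rewrite -[y](subKr z) (le_trans (ler_normB _ _))// addrC lerD2r.
Qed.

Lemma testfun_bounded f : testfun f -> exists2 C, 0 <= C & forall x, `|f x| <= C.
Proof. by move=> [sf bf]; apply: bsupp_bounded => //; exact: smooth_continuous. Qed.

Lemma smooth_measurable f : smooth f -> measurable_fun (setT : set (Rn R n)) f.
Proof.
move=> sf; apply: borel_Rn_measurable_fun.
exact: continuous_rV_measurable (smooth_continuous sf).
Qed.

Lemma bounded_bsupp_integrable f C (D : set (Rn R n)) :
  measurable D -> measurable_fun D f ->
  (forall x, `|f x| <= C) -> bsupp f -> mu.-integrable D (EFin \o f).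
Proof.
move=> mD mf fC [M fM].
have C0 : 0 <= C by exact: le_trans (fC 0).
have mcube : measurable (cube M : set (Rn R n)).
  by apply: borel_Rn_measurable; exact: measurable_cube.
have h : mu.-integrable setT ((EFin \o cst C) \_ (cube M : set (Rn R n))).
  apply/(integrable_mkcond _ mcube).
  apply: measurable_bounded_integrable => //; first exact: lebesgue_cube_lty.
  by exists C; split; [exact: num_real|move=> N CN x _ /=; rewrite ger0_norm// ltW].
apply: (le_integrable mD _ _ (integrableS measurableT mD (@subsetT _ D) h)).
  exact/measurable_EFinP.
move=> x _; rewrite patchE/=; case: ifPn => [_|/negP].
  by rewrite lee_fin (ger0_norm C0).
rewrite inE => nx; rewrite lee_fin.
have [->|/fM//] := eqVneq (f x) 0; by rewrite normr0.
Qed.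

Lemma testfun_integrable f (D : set (Rn R n)) : measurable D -> testfun f ->
  mu.-integrable D (EFin \o f).
Proof.
move=> mD tf; have [C _ fC] := testfun_bounded tf.
apply: (bounded_bsupp_integrable mD _ fC tf.2).
by apply: measurable_funTS; exact: smooth_measurable (tf.1).
Qed.

(** Move from [y] to [x] one coordinate at a time and apply the mean value
theorem on each segment. *)
Lemma testfun_lipschitz f : testfun f ->
  exists2 L, 0 <= L & forall x y, `|f x - f y| <= L * `|x - y|.
Proof.
move=> tf.
have /choice[C HC] : forall i : 'I_n, exists C : R, 0 <= C /\ forall x, `|partial i f x| <= C.
  by move=> i; have [C C0 fC] := testfun_bounded (testfun_partial i tf); exists C.
exists (\sum_(i < n) C i); first by apply: sumr_ge0 => i _; case: (HC i).
move=> x y; set d := x - y.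
have main (s : seq 'I_n) z :
    `|f (\sum_(i <- s) d 0 i *: delta_mx 0 i + z) - f z| <= \sum_(i <- s) C i * `|d|.
  elim: s => [|i s IHs]; first by rewrite !big_nil add0r subrr normr0.
  rewrite !big_cons -addrA; set w := _ + z.
  have -> : f (d 0 i *: delta_mx 0 i + w) - f z =
    (f (d 0 i *: delta_mx 0 i + w) - f w) + (f w - f z) by ring.
  apply: (le_trans (ler_normD _ _)); apply: lerD => //.
  apply: (le_trans (line_lipschitz _ (HC i).2 _ _)).
    by move=> u; exact: smooth_derivable (tf.1).
  by apply: ler_wpM2l; [exact: (HC i).1|exact: mx_norm_coord].
have := main (index_enum 'I_n) y.
rewrite -mulr_suml -row_sum_delta.
by rewrite /d subrK.
Qed.

Lemma testfun_flat_bump (j : nat) (c a : R) : 0 < a -> testfun (flat_bump j c a : V -> R).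
Proof.
move=> a0; split; first exact: smooth_flat_bump.
exists (1 + `|c| / a) => x.
rewrite /flat_bump /flat; case: ifPn => [h _|]; last by rewrite eqxx.
have ca : 0 <= `|c| / a by rewrite divr_ge0// ltW.
apply: mx_norm_nsq; first by rewrite addr_ge0.
have : nsq x <= `|c| / a.
  rewrite ler_pdivlMr// mulrC (le_trans _ (ler_norm _))//.
  by move: h; rewrite subr_gt0 => /ltW.
by move=> /le_trans; apply; rewrite expr2; nra.
Qed.

End compact_support.

Section test_function_lemmas.
Context {R : realType} {n : nat}.
Local Notation V := 'rV[R]_n.
Implicit Types (D K : set V) (f g phi : V -> R).

Lemma test_functionP D phi : test_function D phi ->
  [/\ testfun phi, (forall x, phi x != 0 -> D x) &
      forall i x, partial i phi x != 0 -> D x].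
Proof.
move=> [sphi cphi phiD]; split.
- split => //.
  have [M [_ HM]] := compact_bounded cphi.
  exists (`|M| + 1) => x fx; apply: HM.
    by rewrite (le_lt_trans (ler_norm _))// ltrDl.
  exact: subset_closure.
- by move=> x fx; apply: phiD; exact: subset_closure.
- move=> i x fx; apply: phiD; move: fx.
  apply: partial_supp; first exact: closed_closure.
  by move=> y fy; exact: subset_closure.
Qed.

Lemma testfun_test_function D K phi : testfun phi -> closed K -> K `<=` D ->
  (forall x, phi x != 0 -> K x) -> test_function D phi.
Proof.
move=> [sphi [M fM]] cK KD fK; split => //.
  apply: (subclosed_compact _ (@compact_cube R n M)); first exact: closed_closure.
  rewrite [X in _ `<=` X]((closure_id _).1 (@closed_cube R n M)).
  exact: closureS.
apply: subset_trans KD.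
by rewrite [X in _ `<=` X]((closure_id _).1 cK); exact: closureS.
Qed.

End test_function_lemmas.

(** * Convolution and integration by parts *)

Section convolution.
Context {R : realType} {n : nat}.
Local Notation V := 'rV[R]_n.
Local Notation mu := (lebesgue R n).
Implicit Types (f g k : V -> R) (x : V).

Definition convolve g k x : R := \int[mu]_y (g y * k (x - y)).

Lemma integrable_mulM g (h : V -> R) (C : R) (D : set (Rn R n)) : measurable D ->
  mu.-integrable D (EFin \o g) -> measurable_fun D h -> 0 <= C ->
  (forall x, D x -> `|h x| <= C) -> mu.-integrable D (EFin \o (fun y => g y * h y)).
Proof.
move=> mD intg mh C0 hC.
have := integrableZl mD C intg => h1.
apply: (le_integrable mD _ _ h1).
  apply/measurable_EFinP; apply: measurable_funM => //.
  by move/measurable_int : intg => /measurable_EFinP.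
move=> y Dy /=; rewrite lee_fin !normrM mulrC ler_wpM2r// (ger0_norm C0).
exact: hC.
Qed.

Section conv_integrable.
Variable g : V -> R.
Hypothesis intg : mu.-integrable setT (EFin \o g).

Lemma conv_integrable k x : testfun k ->
  mu.-integrable setT (EFin \o (fun y => g y * k (x - y))).
Proof.
move=> tk; have [C C0 kC] := testfun_bounded tk.
apply: (integrable_mulM _ intg _ C0) => //.
exact: smooth_measurable (testfun_refl x tk).1.
Qed.

Lemma continuous_conv k : testfun k -> continuous (convolve g k).
Proof.
move=> tk x.
have [L L0 kL] := testfun_lipschitz tk.
set N := \int[mu]_y `|g y|.
have N0 : 0 <= N by exact: Rintegral_ge0.
have intNg : mu.-integrable setT (EFin \o (fun y => `|g y|)) by exact: integrable_norm.
have lip x' : `|convolve g k x - convolve g k x'| <= N * L * `|x - x'|.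
  rewrite /convolve -RintegralB//; [|exact: conv_integrable|exact: conv_integrable].
  have intd : mu.-integrable setT (EFin \o (fun y => g y * k (x - y) - g y * k (x' - y))).
    exact: (integrableB measurableT (conv_integrable x tk) (conv_integrable x' tk)).
  apply: (le_trans (le_normr_Rintegral _ intd)) => //.
  rewrite -mulrA -RintegralZr//.
  apply: le_Rintegral => //; first exact: (integrable_norm intd).
    exact: (integrableZr _ _ intNg).
  move=> y _; rewrite -mulrBr normrM ler_wpM2l//.
  by apply: le_trans (kL _ _) _; rewrite opprB addrA subrK.
apply/(@cvgrPdist_le _ _ _ (nbhs (x : V))) => e e0.
have p0 : 0 < e / (N * L + 1) by rewrite divr_gt0// ltr_wpDl// mulr_ge0.
have /(_ _ _ p0) := @cvgr_dist_le _ _ _ (nbhs (x : V)) _ id x (@cvg_id _ (nbhs (x : V))).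
apply: (@filterS _ (nbhs (x : V))) => x' /= hx'.
apply: (le_trans (lip x')).
apply: (@le_trans _ _ ((N * L + 1) * `|x - x'|)).
  by rewrite ler_wpM2r// lerDl.
by rewrite mulrC -ler_pdivlMr ?ltr_wpDl ?mulr_ge0.
Qed.

(** Differentiation under the integral sign in the scalar variable [t] of
[x + t e_i], dominated by a constant times [|g|]. *)
Lemma conv_partial k x i : testfun k ->
  derivable (convolve g k) x (delta_mx 0 i) /\
  partial i (convolve g k) x = convolve g (partial i k) x.
Proof.
move=> tk; set v := delta_mx 0 i.
have dk z : derivable k z v by exact: smooth_derivable tk.1.
have [C C0 kC] := testfun_bounded (testfun_partial i tk).
pose F (t : R) y := g y * k (t *: v + x - y).
have dF t y : is_derive t (1 : R) (F ^~ y) (g y * partial i k (t *: v + x - y)).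
  have h := is_deriveZ (g y) (is_derive_line (x - y) dk t).
  rewrite (_ : F^~ y = g y \*: (fun t : R => k (t *: v + (x - y)))).
    by apply: (is_derive_eq h); rewrite -[t *: v + x - y]addrA.
  by apply/funext => s; rewrite /F -[s *: v + x - y]addrA.
have p1E t y : partial1of2 F t y = g y * partial i k (t *: v + x - y).
  by rewrite partial1of2E; case: (dF t y).
have I0 : `]-1, 1[%classic (0 : R) by rewrite /= in_itv/= ltrN10 ltr01.
have intF t : `]-1, 1[%classic t -> mu.-integrable setT (EFin \o F t).
  by move=> _; exact: conv_integrable.
have derF t y : `]-1, 1[%classic t -> setT y -> derivable (F ^~ y) t 1.
  by move=> _ _; case: (dF t y).
pose G y := C * `|g y|.
have G0 y : 0 <= G y by rewrite mulr_ge0.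
have intG : mu.-integrable setT (EFin \o G).
  exact: (integrableZl _ C (integrable_norm intg)).
have Gub t y : `]-1, 1[%classic t -> setT y -> `|partial1of2 F t y| <= G y.
  by move=> _ _; rewrite p1E normrM mulrC ler_wpM2r.
have d1 := derivable_under_integral measurableT I0 intF derF G0 intG Gub.
have d2 := differentiation_under_integral measurableT I0 intF derF G0 intG Gub.
split; first by apply/derivable1P; exact: d1.
have -> : partial i (convolve g k) x =
    derive1 (fun t : R => \int[mu]_y F t y) 0.
  have E : (fun h : R => h^-1 *: (convolve g k (h *: v + x) - convolve g k x)) =
      (fun h : R => h^-1 *: ((fun t : R => \int[mu]_y F t y) (h *: 1 + 0) -
                             (fun t : R => \int[mu]_y F t y) 0)).
    by apply/funext => h; rewrite /F scale0r !add0r addr0 [h *: 1]mulr1.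
  by rewrite /partial derive1E /derive E.
rewrite d2; apply: eq_Rintegral => y _.
by rewrite p1E scale0r add0r.
Qed.

Lemma partial_conv k i : testfun k -> partial i (convolve g k) = convolve g (partial i k).
Proof. by move=> tk; apply/funext => x; case: (conv_partial x i tk). Qed.

Lemma smooth_conv k : testfun k -> smooth (convolve g k).
Proof.
move=> tk.
apply: (@smooth_coind _ _ [set f | exists2 k, testfun k & f = convolve g k]);
  last by exists k.
move=> _ [{tk}k tk ->]; split; first exact: continuous_conv.
move=> i; split => [x|]; first by case: (conv_partial x i tk).
by rewrite partial_conv//; exists (partial i k) => //; exact: testfun_partial.
Qed.

Lemma conv_supp k x : convolve g k x != 0 -> exists y, g y != 0 /\ k (x - y) != 0.
Proof.
apply: contraPP => /forallNP h; apply/negP; rewrite negbK; apply/eqP.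
rewrite /convolve (_ : (fun y => _) = cst 0) ?Rintegral_cst ?mul0r//.
apply/funext => y /=; have := h y.
have [->|gy] := eqVneq (g y) 0; first by rewrite mul0r.
have [->|ky] := eqVneq (k (x - y)) 0; first by rewrite mulr0.
by move=> /(_ (conj isT isT)).
Qed.

Lemma testfun_conv k : bsupp g -> testfun k -> testfun (convolve g k).
Proof.
move=> [M gM] tk; split; first exact: smooth_conv.
have [N kN] := tk.2.
exists (N + M) => x /conv_supp[y [gy ky]].
rewrite -[x](subrK y) (le_trans (ler_normD _ _))// lerD//; [exact: kN|exact: gM].
Qed.

End conv_integrable.
End convolution.

Section integral_partial.
Context {R : realType} {n : nat}.
Local Notation V := 'rV[R]_n.
Local Notation mu := (lebesgue R n).

(** Convolving [f] with the indicator of a large cube gives, near the origin, the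
constant integral of [f].  Its derivative there is 0, and is also the integral of
the partial derivative. *)
Lemma testfun_integral_partial (f : V -> R) i : testfun f ->
  \int[mu]_y partial i f y = 0.
Proof.
move=> tf; have [M fM] := tf.2.
pose Q := @cube R n (M + 1).
have mQ : measurable (Q : set (Rn R n)).
  by apply: borel_Rn_measurable; exact: measurable_cube.
pose g : V -> R := \1_Q.
have intg : mu.-integrable setT (EFin \o g).
  apply: (@bounded_bsupp_integrable _ _ _ 1) => //.
  - exact: measurable_indic.
  - by move=> x; rewrite /g indicE; case: (_ \in _); rewrite ?normr1 ?normr0.
  - exists (M + 1) => x; rewrite /g indicE; have [|] := boolP (x \in Q); last by rewrite eqxx.
    by rewrite inE.
have gQ h x : (forall y, h y != 0 -> `|y| <= M) -> `|x| <= 1 ->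
    convolve g h x = \int[mu]_y h (x - y).
  move=> hM x1; apply: eq_Rintegral => y _.
  have [->|/hM hy] := eqVneq (h (x - y)) 0; first by rewrite mulr0.
  rewrite /g indicE mem_set ?mul1r// /Q /cube/=.
  rewrite -[y](subKr x) (le_trans (ler_normB _ _))// addrC lerD//.
have tpf := testfun_partial i tf.
transitivity (convolve g (partial i f) 0).
  rewrite gQ ?normr0//; last first.
    move=> y; have := @partial_supp _ _ f _ i (@closed_cube R n M) fM y; exact.
  rewrite Rintegral_lebesgue_refl//; last exact: testfun_integrable.
  exact: continuous_rV_measurable (smooth_continuous tpf.1).
rewrite -partial_conv// /partial -[RHS](@derive_cst _ V R^o (convolve g f 0) 0 (delta_mx 0 i)).
apply: near_eq_derive.
have : \forall x \near (0 : V), `|x| <= 1.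
  have := @cvgr_norm_le _ _ _ _ _ _ _ (@cvg_id _ (nbhs (0 : V))) 1.
  by rewrite normr0 ltr01; apply.
apply: filterS => x x1 /=.
rewrite gQ// gQ ?normr0// !Rintegral_lebesgue_refl//.
- exact: continuous_rV_measurable (smooth_continuous tf.1).
- exact: testfun_integrable.
- exact: continuous_rV_measurable (smooth_continuous tf.1).
- exact: testfun_integrable.
Qed.

Lemma testfun_by_parts (f g : V -> R) i : smooth f -> testfun g ->
  \int[mu]_y (f y * partial i g y) = - \int[mu]_y (partial i f y * g y).
Proof.
move=> sf tg.
have df x : derivable f x (delta_mx 0 i) by exact: smooth_derivable.
have dg x : derivable g x (delta_mx 0 i) by exact: smooth_derivable tg.1.
have := testfun_integral_partial i (testfunM sf tg).
rewrite partialM// RintegralD//; first by move/eqP; rewrite addr_eq0 => /eqP.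
- by apply: testfun_integrable => //; apply: testfunM => //; exact: testfun_partial.
- by apply: testfun_integrable => //; apply: testfunM => //; exact: smooth_partial.
Qed.

End integral_partial.

(** * Square integrals *)

Section square_integral.
Context {R : realType} {n : nat}.
Local Notation V := 'rV[R]_n.
Local Notation mu := (lebesgue R n).
Implicit Types (f g h : V -> R) (k : nat) (x : V) (D : set (Rn R n)).

(** The squared norm of [L^2(D)] as an extended real, so that estimates can be
stated before finiteness is known. *)
Definition sqint D f : \bar R := (\int[mu]_(x in D) (f x ^+ 2)%:E)%E.

Lemma sqint_ge0 D f : (0 <= sqint D f)%E.
Proof. by apply: integral_ge0 => x _; rewrite lee_fin sqr_ge0. Qed.

Lemma measurable_sqr D f : measurable_fun D f ->
  measurable_fun D (fun x => (f x ^+ 2)%:E).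
Proof. by move=> mf; apply/measurable_EFinP; exact: measurable_funX. Qed.

Lemma le_sqint D f g : measurable D -> measurable_fun D f -> measurable_fun D g ->
  (forall x, D x -> `|f x| <= `|g x|) -> (sqint D f <= sqint D g)%E.
Proof.
move=> mD mf mg fg.
have sq0 x : D x -> (0 <= (f x ^+ 2)%:E)%E by move=> _; rewrite lee_fin sqr_ge0.
apply: (ge0_le_integral mu mD sq0 (measurable_sqr mf) (measurable_sqr mg)).
- move=> x Dx; rewrite lee_fin -[f x ^+ 2]real_normK ?num_real//.
  rewrite -[g x ^+ 2]real_normK ?num_real// ler_pXn2r// ?nnegrE//.
  exact: fg.
Qed.

Lemma sqint_lin D (a b : R) f g h : measurable D -> measurable_fun D f ->
  measurable_fun D g -> measurable_fun D h -> 0 <= a -> 0 <= b ->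
  (forall x, D x -> h x ^+ 2 <= a * f x ^+ 2 + b * g x ^+ 2) ->
  (sqint D h <= a%:E * sqint D f + b%:E * sqint D g)%E.
Proof.
move=> mD mf mg mh a0 b0 H.
have mF := measurable_sqr mf; have mG := measurable_sqr mg.
have sq0 (u : V -> R) x : D x -> (0 <= (u x ^+ 2)%:E)%E.
  by move=> _; rewrite lee_fin sqr_ge0.
have maF : measurable_fun D (fun x => a%:E * (f x ^+ 2)%:E)%E.
  exact: measurable_funeM.
have mbG : measurable_fun D (fun x => b%:E * (g x ^+ 2)%:E)%E.
  exact: measurable_funeM.
have aF0 x : D x -> (0 <= a%:E * (f x ^+ 2)%:E)%E by move=> Dx; rewrite mule_ge0 ?lee_fin ?sqr_ge0.
have bG0 x : D x -> (0 <= b%:E * (g x ^+ 2)%:E)%E by move=> Dx; rewrite mule_ge0 ?lee_fin ?sqr_ge0.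
rewrite /sqint -(ge0_integralZl_EFin mu mD (sq0 f) mF a0).
rewrite -(ge0_integralZl_EFin mu mD (sq0 g) mG b0).
rewrite -(ge0_integralD mu mD aF0 maF bG0 mbG).
apply: (ge0_le_integral mu mD (sq0 h) (measurable_sqr mh)).
  exact: emeasurable_funD.
by move=> x Dx; rewrite -!EFinM -EFinD lee_fin; exact: H.
Qed.

Lemma bounded_cvg0 D (F : nat -> V -> R) (C : R) : measurable D ->
  (mu D < +oo)%E -> (forall k, measurable_fun D (F k)) ->
  (forall k x, D x -> `|F k x| <= C) ->
  (forall x, D x -> F ^~ x @ \oo --> 0) ->
  (\int[mu]_(x in D) `|F k x|%:E)%E @[k --> \oo] --> 0%E.
Proof.
move=> mD Dfin mh hC h0.
have -> : (0 = \int[mu]_(x in D) cst 0%:E x)%E by rewrite integral0_eq.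
have mF k : measurable_fun D (fun x => `|F k x|%:E).
  by apply/measurable_EFinP; exact: measurableT_comp.
have intC : mu.-integrable D (EFin \o cst C).
  apply: (measurable_bounded_integrable mD Dfin (measurable_cst C)).
  exists `|C|; split; first exact: num_real.
  by move=> N CN x _ /=; exact: ltW.
have F0 x : D x -> `|F k x|%:E @[k --> \oo] --> 0%:E.
  move=> Dx; apply: cvg_EFin; first exact: nearW.
  rewrite -[X in _ --> X](@normr0 _ R); apply: cvg_norm; exact: h0.
have Cfin x : D x -> (EFin \o cst C) x \is a fin_num by [].
apply: (dominated_cvg mD mF F0 Cfin intC) => k x Dx.
by rewrite abse_EFin lee_fin normr_id; exact: hC.
Qed.

(** Square integrable functions of bounded support: these are integrable, so
that their convolutions with smooth kernels make sense. *)
Definition L2b g := [/\ measurable_fun (setT : set (Rn R n)) g,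
  (sqint setT g < +oo)%E & bsupp g].

Lemma measurable_cubeR (M : R) : measurable (cube M : set (Rn R n)).
Proof. by apply: borel_Rn_measurable; exact: measurable_cube. Qed.

Lemma sqr_integrable D g : measurable D -> measurable_fun D g -> (sqint D g < +oo)%E ->
  mu.-integrable D (EFin \o (fun x => g x ^+ 2)).
Proof.
move=> mD mg gfin; apply/integrableP; split; first exact: measurable_sqr.
rewrite [ltLHS](_ : _ = sqint D g)//.
by apply: eq_integral => x _; rewrite abse_EFin ger0_norm ?sqr_ge0.
Qed.

Lemma L2_integrable D g : measurable D -> (mu D < +oo)%E ->
  measurable_fun D g -> (sqint D g < +oo)%E -> mu.-integrable D (EFin \o g).
Proof.
move=> mD Dfin mg gfin.
have h1 : mu.-integrable D (EFin \o cst (1 : R)).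
  apply: measurable_bounded_integrable => //.
  by exists 1; split; [exact: num_real|move=> N CN x _ /=; rewrite normr1 ltW].
apply: (le_integrable mD _ _ (integrableD mD h1 (sqr_integrable mD mg gfin))).
  exact/measurable_EFinP.
move=> x Dx /=; rewrite lee_fin [leRHS]ger0_norm ?addr_ge0 ?sqr_ge0//.
rewrite -[g x ^+ 2]real_normK ?num_real//.
by have := sqr_ge0 (`|g x| - 1); have := normr_ge0 (g x); rewrite !expr2; nra.
Qed.

Lemma L2b_integrable g : L2b g -> mu.-integrable setT (EFin \o g).
Proof.
move=> [mg gfin [M gM]].
have mC := @measurable_cubeR M.
have : mu.-integrable (cube M) (EFin \o g).
  apply: L2_integrable => //; first exact: lebesgue_cube_lty.
    exact: measurable_funTS.
  have sq0 x : setT x -> (0 <= (g x ^+ 2)%:E)%E by move=> _; rewrite lee_fin sqr_ge0.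
  apply: le_lt_trans gfin.
  exact: (ge0_subset_integral mu mC measurableT (measurable_sqr mg) sq0 (@subsetT _ _)).
move/(integrable_mkcond _ mC); apply: eq_integrable => // x _.
rewrite patchE; case: ifPn => // /negP; rewrite inE => nx.
by rewrite /=; have [->|/gM] := eqVneq (g x) 0.
Qed.

Lemma L2bD (a b : R) f g : L2b f -> L2b g -> L2b (fun x => a * f x + b * g x).
Proof.
move=> [mf ff [M fM]] [mg gf [N gN]].
have maf : measurable_fun (setT : set (Rn R n)) (fun x => a * f x).
  by apply: measurable_funM.
have mbg : measurable_fun (setT : set (Rn R n)) (fun x => b * g x).
  by apply: measurable_funM.
split; first exact: measurable_funD.
- have a2 : 0 <= 2 * a ^+ 2 by rewrite mulr_ge0// sqr_ge0.
  have b2 : 0 <= 2 * b ^+ 2 by rewrite mulr_ge0// sqr_ge0.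
  apply: (le_lt_trans (sqint_lin measurableT mf mg (measurable_funD maf mbg) a2 b2 _)).
    by move=> x _; have := sqr_ge0 (a * f x - b * g x); rewrite /= !expr2; lra.
  have H c u : 0 <= c -> (sqint setT u < +oo -> c%:E * sqint setT u < +oo)%E.
    by move=> c0 uoo; apply: lte_mul_pinfty; rewrite ?lee_fin.
  by apply: lte_add_pinfty; [exact: (H _ f)|exact: (H _ g)].
- exists (Num.max M N) => x fgx; rewrite le_max; apply/orP.
  have [f0|/fM] := eqVneq (f x) 0; last by left.
  have [g0|/gN] := eqVneq (g x) 0; last by right.
  by move: fgx; rewrite f0 g0 !mulr0 addr0 eqxx.
Qed.

Lemma continuous_bsupp_L2b f : continuous f -> bsupp f -> L2b f.
Proof.
move=> cf bf.
have mf : measurable_fun (setT : set (Rn R n)) f.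
  by apply: borel_Rn_measurable_fun; exact: continuous_rV_measurable.
split => //; have [C C0 fC] := bsupp_bounded cf bf.
have mf2 : measurable_fun (setT : set (Rn R n)) (fun x => f x ^+ 2).
  exact: measurable_funX.
have : mu.-integrable setT (EFin \o (fun x => f x ^+ 2)).
  apply: (@bounded_bsupp_integrable _ _ _ (C ^+ 2)) => //.
    by move=> x; rewrite normrX ler_pXn2r// nnegrE.
  have [M fM] := bf; exists M => x; rewrite sqrf_eq0; exact: fM.
move/integrableP => [_]; apply: le_lt_trans.
rewrite [leLHS](_ : _ = \int[mu]_x `|(f x ^+ 2)%:E|)%E//.
by apply: eq_integral => x _; rewrite abse_EFin ger0_norm ?sqr_ge0.
Qed.

End square_integral.

(** * Mollifiers *)

Section averaging_kernel.
Context {R : realType} {n : nat}.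
Local Notation V := 'rV[R]_n.
Local Notation mu := (lebesgue R n).
Implicit Types (f g h : V -> R) (x : V).

(** Smooth even probability densities. *)
Definition averaging (rho : V -> R) := [/\ testfun rho, forall x, 0 <= rho x,
  forall x, rho (- x) = rho x & \int[mu]_x rho x = 1].

Section averaging_theory.
Variable rho : V -> R.
Hypothesis arho : averaging rho.

Let trho : testfun rho. Proof. by case: arho. Qed.
Let rho_ge0 x : 0 <= rho x. Proof. by case: arho. Qed.

Lemma averaging_refl_integrable x : mu.-integrable setT (EFin \o (fun y => rho (x - y))).
Proof. by apply: testfun_integrable => //; exact: testfun_refl. Qed.

Lemma averaging_refl_integral x : \int[mu]_y rho (x - y) = 1.
Proof.
rewrite Rintegral_lebesgue_refl; first by case: arho.
- exact: continuous_rV_measurable (smooth_continuous trho.1).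
- exact: testfun_integrable.
Qed.

Lemma averaging_close f x a e : mu.-integrable setT (EFin \o f) ->
  (forall y, rho (x - y) != 0 -> `|f y - a| <= e) ->
  `|convolve f rho x - a| <= e.
Proof.
move=> intf fe.
have intr := averaging_refl_integrable x.
have intfr := conv_integrable intf x trho.
have -> : convolve f rho x - a = \int[mu]_y (f y * rho (x - y) - a * rho (x - y)).
  rewrite RintegralB//; last exact: (integrableZl measurableT a intr).
  by rewrite RintegralZl// averaging_refl_integral mulr1.
have intd : mu.-integrable setT (EFin \o (fun y => f y * rho (x - y) - a * rho (x - y))).
  exact: (integrableB measurableT intfr (integrableZl measurableT a intr)).
apply: (le_trans (le_normr_Rintegral _ intd)) => //.
rewrite -[leRHS]mulr1 -(averaging_refl_integral x) -RintegralZl//.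
apply: le_Rintegral => //; first exact: (integrable_norm intd).
  exact: (integrableZl measurableT e intr).
move=> y _; rewrite -mulrBl normrM (ger0_norm (rho_ge0 _)).
have [->|ry] := eqVneq (rho (x - y)) 0; first by rewrite !mulr0.
by rewrite ler_wpM2r// fe.
Qed.

(** The variance of [g] under the probability density [rho (x - y) dy] is
nonnegative. *)
Lemma averaging_jensen g x : mu.-integrable setT (EFin \o g) ->
  mu.-integrable setT (EFin \o (fun y => g y ^+ 2)) ->
  (convolve g rho x) ^+ 2 <= convolve (fun y => g y ^+ 2) rho x.
Proof.
move=> intg intg2; set c := convolve g rho x.
have i0 := averaging_refl_integrable x.
have i1 := conv_integrable intg x trho.
have i2 := conv_integrable intg2 x trho.
rewrite -subr_ge0.
have -> : convolve (fun y => g y ^+ 2) rho x - c ^+ 2 =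
    \int[mu]_y ((g y ^+ 2 * rho (x - y) - 2 * c * (g y * rho (x - y)))
      + c ^+ 2 * rho (x - y)).
  have i1c := integrableZl measurableT (2 * c) i1.
  have i0c := integrableZl measurableT (c ^+ 2) i0.
  rewrite RintegralD//; last exact: (integrableB measurableT i2 i1c).
  rewrite RintegralB// !RintegralZl// averaging_refl_integral.
  by rewrite -/(convolve _ _ _) -/(convolve g rho x) -/c; ring.
apply: Rintegral_ge0 => y _.
rewrite (_ : _ + _ = (g y - c) ^+ 2 * rho (x - y)); last by ring.
by rewrite mulr_ge0// sqr_ge0.
Qed.

(** Jensen pointwise, then Tonelli: the kernel integrates to 1 in either
variable. *)
Lemma averaging_young g : L2b g -> (sqint setT (convolve g rho) <= sqint setT g)%E.
Proof.
move=> Lg; have [mg gfin bg] := Lg.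
have intg := L2b_integrable Lg.
have intg2 := sqr_integrable measurableT mg gfin.
have scg := (smooth_conv intg trho).
pose F (p : Rn R n * Rn R n) : \bar R := ((g p.2 ^+ 2) * rho (p.1 - p.2))%:E.
have mF : measurable_fun setT F.
  apply/measurable_EFinP; apply: measurable_funM.
    by apply: measurable_funX; exact: measurableT_comp mg measurable_snd.
  have mr : measurable_fun (setT : set V) rho.
    exact: continuous_rV_measurable (smooth_continuous trho.1).
  apply: (measurableT_comp mr).
  apply: measurable_rV_coordP => i.
  have mc : measurable_fun (setT : set (Rn R n)) (rV_coord i).
    by apply: borel_Rn_measurable_fun; exact: measurable_rV_coord.
  rewrite (_ : _ \o _ = (fun p => rV_coord i p.1 - rV_coord i p.2)); last first.
    by apply/funext => p; rewrite /rV_coord/= rV_subE.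
  apply: measurable_funB; [exact: measurableT_comp mc measurable_fst|].
  exact: measurableT_comp mc measurable_snd.
have F0 p : (0 <= F p)%E by rewrite lee_fin mulr_ge0// sqr_ge0.
apply: (@le_trans _ _ (\int[mu]_x \int[mu]_y F (x, y))%E).
  have sq0 x : setT x -> (0 <= (convolve g rho x ^+ 2)%:E)%E.
    by move=> _; rewrite lee_fin sqr_ge0.
  have mFF : measurable_fun (setT : set (Rn R n)) (fun x => \int[mu]_y F (x, y))%E.
    exact: (@measurable_fun_fubini_tonelli_F _ _ _ _ _ (@lebesgue_sf R n) F mF F0).
  apply: (ge0_le_integral mu measurableT sq0
    (measurable_sqr (smooth_measurable scg)) mFF) => x _.
  have := averaging_jensen x intg intg2.
  rewrite -lee_fin => /le_trans; apply.
  rewrite /convolve /Rintegral fineK//.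
  exact: integrable_fin_num (conv_integrable intg2 x trho).
rewrite (lebesgue_tonelli mF F0).
have G0 y : setT y -> (0 <= \int[mu]_x F (x, y))%E.
  by move=> _; apply: integral_ge0 => x _; exact: F0.
have mGG : measurable_fun (setT : set (Rn R n)) (fun y => \int[mu]_x F (x, y))%E.
  exact: (@measurable_fun_fubini_tonelli_G _ _ _ _ _ (@lebesgue_sf R n) F mF F0).
apply: (ge0_le_integral mu measurableT G0 mGG (measurable_sqr mg)).
move=> y _; rewrite /F/=.
under eq_integral do rewrite EFinM.
have mr : measurable_fun (setT : set V) (fun x => rho (x - y)).
  apply: continuous_rV_measurable => x.
  rewrite (_ : (fun x => _) = (fun x => rho (y - x))).
    exact: (smooth_continuous (testfun_refl y trho).1).
  by apply/funext => z; case: arho => _ _ <- _; rewrite opprB.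
have mEr : measurable_fun (setT : set (Rn R n)) (fun x => (rho (x - y))%:E).
  by apply/measurable_EFinP; exact: borel_Rn_measurable_fun.
have r0 x : setT x -> (0 <= (rho (x - y))%:E)%E by rewrite lee_fin.
rewrite (ge0_integralZl_EFin mu measurableT r0 mEr (sqr_ge0 _)).
rewrite [X in (_ * X)%E](_ : _ = 1%:E) ?mule1//.
rewrite -(averaging_refl_integral y) /Rintegral fineK.
  by apply: eq_integral => x _; case: arho => _ _ <- _; rewrite opprB.
exact: integrable_fin_num (averaging_refl_integrable y).
Qed.

End averaging_theory.
End averaging_kernel.

Section mollifier.
Context {R : realType} {n : nat}.
Local Notation V := 'rV[R]_n.
Local Notation mu := (lebesgue R n).
Implicit Types (f g h : V -> R) (x : V) (k : nat).
Hypothesis n0 : (0 < n)%N.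

Let bmp k : V -> R := flat_bump 0 1 (k.+1%:R ^+ 2).

Let k2_gt0 k : 0 < k.+1%:R ^+ 2 :> R. Proof. exact: exprn_gt0. Qed.

Let bmp_testfun k : testfun (bmp k). Proof. exact: testfun_flat_bump. Qed.

Let bmp_ge0 k x : 0 <= bmp k x. Proof. exact: flat_ge0. Qed.

Let bmp_int k : 0 < \int[mu]_x bmp k x.
Proof.
pose s : R := (2 * k.+1%:R)^-1.
have s0 : 0 < s by rewrite invr_gt0 mulr_gt0.
pose B : set (Rn R n) := eball s.
have mB : measurable B by apply: borel_Rn_measurable; exact: measurable_eball.
pose c : R := flat 0 (3 / 4).
have c0 : 0 < c by apply: flat0_gt0; lra.
have Bfin : (mu B < +oo)%E.
  by apply: le_lt_trans (lebesgue_eball_le s0) _; exact: ltry.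
have Bpos : (0 < mu B)%E.
  apply: lt_le_trans (lebesgue_eball_ge n0 s0).
  by rewrite lte_fin exprn_gt0// mulr_gt0// divr_gt0// ltr0n.
apply: (@lt_le_trans _ _ (\int[mu]_(x in B) c)).
  rewrite Rintegral_cst// mulr_gt0// fine_gt0// Bpos Bfin//.
have intb : mu.-integrable setT (EFin \o bmp k) by exact: testfun_integrable.
apply: (@le_trans _ _ (\int[mu]_(x in B) bmp k x)).
  apply: le_Rintegral => //.
  - apply: (@measurable_bounded_integrable _ _ _ _ (cst c)) => //.
    by exists `|c|; split; [exact: num_real|move=> N CN x _ /=; exact: ltW].
  - exact: (integrableS measurableT).
  - move=> x; rewrite /B eballE//= => /ltW xs; apply: flat0_le.
    have : k.+1%:R ^+ 2 * nsq x <= k.+1%:R ^+ 2 * s ^+ 2 by rewrite ler_wpM2l// ltW.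
    have -> : k.+1%:R ^+ 2 * s ^+ 2 = 1 / 4 :> R.
      rewrite -exprMn /s invfM mulrCA mulfV ?mulr1 ?pnatr_eq0// exprVn.
      by rewrite div1r; congr (_^-1); rewrite expr2; ring.
    lra.
rewrite /Rintegral; apply: fine_le.
- by apply: integrable_fin_num => //; exact: (integrableS measurableT).
- exact: integrable_fin_num.
- have mE : measurable_fun (setT : set (Rn R n)) (EFin \o bmp k).
    by apply/measurable_EFinP; exact: smooth_measurable (bmp_testfun k).1.
  have b0 x : setT x -> (0 <= (EFin \o bmp k) x)%E by rewrite lee_fin.
  exact: (ge0_subset_integral mu mB measurableT mE b0 (@subsetT _ _)).
Qed.

Definition mollifier k : V -> R := fun x => (\int[mu]_x bmp k x)^-1 * bmp k x.

Lemma averaging_mollifier k : averaging (mollifier k).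
Proof.
have c0 := bmp_int k; split.
- by apply: (testfunM (smooth_cst _)).
- by move=> x; rewrite mulr_ge0// invr_ge0 ltW.
- by move=> x; rewrite /mollifier /bmp /flat_bump nsqN.
- rewrite RintegralZl//; last exact: testfun_integrable.
  by rewrite mulVf// gt_eqF.
Qed.

Lemma mollifier_supp k x : mollifier k x != 0 -> nsq x <= (k.+1%:R^-1) ^+ 2.
Proof.
rewrite mulf_eq0 negb_or => /andP[_]; rewrite /bmp /flat_bump /flat.
case: ifPn => [h _|]; last by rewrite eqxx.
by rewrite exprVn -[leRHS]mulr1 ler_pdivlMl//; move: h; rewrite subr_gt0 => /ltW.
Qed.

(** Pointwise convergence follows from continuity since the kernels concentrate
at the origin; supports and bounds are uniform in [k], so dominated convergence
applies. *)
Lemma continuous_conv_cvg f : continuous f -> bsupp f ->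
  sqint setT (fun x => convolve f (mollifier k) x - f x) @[k --> \oo] --> 0%E.
Proof.
move=> cf bf.
have [C C0 fC] := bsupp_bounded cf bf.
have [M fM] := bf.
have Lf := continuous_bsupp_L2b cf bf.
have intf := L2b_integrable Lf.
have [mf _ _] := Lf.
pose F k x := (convolve f (mollifier k) x - f x) ^+ 2.
have mF k : measurable_fun (setT : set (Rn R n)) (F k).
  have [tm _ _ _] := averaging_mollifier k.
  exact: (measurable_funX _ (measurable_funB (smooth_measurable (smooth_conv intf tm)) mf)).
pose Q := @cube R n (M + 1).
have mQ : measurable (Q : set (Rn R n)) by exact: measurable_cubeR.
have FQ k x : ~ Q x -> F k x = 0.
  move=> nQ.
  have f0 : f x = 0.
    apply/eqP; apply: contra_notT nQ => /fM; rewrite /Q /cube/= => /le_trans.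
    by apply; rewrite lerDl.
  rewrite /F f0 subr0; have [->|] := eqVneq (convolve f (mollifier k) x) 0; first by rewrite expr0n.
  move=> /conv_supp[y [/fM yM /mollifier_supp xy]]; exfalso; apply: nQ.
  rewrite /Q /cube/= -[x](subrK y) addrC (le_trans (ler_normD _ _))// lerD//.
  apply: mx_norm_nsq => //; apply: le_trans xy _.
  by rewrite ler_pXn2r// ?nnegrE ?invr_ge0// invf_le1// ler1n.
rewrite (_ : (fun k => _) = (fun k => \int[mu]_(x in Q) `|F k x|%:E)%E); last first.
  apply/funext => k; rewrite [RHS]integral_mkcond; apply: eq_integral => x _.
  rewrite patchE; case: ifPn => [_|/negP].
    by rewrite ger0_norm// sqr_ge0.
  by rewrite inE => /(FQ k); rewrite /F => ->.
apply: (@bounded_cvg0 _ _ _ _ ((C + C) ^+ 2)) => //.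
- exact: lebesgue_cube_lty.
- by move=> k; apply: measurable_funTS.
- move=> k x _; rewrite /F normrX ler_pXn2r// ?nnegrE ?addr_ge0//.
  apply: (le_trans (ler_normB _ _)); rewrite lerD//.
  rewrite -[X in `|X|]subr0; apply: averaging_close => //.
    exact: averaging_mollifier.
  by move=> y _; rewrite subr0.
- move=> x _.
  have : (fun k => convolve f (mollifier k) x - f x) @ \oo --> 0.
    apply/cvgrPdist_le => e e0.
    have /cvgrPdist_le/(_ _ e0)/nbhs_ballP[d /= d0 dfe] := cf x.
    have := near_infty_natSinv_lt (PosNum d0).
    apply: filterS => k kd; rewrite sub0r normrN.
    apply: averaging_close => //; first exact: averaging_mollifier.
    move=> y /mollifier_supp xy; rewrite distrC; apply: dfe.
    rewrite mx_norm_ball /ball_/=; apply: le_lt_trans kd.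
    by apply: mx_norm_nsq.
  move=> h; have := cvgM h h; rewrite mulr0 /F; exact.
Qed.

End mollifier.

(** * Approximation of Borel sets by continuous functions *)

Section clamp.
Context {R : realType}.

Definition clamp (t : R) : R := Num.max 0 (Num.min 1 t).

Lemma continuous_clamp : continuous clamp.
Proof.
move=> t; rewrite /clamp; apply: continuous_max; first exact: cvg_cst.
by apply: continuous_min; [exact: cvg_cst|exact: cvg_id].
Qed.

Lemma clamp_itv t : 0 <= clamp t <= 1.
Proof. by rewrite /clamp le_max lexx/= ge_max ler01 ge_min lexx. Qed.

Lemma clamp1 t : 1 <= t -> clamp t = 1.
Proof. by move=> t1; rewrite /clamp min_l// max_r. Qed.

Lemma clamp0 t : t <= 0 -> clamp t = 0.
Proof. by move=> t0; rewrite /clamp min_r ?max_l// (le_trans t0). Qed.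

End clamp.

Section borel_approximation.
Context {R : realType} {n : nat}.
Local Notation V := 'rV[R]_n.
Local Notation mu := (lebesgue R n).
Implicit Types (f g h : V -> R) (x : V) (k : nat).
Variable M : R.
Let Q : set (Rn R n) := @cube R n M.

Let mQ : measurable Q. Proof. exact: measurable_cubeR. Qed.

Let Qfin : (mu Q < +oo)%E. Proof. exact: lebesgue_cube_lty. Qed.

Let dist f g : \bar R := (\int[mu]_(x in Q) `|f x - g x|%:E)%E.

Let bmeas f := measurable_fun (setT : set V) f.

Let mdist f g : bmeas f -> bmeas g ->
  measurable_fun Q (fun x => `|f x - g x|%:E).
Proof.
move=> mf mg; apply: measurable_funTS; apply/measurable_EFinP.
exact: (measurableT_comp (@normr_measurable R setT)
  (borel_Rn_measurable_fun (measurable_funB mf mg))).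
Qed.

Let dist_le f1 g1 f2 g2 f g : bmeas f1 -> bmeas g1 -> bmeas f2 -> bmeas g2 ->
  bmeas f -> bmeas g ->
  (forall x, `|f x - g x| <= `|f1 x - g1 x| + `|f2 x - g2 x|) ->
  (dist f g <= dist f1 g1 + dist f2 g2)%E.
Proof.
move=> mf1 mg1 mf2 mg2 mf mg H; rewrite /dist.
have d0 u v x : Q x -> (0 <= `|u x - v x :> R|%:E)%E by rewrite lee_fin.
rewrite -(ge0_integralD mu mQ (d0 f1 g1) (mdist mf1 mg1) (d0 f2 g2) (mdist mf2 mg2)).
apply: (ge0_le_integral mu mQ (d0 f g) (mdist mf mg)).
  exact: (emeasurable_funD (mdist mf1 mg1) (mdist mf2 mg2)).
by move=> x _; rewrite -EFinD lee_fin.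
Qed.

(** Indicators that are limits in [L^1] of the cube [Q] of continuous functions
with values between 0 and 1.  These sets form a sigma-algebra containing the
preimages of half-open intervals under the coordinates, hence all Borel sets. *)
Definition approximable (B : set V) := measurable B /\
  forall e : R, 0 < e -> exists f, [/\ continuous f, forall x, 0 <= f x <= 1 &
    (\int[mu]_(x in Q) `|\1_B x - f x|%:E <= e%:E)%E].

Let mind (B : set V) : measurable B -> bmeas (\1_B).
Proof. by move=> mB; exact: measurable_indic. Qed.

Lemma approximable_lim (B : set V) (B_ : nat -> set V) : measurable B ->
  (forall k, approximable (B_ k)) ->
  (forall x, (fun k => \1_(B_ k) x : R) @ \oo --> (\1_B x : R)) -> approximable B.
Proof.
move=> mB aB cB; split => // e e0.
have mB_ k : measurable (B_ k) by case: (aB k).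
have : dist (\1_(B_ k)) (\1_B) @[k --> \oo] --> 0%E.
  have mF k : measurable_fun Q (fun x : V => \1_(B_ k) x - \1_B x : R).
    apply: measurable_funTS; apply: borel_Rn_measurable_fun.
    exact: (measurable_funB (mind (mB_ k)) (mind mB)).
  have bF k x : Q x -> `|\1_(B_ k) x - \1_B x : R| <= 2.
    move=> _; rewrite (le_trans (ler_normB _ _))// !indicE.
    by case: (x \in _); case: (x \in _); rewrite ?normr1 ?normr0; lra.
  apply: (bounded_cvg0 mQ Qfin mF bF).
  move=> x _; rewrite -(subrr (\1_B x : R)); apply: cvgB; first exact: cB.
    exact: cvg_cst.
have e20 : 0 < e / 2 by lra.
move/fine_cvgP => [finB] /cvgrPdist_le/(_ _ e20) clB.
have [k [fk ck]] := filter_ex (filterI finB clB).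
have [f [cf f01 fe]] := (aB k).2 _ e20.
exists f; split => //.
apply: (@le_trans _ _ (dist (\1_(B_ k)) (\1_B) + dist (\1_(B_ k)) f)%E).
  apply: dist_le; [exact: mind|exact: mind|exact: mind|
    exact: continuous_rV_measurable|exact: mind|exact: continuous_rV_measurable|].
  move=> x; rewrite [X in _ <= X + _]distrC.
  by rewrite (_ : \1_B x - f x = (\1_B x - \1_(B_ k) x) + (\1_(B_ k) x - f x)) ?ler_normD//; ring.
rewrite (_ : e%:E = (e / 2)%:E + (e / 2)%:E)%E; last by rewrite -EFinD; congr EFin; lra.
apply: leeD => //; rewrite -(fineK fk) lee_fin.
by move: ck; rewrite sub0r normrN; exact: le_trans (ler_norm _).
Qed.

Lemma approximableC (B : set V) : approximable B -> approximable (~` B).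
Proof.
move=> [mB aB]; split; first exact: measurableC.
move=> e e0; have [f [cf f01 fe]] := aB _ e0.
exists (fun x => 1 - f x); split.
- by move=> x; apply: (@cvgB _ R^o _ (nbhs (x : V)) _ (cst 1)); [exact: cvg_cst|exact: cf].
- by move=> x; have := f01 x; lra.
- rewrite (_ : (fun x => _) = (fun x => `|\1_B x - f x|%:E))//.
  apply/funext => x; congr EFin; rewrite distrC.
  congr (`|_|); rewrite !indicE in_setC; case: (x \in B) => /=; lra.
Qed.

(** The function [f + g - f g] approximates the indicator of the union. *)
Lemma approximableU (A B : set V) : approximable A -> approximable B ->
  approximable (A `|` B).
Proof.
move=> [mA aA] [mB aB]; split; first exact: measurableU.
move=> e e0; have e20 : 0 < e / 2 by lra.
have [f [cf f01 fe]] := aA _ e20; have [g [cg g01 ge]] := aB _ e20.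
have cfg : continuous (fun x => f x + g x - f x * g x).
  move=> x; apply: (@cvgB _ R^o _ (nbhs (x : V))); last exact: (cvgM (cf x) (cg x)).
  exact: (cvgD (cf x) (cg x)).
exists (fun x => f x + g x - f x * g x); split => //.
  by move=> x; have := f01 x; have := g01 x; nra.
apply: (@le_trans _ _ (dist (\1_A) f + dist (\1_B) g)%E).
  apply: dist_le; [exact: mind|exact: continuous_rV_measurable|exact: mind|
    exact: continuous_rV_measurable|apply: mind; exact: measurableU|
    exact: continuous_rV_measurable|].
  move=> x.
  rewrite (_ : _ - _ = (\1_A x - f x) * (1 - \1_B x) + (\1_B x - g x) * (1 - f x)).
    apply: (le_trans (ler_normD _ _)); rewrite !normrM; apply: lerD.
      rewrite ler_piMr// indicE; case: (_ \in _); rewrite ?subrr ?normr0 ?subr0 ?normr1//.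
    by rewrite ler_piMr// ger0_norm; have := f01 x; lra.
  by rewrite !indicE in_setU; case: (x \in A); case: (x \in B) => /=; ring.
rewrite (_ : e%:E = (e / 2)%:E + (e / 2)%:E)%E; last by rewrite -EFinD; congr EFin; lra.
exact: leeD.
Qed.

Lemma approximable0 : approximable set0.
Proof.
split=> // e e0; exists (cst 0); split; first exact: cst_continuous.
  by move=> x /=; rewrite lexx ler01.
rewrite integral0_eq ?lee_fin ?ltW// => x _.
by rewrite indic0 /cst subrr normr0.
Qed.

Lemma approximable_bigcup (F : nat -> set V) : (forall k, approximable (F k)) ->
  approximable (\bigcup_k F k).
Proof.
move=> aF.
apply: (@approximable_lim _ (fun k => \big[setU/set0]_(i < k) F i)).
- by apply: bigcup_measurable => k _; case: (aF k).
- elim=> [|k IHk]; first by rewrite big_ord0; exact: approximable0.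
  by rewrite big_ord_recr/=; exact: approximableU.
- move=> x; apply: cvg_near_cst.
  have [[i _ Fix]|nF] := pselect ((\bigcup_k F k) x).
    exists i.+1 => // k /= ik; rewrite !indicE !mem_set//; first by exists i.
    by rewrite -bigcup_mkord; exists i.
  apply: nearW => k; rewrite !indicE !memNset//.
  by rewrite -bigcup_mkord => -[i _ Fix]; apply: nF; exists i.
Qed.

(** Half-open intervals generate the Borel sets of the line; their indicators
are pointwise limits of the trapezoidal functions [hk]. *)
Lemma approximable_coord (i : 'I_n) (Y : set (measurableTypeR R)) : measurable Y ->
  approximable (rV_coord i @^-1` Y).
Proof.
move: Y.
apply: smallest_sub => /=.
  split.
  - by rewrite /= preimage_set0; exact: approximable0.
  - by move=> A /= aA; rewrite setTD preimage_setC; exact: approximableC.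
  - by move=> F aF /=; rewrite preimage_bigcup; exact: approximable_bigcup.
move=> _ [[a b] _ <-] /=.
pose hk k (t : R) := clamp (k%:R * (t - a)) * clamp (1 - k%:R * (t - b)).
have mB : measurable (rV_coord i @^-1` `]a, b]%classic : set V).
  by rewrite -[X in measurable X]setTI; exact: measurable_rV_coord.
split => // e e0.
have chk k : continuous (fun x : V => hk k (x 0 i)).
  move=> x.
  have ci : {for x, continuous (fun y : V => y 0 i)} by exact: coord_continuous.
  have ch : continuous (hk k).
    move=> t; rewrite /hk; apply: (@cvgM R _ (nbhs (t : R))).
      apply: (@continuous_comp _ _ _ (fun t => k%:R * (t - a)) clamp); last exact: continuous_clamp.
      apply: (@cvgMr R); apply: cvgB; [exact: cvg_id|exact: cvg_cst].
    apply: (@continuous_comp _ _ _ (fun t => 1 - k%:R * (t - b)) clamp); last exact: continuous_clamp.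
    apply: cvgB; first exact: cvg_cst.
    apply: (@cvgMr R); apply: cvgB; [exact: cvg_id|exact: cvg_cst].
  exact: (continuous_comp ci (ch _)).
have hk01 k t : 0 <= hk k t <= 1.
  by rewrite /hk; have := clamp_itv (k%:R * (t - a)); have := clamp_itv (1 - k%:R * (t - b)); nra.
have hlim t : (fun k => hk k t) @ \oo --> (\1_(`]a, b]%classic) t : R).
  apply: cvg_near_cst.
  have [ta|ta] := leP t a.
    apply: nearW => k; rewrite indicE memNset; last by rewrite /= in_itv/= ltNge ta.
    by rewrite /hk clamp0 ?mul0r// mulr_ge0_le0// subr_le0.
  have ta' : 0 < t - a by rewrite subr_gt0.
  have near1 : \forall k \near \oo, clamp (k%:R * (t - a)) = 1.
    near=> k; apply: clamp1.
    rewrite -ler_pdivrMr//; near: k; exact: nbhs_infty_ger.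
  have [tb|tb] := leP t b.
    apply: filterS near1 => k h1; rewrite /hk h1 mul1r indicE mem_set; last by rewrite /= in_itv/= ta tb.
    rewrite clamp1//.
    by rewrite lerBrDr addrC -lerBrDr subrr mulr_ge0_le0// subr_le0.
  have tb' : 0 < t - b by rewrite subr_gt0.
  near=> k; rewrite indicE memNset; last by rewrite /= in_itv/= ta/= leNgt tb.
  rewrite /hk [X in _ * X]clamp0 ?mulr0//.
  rewrite subr_le0 -ler_pdivrMr//; near: k; exact: nbhs_infty_ger.
have : dist (\1_(rV_coord i @^-1` `]a, b]%classic)) (fun x => hk k (x 0 i)) @[k --> \oo] --> 0%E.
  have mF k : measurable_fun Q (fun x : V => \1_(rV_coord i @^-1` `]a, b]%classic) x - hk k (x 0 i) : R).
    apply: measurable_funTS; apply: borel_Rn_measurable_fun.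
    exact: (measurable_funB (mind mB) (continuous_rV_measurable (chk k))).
  have bF k x : Q x -> `|\1_(rV_coord i @^-1` `]a, b]%classic) x - hk k (x 0 i) : R| <= 2.
    move=> _; have /andP[h0 h1] := hk01 k (x 0 i).
    rewrite (le_trans (ler_normB _ _))// (ger0_norm h0) indicE.
    by case: (x \in _); rewrite ?normr1 ?normr0; lra.
  apply: (bounded_cvg0 mQ Qfin mF bF).
  move=> x _; rewrite -(subrr (\1_(rV_coord i @^-1` `]a, b]%classic) x : R)).
    apply: cvgB; first exact: cvg_cst.
    exact: (hlim (x 0 i)).
move/fine_cvgP => [finB] /cvgrPdist_le/(_ _ e0) clB.
have [k [fk ck]] := filter_ex (filterI finB clB).
exists (fun x => hk k (x 0 i)); split => //.
rewrite -/(dist _ _) -(fineK fk) lee_fin.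
by move: ck; rewrite sub0r normrN; exact: le_trans (ler_norm _).
Unshelve. all: by end_near. Qed.

Lemma borel_approximable (B : set V) : measurable B -> approximable B.
Proof.
apply: smallest_sub => /=.
  split.
  - exact: approximable0.
  - by move=> A aA; rewrite setTD; exact: approximableC.
  - by move=> F aF; exact: approximable_bigcup.
rewrite -bigcup_seq; apply: bigcup_sub => i _ B' [Y mY <-].
by rewrite setTI; exact: approximable_coord.
Qed.

End borel_approximation.
(** * Mollification converges in square mean *)

Section ereal_null_sequences.
Context {R : realType}.

Lemma ecvg0P (u : nat -> \bar R) : (forall k, (0 <= u k)%E) ->
  u @ \oo --> 0%E <-> forall e : R, 0 < e -> \forall k \near \oo, (u k <= e%:E)%E.
Proof.
move=> u0; split.
  move/fine_cvgP => [finu] /cvgrPdist_le cu e e0.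
  apply: filterS2 finu (cu _ e0) => k uk; rewrite sub0r normrN => h.
  by rewrite -(fineK uk) lee_fin (le_trans (ler_norm _)).
move=> H; apply/fine_cvgP; split.
  by apply: filterS (H 1 ltr01) => k uk; rewrite ge0_fin_numE// (le_lt_trans uk)// ltry.
apply/cvgrPdist_le => e e0; apply: filterS (H _ e0) => k uk.
rewrite sub0r normrN ger0_norm ?fine_ge0//.
have fu : u k \is a fin_num by rewrite ge0_fin_numE// (le_lt_trans uk)// ltry.
by rewrite -lee_fin fineK.
Qed.

End ereal_null_sequences.

Section mollifier_convergence.
Import HBNNSimple.
Context {R : realType} {n : nat}.
Local Notation V := 'rV[R]_n.
Local Notation mu := (lebesgue R n).
Implicit Types (f g h : V -> R) (x : V) (k : nat).
Hypothesis n0 : (0 < n)%N.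

Local Notation rho := (@mollifier R n).

Definition mollifiable g := L2b g /\
  sqint setT (fun x => convolve g (rho k) x - g x) @[k --> \oo] --> 0%E.

Let trho k : testfun (rho k). Proof. by have [t _ _ _] := @averaging_mollifier R n n0 k; exact: t. Qed.

Let mconv g k : L2b g -> measurable_fun (setT : set (Rn R n)) (convolve g (rho k)).
Proof.
move=> Lg; apply: smooth_measurable.
exact: (smooth_conv (L2b_integrable Lg) (trho k)).
Qed.

Lemma convolve_lin (a b : R) f g k : L2b f -> L2b g ->
  convolve (fun x => a * f x + b * g x) (rho k) =
  (fun x => a * convolve f (rho k) x + b * convolve g (rho k) x).
Proof.
move=> Lf Lg; apply/funext => x.
have i1 := conv_integrable (L2b_integrable Lf) x (trho k).
have i2 := conv_integrable (L2b_integrable Lg) x (trho k).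
rewrite /convolve -(RintegralZl a measurableT i1) -(RintegralZl b measurableT i2).
rewrite -RintegralD//; [|exact: (integrableZl measurableT a i1)|
  exact: (integrableZl measurableT b i2)].
by apply: eq_Rintegral => y _; rewrite mulrDl !mulrA.
Qed.

(** Write [g] as [h + (g - h)]: by Young's inequality mollification does not
increase the norm of the small part [g - h], uniformly in [k]. *)
Lemma mollifiable_lim g : L2b g ->
  (forall e : R, 0 < e -> exists2 h, mollifiable h &
    (sqint setT (fun x => (g x - h x)%R) <= e%:E)%E) -> mollifiable g.
Proof.
move=> Lg H; split => //; apply/ecvg0P => [k|e e0]; first exact: sqint_ge0.
have e16 : 0 < e / 16 by lra.
have [h [Lh ch] gh] := H _ e16.
have e4 : 0 < e / 4 by lra.
move/(ecvg0P (fun=> sqint_ge0 _ _)) : ch => /(_ _ e4).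
apply: filterS => k sk.
have [mg _ _] := Lg; have [mh _ _] := Lh.
pose gh' x := 1 * g x + (-1) * h x.
have Lgh : L2b gh' by exact: L2bD.
have [mgh _ _] := Lgh.
have gh'E : (fun x => g x - h x) = gh'.
  by apply/funext => x; rewrite /gh' mul1r mulN1r.
rewrite gh'E in gh.
have young := averaging_young (@averaging_mollifier R n n0 k) Lgh.
have mA := measurable_funB (mconv k Lh) mh.
have mB : measurable_fun (setT : set (Rn R n)) (fun x => convolve gh' (rho k) x - gh' x).
  exact: (measurable_funB (mconv k Lgh) mgh).
have l2 : (0 : R) <= 2 by [].
have s1 : (sqint setT (fun x => (convolve gh' (rho k) x - gh' x)%R) <=
    2%:E * sqint setT (convolve gh' (rho k)) + 2%:E * sqint setT gh')%E.
  apply: (sqint_lin measurableT (mconv k Lgh) mgh mB l2 l2) => x _.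
  by have := sqr_ge0 (convolve gh' (rho k) x + gh' x); rewrite !expr2; lra.
apply: (@le_trans _ _ (2%:E * (e / 4)%:E + 2%:E * (2%:E * (e / 16)%:E + 2%:E * (e / 16)%:E))%E);
  last by rewrite -!(EFinM, EFinD) lee_fin; lra.
apply: (@le_trans _ _ (2%:E * sqint setT (fun x => (convolve h (rho k) x - h x)%R) +
   2%:E * sqint setT (fun x => (convolve gh' (rho k) x - gh' x)%R))%E).
  apply: (sqint_lin measurableT mA mB (measurable_funB (mconv k Lg) mg) l2 l2) => x _ /=.
  rewrite /gh' convolve_lin//.
  set a := convolve g _ x; set b := convolve h _ x.
  have := sqr_ge0 (b - h x - (1 * a + -1 * b - (1 * g x + -1 * h x))).
  by rewrite !expr2; lra.
apply: leeD; first by rewrite lee_pmul2l.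
rewrite lee_pmul2l//; apply: (le_trans s1).
apply: leeD; rewrite lee_pmul2l//.
exact: le_trans young gh.
Qed.

Lemma mollifiable_lin (a b : R) f g : mollifiable f -> mollifiable g ->
  mollifiable (fun x => a * f x + b * g x).
Proof.
move=> [Lf cf] [Lg cg]; have Lfg := L2bD a b Lf Lg; split => //.
have [mf _ _] := Lf; have [mg _ _] := Lg; have [mfg _ _] := Lfg.
apply/ecvg0P => [k|e e0]; first exact: sqint_ge0.
pose c := 2 * a ^+ 2 + 2 * b ^+ 2 + 1.
have a2 : 0 <= 2 * a ^+ 2 by rewrite mulr_ge0// sqr_ge0.
have b2 : 0 <= 2 * b ^+ 2 by rewrite mulr_ge0// sqr_ge0.
have c0 : 0 < c by rewrite /c; lra.
have ec : 0 < e / c by rewrite divr_gt0.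
move/(ecvg0P (fun=> sqint_ge0 _ _)) : cf => /(_ _ ec) cf.
move/(ecvg0P (fun=> sqint_ge0 _ _)) : cg => /(_ _ ec) cg.
apply: filterS2 cf cg => k cf cg.
apply: (@le_trans _ _ ((2 * a ^+ 2)%:E * (e / c)%:E + (2 * b ^+ 2)%:E * (e / c)%:E)%E).
  apply: (@le_trans _ _ ((2 * a ^+ 2)%:E * sqint setT (fun x => (convolve f (rho k) x - f x)%R) +
     (2 * b ^+ 2)%:E * sqint setT (fun x => (convolve g (rho k) x - g x)%R))%E).
    apply: (sqint_lin measurableT (measurable_funB (mconv k Lf) mf)
      (measurable_funB (mconv k Lg) mg) (measurable_funB (mconv k Lfg) mfg) a2 b2) => x _ /=.
    rewrite convolve_lin//; set u := convolve f _ x; set v := convolve g _ x.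
    have := sqr_ge0 (a * (u - f x) - b * (v - g x)).
    by rewrite !expr2; lra.
  by apply: leeD; rewrite lee_wpmul2l// lee_fin.
rewrite -!(EFinM, EFinD) lee_fin -mulrDl.
rewrite [leRHS](_ : e = c * (e / c)); last by rewrite mulrC divfK// gt_eqF.
by rewrite ler_wpM2r ?(ltW ec)// /c; lra.
Qed.

Lemma mollifiable_continuous f : continuous f -> bsupp f -> mollifiable f.
Proof.
move=> cf bf; split; first exact: continuous_bsupp_L2b.
exact: continuous_conv_cvg.
Qed.

Lemma mollifiable0 : mollifiable (fun=> 0).
Proof.
apply: mollifiable_continuous; first exact: cst_continuous.
by exists 0 => x; rewrite eqxx.
Qed.

Lemma indic_L2b (E : set (Rn R n)) M : measurable E -> E `<=` @cube R n M ->
  L2b (\1_E : V -> R).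
Proof.
move=> mE EM.
have mi : measurable_fun (setT : set (Rn R n)) (\1_E : V -> R) by exact: measurable_indic.
split => //.
  apply: (@le_lt_trans _ _ (mu E)).
    rewrite -[X in (_ <= mu X)%E]setIT -integral_indic// /sqint.
    rewrite (_ : (fun x => (_ ^+ 2)%:E) = (fun x => (\1_E x)%:E))//.
    by apply/funext => x; rewrite indicE; case: (x \in E); rewrite ?expr1n ?expr0n.
  apply: le_lt_trans (@lebesgue_cube_lty R n M).
  by apply: le_measure => //; rewrite inE//; exact: measurable_cubeR.
exists M => x; rewrite indicE; have [|] := boolP (x \in E); last by rewrite eqxx.
by rewrite inE => /EM.
Qed.

Lemma sqint_indicB (A B : set (Rn R n)) : measurable A -> measurable B -> A `<=` B ->
  sqint setT (fun x => (\1_A x - \1_B x : R)) = mu (B `\` A).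
Proof.
move=> mA mB AB.
rewrite -[X in _ = mu X]setIT -integral_indic//; last exact: measurableD.
apply: eq_integral => x _; congr EFin.
rewrite !indicE in_setD.
case: (boolP (x \in A)) => [xA|_].
  by rewrite (_ : x \in B) ?subrr ?expr0n//; move: xA; rewrite !inE; exact: AB.
by case: (x \in B); rewrite /= ?sub0r ?sqrrN ?expr1n ?oppr0 ?expr0n.
Qed.

(** An approximating continuous function has to be multiplied by a continuous
cutoff to acquire bounded support.  As all functions have values between
0 and 1, closeness in [L^1] gives closeness in [L^2]. *)
Lemma mollifiable_borel_indic (B : set V) M : measurable B -> B `<=` cube M ->
  mollifiable (\1_B).
Proof.
move=> mB BM.
have mB' : measurable (B : set (Rn R n)) by exact: borel_Rn_measurable.
have LB := indic_L2b mB' BM.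
apply: mollifiable_lim => // e e0.
have [f [cf f01 fe]] := (borel_approximable (M + 1) mB).2 _ e0.
pose chi x : R := clamp (M + 1 - `|x|).
have cchi : continuous chi.
  move=> x.
  have cn : {for x, continuous (fun y : V => M + 1 - `|y|)}.
    apply: (@cvgB _ R^o _ (nbhs (x : V)) _ (cst (M + 1))); first exact: cvg_cst.
    exact: norm_continuous.
  exact: (continuous_comp cn (@continuous_clamp R _)).
have chi01 x : 0 <= chi x <= 1 by exact: clamp_itv.
have chi1 x : `|x| <= M -> chi x = 1.
  by move=> xM; apply: clamp1; lra.
have chi0 x : ~ `|x| <= M + 1 -> chi x = 0.
  move=> /negP; rewrite -ltNge => xM; apply: clamp0; lra.
pose h x := f x * chi x.
have ch : continuous h by move=> x; exact: (cvgM (cf x) (cchi x)).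
have bh : bsupp h.
  exists (M + 1) => x; apply: contraPP => /chi0 c0.
  by rewrite /h c0 mulr0 eqxx.
exists h; first exact: mollifiable_continuous.
apply: le_trans fe.
pose Q : set (Rn R n) := @cube R n (M + 1).
have mQ : measurable Q by exact: measurable_cubeR.
have md (g : V -> R) : continuous g ->
    measurable_fun (setT : set (Rn R n)) (fun x : V => \1_B x - g x : R).
  move=> cg; apply: borel_Rn_measurable_fun.
  have mi : measurable_fun (setT : set V) (\1_B : V -> R) by exact: measurable_indic.
  exact: (measurable_funB mi (continuous_rV_measurable cg)).
have mdf : measurable_fun Q (fun x => `|\1_B x - f x|%:E).
  apply: measurable_funTS; apply/measurable_EFinP.
  exact: (measurableT_comp (@normr_measurable R setT) (md f cf)).
rewrite [leRHS]integral_mkcond.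
have sq0 x : setT x -> (0 <= ((\1_B x - h x) ^+ 2)%:E)%E by rewrite lee_fin sqr_ge0.
apply: (ge0_le_integral mu measurableT sq0 (measurable_sqr (md h ch))
  ((measurable_restrictT _ mQ).1 mdf)).
move=> x _; rewrite patchE; case: ifPn => [|/negP]; rewrite inE /Q /cube/= => xQ; last first.
  rewrite /h chi0// mulr0 subr0 indicE memNset ?expr0n// => /BM; rewrite /cube/=.
  by move=> xM; apply: xQ; apply: le_trans xM _; rewrite lerDl.
rewrite lee_fin.
have fx := f01 x; have cx := chi01 x.
have [xM|xM] := pselect (`|x| <= M).
  rewrite /h chi1// mulr1 -real_normK ?num_real// expr2 ler_piMr//.
  by rewrite ler_norml indicE; case: (x \in B); rewrite /=; lra.
have -> : \1_B x = 0 :> R by rewrite indicE memNset// => /BM.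
rewrite !sub0r sqrrN normrN (ger0_norm (_ : 0 <= f x)); last by lra.
have [fx0 fx1] := andP fx; have [cx0 cx1] := andP cx.
by rewrite /h expr2 -[leRHS]mulr1; apply: ler_pM; rewrite ?mulr_ge0 ?ler_piMr ?mulr_ile1.
Qed.

(** A Lebesgue measurable set differs by small measure from a Borel set that
contains it. *)
Lemma mollifiable_indic (E : set (Rn R n)) M : measurable E -> E `<=` @cube R n M ->
  mollifiable (\1_E).
Proof.
move=> mE EM.
have Efin : (mu E < +oo)%E.
  apply: le_lt_trans (@lebesgue_cube_lty R n M).
  by apply: le_measure => //; rewrite inE//; exact: measurable_cubeR.
apply: mollifiable_lim; first exact: indic_L2b mE EM.
move=> e e0.
have [B [mB EB Be]] := lebesgue_outer_approx e0 Efin.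
pose B' := B `&` @cube R n M.
have mB'b : measurable B' by apply: measurableI => //; exact: measurable_cube.
have mB' : measurable (B' : set (Rn R n)) by exact: borel_Rn_measurable.
have EB' : E `<=` B' by move=> x Ex; split; [exact: EB|exact: EM].
exists (\1_B'); first by apply: (@mollifiable_borel_indic _ M) => // x [].
rewrite sqint_indicB// measureD//.
  rewrite setIidr// leeBlDl ?ge0_fin_numE//.
  apply: le_trans Be; rewrite -lebesgueE//.
  by apply: le_measure; rewrite ?inE//; [exact: borel_Rn_measurable|move=> x []].
apply: le_lt_trans (@lebesgue_cube_lty R n M).
by apply: le_measure; rewrite ?inE//; [exact: measurable_cubeR|move=> x []].
Qed.

Lemma mollifiable_sum (I : Type) (s : seq I) (F : I -> V -> R) :
  (forall i, mollifiable (F i)) -> mollifiable (fun x => \sum_(i <- s) F i x).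
Proof.
move=> HF; elim: s => [|i s IHs].
  by under eq_fun do rewrite big_nil; exact: mollifiable0.
under eq_fun do rewrite big_cons.
have := mollifiable_lin 1 1 (HF i) IHs.
by under eq_fun do rewrite !mul1r.
Qed.

Lemma mollifiable_nnsfun (s : {nnsfun Rn R n >-> R}) :
  bsupp (fun x => s x) -> mollifiable (fun x => s x).
Proof.
move=> [M sM].
rewrite (_ : (fun x => s x) = (fun x =>
    \sum_(c <- finmap.enum_fset (fset_set (range s))) c * \1_(s @^-1` [set c]) x)); last first.
  by apply/funext => x; rewrite fimfunE fsbig_finite.
apply: mollifiable_sum => c.
have [->|c0] := eqVneq c 0.
  by under eq_fun do rewrite mul0r; exact: mollifiable0.
have mi : mollifiable (\1_(s @^-1` [set c])).
  apply: (@mollifiable_indic _ M) => // x /= sxc.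
  by apply: sM; rewrite sxc.
have := mollifiable_lin c 0 mi mollifiable0.
by under eq_fun do rewrite mul0r addr0.
Qed.

(** Simple functions increase to [g]; the squares of the differences are
dominated by [g^2]. *)
Lemma mollifiable_ge0 g : L2b g -> (forall x, 0 <= g x) -> mollifiable g.
Proof.
move=> Lg g0; have [mg gfin [M gM]] := Lg.
have mEg : measurable_fun (setT : set (Rn R n)) (EFin \o g) by exact/measurable_EFinP.
pose s := nnsfun_approx measurableT mEg.
have cs x : (fun k => s k x) @ \oo --> g x.
  have : EFin \o s^~ x @ \oo --> (g x)%:E.
    by apply: (cvg_nnsfun_approx measurableT mEg) => // y _; rewrite lee_fin.
  by move/fine_cvgP => [].
have s_ge0 k x : 0 <= s k x by exact: fun_ge0.
have sg k x : s k x <= g x.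
  have ndx : nondecreasing_seq (fun k => s k x).
    by move=> i j ij; have /lefP := nd_nnsfun_approx measurableT mEg ij; apply.
  rewrite -(cvg_lim _ (cs x))//; apply: nondecreasing_cvgn_le => //.
  by apply/cvg_ex; exists (g x).
apply: mollifiable_lim => // e e0.
have ms k : measurable_fun (setT : set (Rn R n)) (s k) by [].
have H : sqint setT (fun x => g x - s k x) @[k --> \oo] --> 0%E.
  have -> : (0 = \int[mu]_(x in setT) cst 0%:E x)%E by rewrite integral0_eq.
  have mF k : measurable_fun (setT : set (Rn R n)) (fun x => ((g x - s k x) ^+ 2)%:E).
    exact: (measurable_sqr (measurable_funB mg (ms k))).
  have intg2 := sqr_integrable measurableT mg gfin.
  apply: (dominated_cvg measurableT mF _ _ intg2) => //.
    move=> x _; apply: cvg_EFin; first exact: nearW.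
    have h : (fun k => g x - s k x) @ \oo --> 0.
      by rewrite -(subrr (g x)); apply: cvgB; [exact: cvg_cst|exact: cs].
    by have := cvgM h h; rewrite mulr0; exact.
  move=> k x _; rewrite abse_EFin lee_fin ger0_norm ?sqr_ge0//.
  have h1 := sg k x; have h2 := s_ge0 k x.
  by rewrite ler_pXn2r ?nnegrE ?subr_ge0// lerBlDr lerDl.
move/(ecvg0P (fun=> sqint_ge0 _ _)) : H => /(_ _ e0) /filter_ex[k hk].
exists (fun x => s k x) => //; apply: mollifiable_nnsfun; exists M => x sx.
apply: gM; apply: contra_neq sx => gx0; apply/eqP.
by rewrite eq_le s_ge0 -gx0 sg.
Qed.

Lemma L2b_mollifiable g : L2b g -> mollifiable g.
Proof.
move=> Lg; have [mg gfin [M gM]] := Lg.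
have part (h : V -> R) : measurable_fun (setT : set (Rn R n)) h ->
    (forall x, 0 <= h x) -> (forall x, h x <= `|g x|) -> mollifiable h.
  move=> mh h0 hg; apply: mollifiable_ge0 => //; split => //.
    apply: le_lt_trans gfin; apply: le_sqint => // x _.
    by rewrite ger0_norm.
  exists M => x hx; apply: gM; apply: contra_neq hx => gx.
  by apply/eqP; rewrite eq_le h0 (le_trans (hg x))// gx normr0.
have mp : mollifiable (fun x => Num.max (g x) 0).
  apply: part; first exact: (measurable_funrpos mg).
    by move=> x; rewrite le_max lexx orbT.
  by move=> x; rewrite ge_max normr_ge0 ler_norm.
have mn : mollifiable (fun x => Num.max (- g x) 0).
  apply: part; first exact: (measurable_funrneg mg).
    by move=> x; rewrite le_max lexx orbT.
  by move=> x; rewrite ge_max normr_ge0 -normrN ler_norm.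
have := mollifiable_lin 1 (-1) mp mn.
rewrite (_ : (fun x => _) = g)//; apply/funext => x.
rewrite mul1r mulN1r.
by case: (leP (g x) 0) => h; case: leP => h'; lra.
Qed.

End mollifier_convergence.

(** * Weak derivatives on a ball *)

Section weak_derivatives.
Context {R : realType} {n : nat}.
Local Notation V := 'rV[R]_n.
Local Notation mu := (lebesgue R n).
Implicit Types (f g h u v : V -> R) (x : V) (k : nat).
Hypothesis n0 : (0 < n)%N.
Variable r : R.
Hypothesis r0 : 0 < r.

Let D : set (Rn R n) := @eball R n r.

Let mD : measurable D.
Proof. by apply: borel_Rn_measurable; exact: measurable_eball. Qed.

Let Dfin : (mu D < +oo)%E.
Proof. by apply: le_lt_trans (lebesgue_eball_le r0) _; exact: ltry. Qed.

Let DE x : D x <-> nsq x < r ^+ 2.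
Proof. by rewrite /D eballE. Qed.

Lemma closed_nsq_le (c : R) : closed [set x : V | nsq x <= c].
Proof.
rewrite (_ : [set x : V | nsq x <= c] = (@nsq R n) @^-1` [set t | t <= c])//.
by apply: closed_comp => [x _|]; [exact: continuous_nsq|exact: closed_le].
Qed.

Lemma eball_test_function (c : R) phi : c < r ^+ 2 -> testfun phi ->
  (forall x, phi x != 0 -> nsq x <= c) -> test_function (@eball R n r) phi.
Proof.
move=> cr tphi phic.
have sub : [set x : V | nsq x <= c] `<=` @eball R n r.
  by move=> x /= xc; apply/DE; exact: le_lt_trans cr.
exact: (@testfun_test_function R n _ _ phi tphi (@closed_nsq_le c) sub phic).
Qed.

Lemma L2_lin (a b : R) f g : L2 D f -> L2 D g -> L2 D (fun x => a * f x + b * g x).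
Proof.
move=> [mf ff] [mg gf].
have maf : measurable_fun D (fun x => a * f x) by exact: (measurable_funM (measurable_cst a) mf).
have mbg : measurable_fun D (fun x => b * g x) by exact: (measurable_funM (measurable_cst b) mg).
have mfg := measurable_funD maf mbg; split; first exact: mfg.
have a2 : 0 <= 2 * a ^+ 2 by rewrite mulr_ge0// sqr_ge0.
have b2 : 0 <= 2 * b ^+ 2 by rewrite mulr_ge0// sqr_ge0.
apply: (le_lt_trans (sqint_lin mD mf mg mfg a2 b2 _)).
  by move=> x _ /=; have := sqr_ge0 (a * f x - b * g x); rewrite !expr2; lra.
have H c w : 0 <= c -> (sqint D w < +oo -> c%:E * sqint D w < +oo)%E.
  by move=> c0 uoo; apply: lte_mul_pinfty; rewrite ?lee_fin.
by apply: lte_add_pinfty; [exact: (H _ f)|exact: (H _ g)].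
Qed.

Lemma L2_bounded_mul f h (C : R) : measurable_fun D h -> (forall x, `|h x| <= C) ->
  L2 D f -> L2 D (fun x => h x * f x).
Proof.
move=> mh hC [mf ff]; have mhf := measurable_funM mh mf; split; first exact: mhf.
have C2 : 0 <= C ^+ 2 by exact: sqr_ge0.
apply: (le_lt_trans (sqint_lin mD mf mf mhf C2 (lexx 0) _)).
  move=> x _ /=; rewrite mul0r addr0 exprMn ler_wpM2r ?sqr_ge0//.
  rewrite -real_normK ?num_real// ler_pXn2r ?nnegrE ?normr_ge0//.
  exact: le_trans (hC x).
rewrite mul0e adde0; apply: lte_mul_pinfty => //; by rewrite lee_fin.
Qed.

Lemma L2_mul_integrable f g : L2 D f -> L2 D g ->
  mu.-integrable D (EFin \o (fun x => f x * g x)).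
Proof.
move=> [mf ff] [mg gf].
have i1 := sqr_integrable mD mf ff; have i2 := sqr_integrable mD mg gf.
apply: (le_integrable mD _ _ (integrableD mD i1 i2)).
  by apply/measurable_EFinP; exact: (measurable_funM mf mg).
move=> x _ /=; rewrite lee_fin [leRHS]ger0_norm ?addr_ge0 ?sqr_ge0//.
rewrite ler_norml; apply/andP; split.
  have := sqr_ge0 (f x + g x); have := sqr_ge0 (f x); have := sqr_ge0 (g x).
  by rewrite !expr2; lra.
have := sqr_ge0 (f x - g x); have := sqr_ge0 (f x); have := sqr_ge0 (g x).
by rewrite !expr2; lra.
Qed.

Lemma testfun_measurableD f : testfun f -> measurable_fun D f.
Proof. by move=> [sf _]; apply: measurable_funTS; exact: smooth_measurable. Qed.

Lemma L2_testfun f : testfun f -> L2 D f.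
Proof.
move=> tf; have [sf bf] := tf; split; first exact: testfun_measurableD.
have [mf ff _] := continuous_bsupp_L2b (smooth_continuous sf) bf.
apply: le_lt_trans ff.
have sq0 x : setT x -> (0 <= (f x ^+ 2)%:E)%E by rewrite lee_fin sqr_ge0.
exact: (ge0_subset_integral mu mD measurableT (measurable_sqr mf) sq0 (@subsetT _ _)).
Qed.

Lemma sqint_restrict f : sqint setT (f \_ D) = sqint D f.
Proof.
rewrite /sqint [RHS]integral_mkcond; apply: eq_integral => x _.
by rewrite !patchE; case: ifP => // _; rewrite expr0n.
Qed.

Lemma L2b_restrict f : L2 D f -> L2b (f \_ D).
Proof.
move=> [mf ff]; split; first exact: ((measurable_restrictT _ mD).1 mf).
  by rewrite sqint_restrict.
exists r => x; rewrite patchE; case: ifPn; last by rewrite eqxx.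
rewrite inE => /DE Dx _; apply: mx_norm_nsq; exact: ltW.
Qed.

Lemma convolve_restrict f g x :
  convolve (f \_ D) g x = \int[mu]_(y in D) (f y * g (x - y)).
Proof.
rewrite /convolve [RHS]Rintegral_mkcond; apply: eq_Rintegral => y _.
by rewrite !patchE; case: ifP => // _; rewrite mul0r.
Qed.

Lemma sqint_eq0_ae f : measurable_fun D f -> sqint D f = 0%E ->
  {ae mu, forall x, D x -> f x = 0}.
Proof.
move=> mf f0.
have : (\int[mu]_(x in D) `|(f x ^+ 2)%:E| = 0)%E.
  rewrite -f0; apply: eq_integral => x _.
  by rewrite abse_EFin ger0_norm ?sqr_ge0.
move/(ae_eq_integral_abs _ mD (measurable_sqr mf)).
apply: filterS => x h Dx; have := h Dx => -[] /eqP.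
by rewrite sqrf_eq0 => /eqP.
Qed.

(** The fundamental lemma of the calculus of variations.  For a cutoff [zeta j],
every mollification of [zeta j g] is an integral of [g] against a test function,
hence 0, so the limit [zeta j g] is 0 almost everywhere.  The cutoffs are
positive on balls that exhaust [D]. *)
Lemma test_function_vanish g : L2 D g ->
  (forall phi, test_function (@eball R n r) phi ->
     \int[mu]_(x in D) (g x * phi x) = 0) ->
  {ae mu, forall x, D x -> g x = 0}.
Proof.
move=> Lg gphi; have [mg _] := Lg.
(* Squared radii increasing to [r^2]. *)
pose c j : R := r ^+ 2 * (1 - j.+1%:R^-1).
have cr j : c j < r ^+ 2.
  by rewrite -[ltRHS]mulr1 ltr_pM2l ?exprn_gt0// ltrBlDr ltrDl invr_gt0.
pose zeta j : V -> R := flat_bump 0 (c j) 1.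
have tz j : testfun (zeta j) by exact: testfun_flat_bump.
have zc j x : zeta j x != 0 -> nsq x <= c j.
  rewrite /zeta /flat_bump /flat mul1r; case: ifPn => [|_]; last by rewrite eqxx.
  by rewrite subr_gt0 => /ltW.
have H j : {ae mu, forall x, D x -> zeta j x * g x = 0}.
  have [C C0 zC] := testfun_bounded (tz j).
  have Lzg := L2_bounded_mul (testfun_measurableD (tz j)) zC Lg.
  have [mzg _] := Lzg.
  apply: sqint_eq0_ae => //.
  have [LG] := L2b_mollifiable n0 (L2b_restrict Lzg).
  have cv0 k x : convolve ((fun y => zeta j y * g y) \_ D) (mollifier k) x = 0.
    rewrite convolve_restrict.
    have [tm _ _ _] := @averaging_mollifier R n n0 k.
    have tphi : test_function (@eball R n r) (fun y => zeta j y * mollifier k (x - y)).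
      apply: (eball_test_function (cr j)).
        apply: (testfunM (tz j).1); exact: testfun_refl.
      by move=> y; rewrite mulf_eq0 negb_or => /andP[/zc].
    rewrite -[RHS](gphi _ tphi); apply: eq_Rintegral => y _.
    by rewrite [zeta j y * g y]mulrC -mulrA.
  rewrite (_ : (fun k => _) = (fun=> sqint D (fun x => zeta j x * g x))).
    by move/cvg_lim => <-//; rewrite lim_cst.
  apply/funext => k; rewrite -sqint_restrict; apply: eq_integral => x _.
  by rewrite cv0 sub0r sqrrN.
move: (ae_foralln H); apply: filterS => x h Dx.
have /DE xr := Dx.
have : exists j : nat, 0 < zeta j x.
  have d0 : 0 < 1 - nsq x / r ^+ 2.
    by rewrite subr_gt0 ltr_pdivrMr ?mul1r// exprn_gt0.
  have [j _ hj] := near_infty_natSinv_lt (PosNum d0).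
  exists j; rewrite /zeta /flat_bump mul1r; apply: flat0_gt0.
  have := hj j (leqnn j) => /= {}hj.
  rewrite subr_gt0 /c -ltr_pdivrMl ?exprn_gt0// mulrC.
  by rewrite ltrBrDr addrC -ltrBrDr.
move=> [j zj]; have := h j Dx => /eqP.
by rewrite mulf_eq0 gt_eqF//= => /eqP.
Qed.

Lemma test_function_testfun phi : test_function (@eball R n r) phi -> testfun phi.
Proof. by move=> /test_functionP[]. Qed.

Lemma L2_testfun_integrable g phi : L2 D g -> testfun phi ->
  mu.-integrable D (EFin \o (fun x => g x * phi x)).
Proof. by move=> Lg tphi; apply: L2_mul_integrable => //; exact: L2_testfun. Qed.

Lemma weak_partial_unique i u g1 g2 : is_weak_partial D i u g1 ->
  is_weak_partial D i u g2 -> {ae mu, forall x, D x -> g1 x = g2 x}.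
Proof.
move=> [L1 h1] [L2' h2].
have Ld : L2 D (fun x => g1 x - g2 x).
  have := L2_lin 1 (-1) L1 L2'.
  by under eq_fun do rewrite mul1r mulN1r.
have Hphi phi : test_function (@eball R n r) phi ->
    \int[mu]_(x in D) ((g1 x - g2 x) * phi x) = 0.
  move=> tphi; have tphi' := test_function_testfun tphi.
  under eq_Rintegral do rewrite mulrBl.
  rewrite (RintegralB mD (L2_testfun_integrable L1 tphi') (L2_testfun_integrable L2' tphi')).
  by apply/eqP; rewrite subr_eq0 -eqr_opp -h1// -h2.
have ae := test_function_vanish Ld Hphi.
apply: (@filterS _ (almost_everywhere mu) _ _ _ _ ae) => x h Dx.
by have := h Dx => /eqP; rewrite subr_eq0 => /eqP.
Qed.

Lemma weak_partialP i u : H1 D u -> is_weak_partial D i u (weak_partial D i u).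
Proof. by move=> [_ /(_ i)]; exact: xgetPex. Qed.

Lemma is_weak_partial_lin (a b : R) i u v g h : L2 D u -> L2 D v ->
  is_weak_partial D i u g -> is_weak_partial D i v h ->
  is_weak_partial D i (fun x => a * u x + b * v x) (fun x => a * g x + b * h x).
Proof.
move=> Lu Lv [Lg hg] [Lh hh]; split; first exact: L2_lin.
have lin p q phi : L2 D p -> L2 D q -> testfun phi ->
    \int[mu]_(x in D) ((a * p x + b * q x) * phi x) =
    a * \int[mu]_(x in D) (p x * phi x) + b * \int[mu]_(x in D) (q x * phi x).
  move=> Lp Lq tphi.
  have i1 := L2_testfun_integrable Lp tphi; have i2 := L2_testfun_integrable Lq tphi.
  rewrite -(RintegralZl a mD i1) -(RintegralZl b mD i2).
  rewrite -(RintegralD mD (integrableZl mD a i1) (integrableZl mD b i2)).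
  by apply: eq_Rintegral => x _; rewrite mulrDl !mulrA.
move=> phi tphi; have tphi' := test_function_testfun tphi.
rewrite lin//; last exact: testfun_partial.
by rewrite lin// hg// hh// !mulrN -opprD.
Qed.

Lemma is_weak_partial_testfun i f : testfun f -> is_weak_partial D i f (partial i f).
Proof.
move=> tf; split; first by apply: L2_testfun; exact: testfun_partial.
move=> phi /test_functionP[tphi phiD dphiD].
have ext p : (forall x, p x != 0 -> D x) -> \int[mu]_(x in D) p x = \int[mu]_x p x.
  move=> pD; rewrite Rintegral_mkcond; apply: eq_Rintegral => x _.
  rewrite patchE; case: ifPn => // /negP; rewrite inE => nDx.
  by apply/esym/eqP; apply: contra_notT nDx; exact: pD.
rewrite ext; last by move=> x; rewrite mulf_eq0 negb_or => /andP[_]; exact: dphiD.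
rewrite ext; last by move=> x; rewrite mulf_eq0 negb_or => /andP[_]; exact: phiD.
exact: testfun_by_parts tf.1 tphi.
Qed.

Lemma test_functionM f phi : smooth f -> test_function (@eball R n r) phi ->
  test_function (@eball R n r) (fun x => f x * phi x).
Proof.
move=> sf tphi; have [sphi cphi phiD] := tphi.
have sub : [set x | f x * phi x != 0] `<=` closure [set x | phi x != 0].
  move=> x /=; rewrite mulf_eq0 negb_or => /andP[_ h]; exact: subset_closure.
apply: (testfun_test_function (testfunM sf (test_function_testfun tphi)) (@closed_closure _ _) phiD).
exact: sub.
Qed.

(** Apply the definition of the weak derivative of [u] to the test function
[zeta phi]. *)
Lemma is_weak_partialM i u g zeta : L2 D u -> is_weak_partial D i u g ->
  testfun zeta ->
  is_weak_partial D i (fun x => zeta x * u x)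
    (fun x => zeta x * g x + partial i zeta x * u x).
Proof.
move=> Lu [Lg hg] tz.
have [C _ zC] := testfun_bounded tz.
have tdz := testfun_partial i tz.
have [C' _ dzC] := testfun_bounded tdz.
have Lzg := L2_bounded_mul (testfun_measurableD tz) zC Lg.
have Ldzu := L2_bounded_mul (testfun_measurableD tdz) dzC Lu.
have Lzu := L2_bounded_mul (testfun_measurableD tz) zC Lu.
split.
  have := L2_lin 1 1 Lzg Ldzu.
  by under eq_fun do rewrite !mul1r.
move=> phi tphi; have tphi' := test_function_testfun tphi.
have dz x : derivable zeta x (delta_mx 0 i) by exact: smooth_derivable tz.1.
have dphi x : derivable phi x (delta_mx 0 i) by exact: smooth_derivable tphi'.1.
have := hg _ (test_functionM tz.1 tphi).
rewrite partialM// => hzphi.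
have i1 : mu.-integrable D (EFin \o (fun x => u x * (zeta x * partial i phi x))).
  apply: L2_testfun_integrable => //; apply: (testfunM tz.1); exact: testfun_partial.
have i2 : mu.-integrable D (EFin \o (fun x => u x * (partial i zeta x * phi x))).
  by apply: L2_testfun_integrable => //; apply: (testfunM tdz.1).
have i3 := L2_testfun_integrable Lzg tphi'.
have i4 := L2_testfun_integrable Ldzu tphi'.
under [in RHS]eq_Rintegral do rewrite mulrDl.
rewrite (RintegralD mD i3 i4).
move: hzphi; under eq_Rintegral do rewrite mulrDr.
rewrite (RintegralD mD i1 i2) => hz.
have e1 : \int[mu]_(x in D) (zeta x * u x * partial i phi x) =
    \int[mu]_(x in D) (u x * (zeta x * partial i phi x)).
  by apply: eq_Rintegral => x _; ring.
have e2 : \int[mu]_(x in D) (partial i zeta x * u x * phi x) =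
    \int[mu]_(x in D) (u x * (partial i zeta x * phi x)).
  by apply: eq_Rintegral => x _; ring.
have e3 : \int[mu]_(x in D) (zeta x * g x * phi x) =
    \int[mu]_(x in D) (g x * (zeta x * phi x)).
  by apply: eq_Rintegral => x _; ring.
by rewrite e1 e2 e3; lra.
Qed.

(** Derivatives of a mollification fall on the kernel, and [zeta] times a
reflected kernel is a test function of the ball, against which the weak
derivative of [u] may be used. *)
Lemma partial_convolve_restrict i u g zeta (c : R) rho x : L2 D u ->
  is_weak_partial D i u g -> testfun zeta -> c < r ^+ 2 ->
  (forall y, zeta y != 0 -> nsq y <= c) -> testfun rho ->
  partial i (convolve ((fun y => zeta y * u y) \_ D) rho) x =
  convolve ((fun y => zeta y * g y + partial i zeta y * u y) \_ D) rho x.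
Proof.
move=> Lu wg tz cr zc trho.
have [C _ zC] := testfun_bounded tz.
have Lzu := L2_bounded_mul (testfun_measurableD tz) zC Lu.
rewrite (partial_conv (L2b_integrable (L2b_restrict Lzu)))// !convolve_restrict.
pose psi y := rho (x - y).
have tpsi : testfun psi by exact: testfun_refl.
have dpsi y : partial i rho (x - y) = - partial i psi y.
  by rewrite partial_refl ?opprK//; exact: trho.1.
have tzpsi : test_function (@eball R n r) (fun y => zeta y * psi y).
  apply: (eball_test_function cr); first exact: (testfunM tz.1).
  by move=> y; rewrite mulf_eq0 negb_or => /andP[/zc].
have dz y : derivable zeta y (delta_mx 0 i) by exact: smooth_derivable tz.1.
have dps y : derivable psi y (delta_mx 0 i) by exact: smooth_derivable tpsi.1.
have tdz := testfun_partial i tz.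
have Lg := wg.1.
have := wg.2 _ tzpsi; rewrite partialM//.
under eq_Rintegral do rewrite mulrDr.
have i1 : mu.-integrable D (EFin \o (fun x => u x * (zeta x * partial i psi x))).
  apply: L2_testfun_integrable => //; apply: (testfunM tz.1); exact: testfun_partial.
have i2 : mu.-integrable D (EFin \o (fun x => u x * (partial i zeta x * psi x))).
  by apply: L2_testfun_integrable => //; apply: (testfunM tdz.1).
have i3 : mu.-integrable D (EFin \o (fun x => g x * (zeta x * psi x))).
  by apply: L2_testfun_integrable => //; apply: (testfunM tz.1).
rewrite (RintegralD mD i1 i2) => h.
have -> : \int[mu]_(y in D) (zeta y * u y * partial i rho (x - y)) =
    - \int[mu]_(y in D) (u y * (zeta y * partial i psi y)).
  rewrite -mulN1r -(RintegralZl _ mD i1); apply: eq_Rintegral => y _.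
  by rewrite dpsi; ring.
have -> : \int[mu]_(y in D) ((zeta y * g y + partial i zeta y * u y) * rho (x - y)) =
    \int[mu]_(y in D) (g y * (zeta y * psi y)) +
    \int[mu]_(y in D) (u y * (partial i zeta y * psi y)).
  rewrite -(RintegralD mD i3 i2); apply: eq_Rintegral => y _.
  by rewrite /psi; ring.
by lra.
Qed.

Lemma sqint_le_setT f : measurable_fun (setT : set (Rn R n)) f ->
  (sqint D f <= sqint setT f)%E.
Proof.
move=> mf.
have sq0 x : setT x -> (0 <= (f x ^+ 2)%:E)%E by rewrite lee_fin sqr_ge0.
exact: (ge0_subset_integral mu mD measurableT (measurable_sqr mf) sq0 (@subsetT _ _)).
Qed.

Lemma mollify_restrict_cvg f : L2 D f ->
  sqint D (fun x => convolve (f \_ D) (mollifier k) x - f x) @[k --> \oo] --> 0%E.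
Proof.
move=> Lf; have LF := L2b_restrict Lf.
have [_ cv] := L2b_mollifiable n0 LF.
apply/ecvg0P => [k|e e0]; first exact: sqint_ge0.
move/(ecvg0P (fun=> sqint_ge0 _ _)) : cv => /(_ _ e0).
apply: filterS => k; apply: le_trans.
have [tm _ _ _] := @averaging_mollifier R n n0 k.
have ms := smooth_measurable (smooth_conv (L2b_integrable LF) tm).
have [mF _ _] := LF.
apply: le_trans (sqint_le_setT (measurable_funB ms mF)).
rewrite /sqint le_eqVlt; apply/orP; left; apply/eqP; apply: eq_integral => x Dx.
by rewrite /= patchE Dx.
Qed.

(** Mollifications of [zeta u] with kernels of radius less than [r / 4] are test
functions of the ball, and by [partial_convolve_restrict] their partial
derivatives are mollifications of the weak derivative of [zeta u]. *)
Lemma cutoff_approx u zeta (g : 'I_n -> V -> R) : L2 D u ->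
  (forall i, is_weak_partial D i u (g i)) -> testfun zeta ->
  (forall x, zeta x != 0 -> nsq x <= r ^+ 2 / 3) ->
  exists phi : nat -> V -> R, [/\ forall k, test_function (@eball R n r) (phi k),
    sqint D (fun x => phi k x - zeta x * u x) @[k --> \oo] --> 0%E &
    forall i, sqint D (fun x => partial i (phi k) x -
      (zeta x * g i x + partial i zeta x * u x)) @[k --> \oo] --> 0%E].
Proof.
move=> Lu wg tz zc.
have r20 : 0 < r ^+ 2 by exact: exprn_gt0.
have [C _ zC] := testfun_bounded tz.
have Lzu := L2_bounded_mul (testfun_measurableD tz) zC Lu.
have r4 : 0 < r / 4 by rewrite divr_gt0.
have [N _ hN] := near_infty_natSinv_lt (PosNum r4).
pose F k := convolve ((fun y => zeta y * u y) \_ D) (mollifier k).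
have LF := L2b_restrict Lzu.
have tF k : testfun (F k).
  have [tm _ _ _] := @averaging_mollifier R n n0 k.
  by apply: (testfun_conv (L2b_integrable LF)) => //; case: LF.
exists (fun k => F (k + N)%N); split.
(* If [|y|^2 <= r^2 / 3] and [|x - y| <= r / 4], then
   [|x|^2 <= 2 |y|^2 + 2 |x - y|^2 <= (2 / 3 + 1 / 8) r^2 = 19 / 24 r^2]. *)
- move=> k; apply: (@eball_test_function (19 / 24 * r ^+ 2)) => //.
    by rewrite -[ltRHS]mul1r ltr_pM2r//; lra.
  move=> x /conv_supp[y [zy /mollifier_supp xy]].
  have {}zy : nsq y <= r ^+ 2 / 3.
    move: zy; rewrite patchE; case: ifPn => [_|]; last by rewrite eqxx.
    by rewrite mulf_eq0 negb_or => /andP[/zc].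
  have := hN (k + N)%N (leq_addl _ _) => /= hk.
  have : (k + N).+1%:R^-1 ^+ 2 <= (r / 4) ^+ 2.
    by rewrite ler_pXn2r ?nnegrE ?invr_ge0 ?(ltW r4)// ltW.
  move=> /(le_trans xy) h2.
  have h1 : nsq x <= 2 * nsq y + 2 * nsq (x - y).
    by have := nsqD y (x - y); rewrite [y + _]addrC subrK.
  by move: h2 zy h1; rewrite !expr2; lra.
- rewrite (cvg_shiftn N (fun k => sqint D (fun x => F k x - zeta x * u x))).
  exact: mollify_restrict_cvg.
- move=> i.
  have tdz := testfun_partial i tz.
  have [C' _ dzC] := testfun_bounded tdz.
  pose G x := zeta x * g i x + partial i zeta x * u x.
  have LG : L2 D G by exact: (is_weak_partialM Lu (wg i) tz).1.
  have E : (fun k => sqint D (fun x => partial i (F k) x - G x)) =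
      (fun k => sqint D (fun x => convolve (G \_ D) (mollifier k) x - G x)).
    apply/funext => k; apply: eq_integral => x _.
    have [tm _ _ _] := @averaging_mollifier R n n0 k.
    rewrite (@partial_convolve_restrict i u (g i) zeta (r ^+ 2 / 3))//.
    by rewrite ltr_pdivrMr// ltr_pMr//; lra.
  rewrite (cvg_shiftn N (fun k => sqint D (fun x => partial i (F k) x - G x))) E.
  exact: mollify_restrict_cvg.
Qed.

Lemma cutoff_H10 u zeta : H1 D u -> testfun zeta ->
  (forall x, zeta x != 0 -> nsq x <= r ^+ 2 / 3) ->
  H10 (@eball R n r) (fun x => zeta x * u x).
Proof.
move=> Hu tz zc; have [Lu _] := Hu.
have wg i := weak_partialP i Hu.
have wzu i := is_weak_partialM Lu (wg i) tz.
have [C _ zC] := testfun_bounded tz.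
have Lzu := L2_bounded_mul (testfun_measurableD tz) zC Lu.
have Hzu : H1 D (fun x => zeta x * u x).
  by split => // i; eexists; exact: (wzu i).
split => //.
have [phi [tphi c0 ci]] := cutoff_approx Lu wg tz zc.
exists phi; split => //.
have tp k := test_function_testfun (tphi k).
pose G i x := zeta x * weak_partial D i u x + partial i zeta x * u x.
have Hd k : H1 D (fun x => phi k x - zeta x * u x) /\
    forall i, is_weak_partial D i (fun x => phi k x - zeta x * u x)
      (fun x => partial i (phi k) x - G i x).
  have W i : is_weak_partial D i (fun x => phi k x - zeta x * u x)
      (fun x => partial i (phi k) x - G i x).
    have := is_weak_partial_lin 1 (-1) (L2_testfun (tp k)) Lzu
      (is_weak_partial_testfun i (tp k)) (wzu i).
    rewrite (_ : (fun x => 1 * phi k x + _) = (fun x => phi k x - zeta x * u x)).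
      rewrite (_ : (fun x => 1 * partial i (phi k) x + _) =
        (fun x => partial i (phi k) x - G i x))//.
      by apply/funext => x; rewrite mul1r mulN1r.
    by apply/funext => x; rewrite mul1r mulN1r.
  split; last exact: W.
  split; last by move=> i; eexists; exact: (W i).
  have := L2_lin 1 (-1) (L2_testfun (tp k)) Lzu.
  by under eq_fun do rewrite mul1r mulN1r.
have E k i : sqint D (weak_partial D i (fun x => phi k x - zeta x * u x)) =
    sqint D (fun x => partial i (phi k) x - G i x).
  have [H W] := Hd k.
  have W1 := weak_partialP i H; have W2 := W i.
  have := weak_partial_unique W1 W2 => ae.
  apply: (ge0_ae_eq_integral mD (measurable_sqr W1.1.1) (measurable_sqr W2.1.1)).
  - by move=> x _; rewrite lee_fin sqr_ge0.
  - by move=> x _; rewrite lee_fin sqr_ge0.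
  - by apply: (@filterS _ (almost_everywhere mu) _ _ _ _ ae) => x h Dx; rewrite h.
rewrite /H1norm -[X in _ --> X](@sqrtr0 R).
apply: continuous_cvg; first exact: sqrt_continuous.
have fcv (s : nat -> \bar R) : s @ \oo --> 0%E -> fine (s k) @[k --> \oo] --> (0 : R).
  by move/fine_cvgP => [].
rewrite -[X in _ --> X](addr0 (0 : R)); apply: cvgD.
  exact: (fcv _ c0).
rewrite [X in _ --> X](_ : 0 = \sum_(i < n) (0 : R)); last by rewrite big1_eq.
apply: cvg_big => [|i _]; first exact: add_continuous.
rewrite (_ : (fun k => _) = (fun k => fine (sqint D (fun x => partial i (phi k) x - G i x)))).
  exact: (fcv _ (ci i)).
by apply/funext => k; rewrite -E.
Qed.

End weak_derivatives.

(** * Small sets carry little of a function of bounded energy *)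

Section line_bound.
Context {R : realType}.

(** Integrate the derivative of [g^2] from a point where [g] vanishes, and bound
[2 g g'] by [g^2 / r + r g'^2]. *)
Lemma sqr_le_line_integral (g dg : R -> R) (M r t : R) : 0 < r ->
  (forall s, is_derive s (1 : R) g (dg s)) -> continuous dg ->
  (forall s, M < `|s| -> g s = 0) ->
  ((g t ^+ 2)%:E <= \int[lebesgue_measure]_s (r^-1 * g s ^+ 2 + r * dg s ^+ 2)%:E)%E.
Proof.
move=> r0 gdg cdg g0.
have cg : continuous g.
  by move=> s; apply/differentiable_continuous/derivable1_diffP; case: (gdg s).
pose h s := r^-1 * g s ^+ 2 + r * dg s ^+ 2.
have h0 s : 0 <= h s by rewrite addr_ge0// mulr_ge0 ?invr_ge0 ?sqr_ge0// ltW.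
have [Mt|tM] := ltP M `|t|.
  by rewrite g0// expr0n/=; apply: integral_ge0 => s _; rewrite lee_fin; exact: h0.
pose a := - (`|M| + 1).
have at_ : a < t.
  rewrite /a; have := ler_norm (- t); rewrite normrN => h1.
  have := ler_norm M => h2; lra.
have ga : g a = 0.
  apply: g0; rewrite /a normrN ger0_norm ?addr_ge0//.
  by apply: le_lt_trans (ler_norm M) _; rewrite ltrDl.
pose f s := 2 * (g s * dg s).
have cf : continuous f.
  move=> s; apply: (@cvgMr R _ (nbhs (s : R))).
  exact: (cvgM (cg s) (cdg s)).
have dF s : is_derive s (1 : R) (fun s => g s ^+ 2) (f s).
  have := is_deriveX 2 (gdg s); rewrite exprfctE => H.
  by apply: (is_derive_eq H); rewrite /f expr1 /GRing.scale/= mulrA.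
have cF : continuous (fun s => g s ^+ 2).
  by move=> s; apply/differentiable_continuous/derivable1_diffP; case: (dF s).
have ftc : (\int[lebesgue_measure]_(s in `[a, t]) (f s)%:E = (g t ^+ 2)%:E - (g a ^+ 2)%:E)%E.
  apply: (@continuous_FTC2 R f (fun s => g s ^+ 2) a t at_).
  - exact: continuous_subspaceT.
  - split.
    + by move=> s _; case: (dF s).
    + exact: cvg_at_right_filter (cF a).
    + exact: cvg_at_left_filter (cF t).
  - by move=> s _; rewrite derive1E; case: (dF s).
rewrite ga expr0n/= sube0 in ftc; rewrite -ftc.
have mh : measurable_fun (setT : set (measurableTypeR R)) h.
  apply: continuous_measurable_fun => s.
  by apply: cvgD; apply: (@cvgMr R _ (nbhs (s : R))); [exact: cF|exact: (cvgM (cdg s) (cdg s))].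
have mI : measurable (`[a, t]%classic : set (measurableTypeR R)) by exact: measurable_itv.
have mf : measurable_fun (`[a, t]%classic : set (measurableTypeR R)) f.
  by apply: measurable_funTS; exact: continuous_measurable_fun.
apply: (@le_trans _ _ (\int[lebesgue_measure]_(s in `[a, t]) (h s)%:E)%E); last first.
  have h0' s : setT s -> (0 <= (h s)%:E)%E by rewrite lee_fin.
  apply: (ge0_subset_integral lebesgue_measure mI measurableT _ h0' (@subsetT _ _)).
  exact/measurable_EFinP.
have intf : lebesgue_measure.-integrable `[a, t] (EFin \o f).
  by apply: continuous_compact_integrable; [exact: segment_compact|exact: continuous_subspaceT].
have ch : continuous h.
  move=> s.
  by apply: cvgD; apply: (@cvgMr R _ (nbhs (s : R))); [exact: cF|exact: (cvgM (cdg s) (cdg s))].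
have inth : lebesgue_measure.-integrable `[a, t] (EFin \o h).
  by apply: continuous_compact_integrable; [exact: segment_compact|exact: continuous_subspaceT].
apply: (le_integral mI intf inth) => s _; rewrite lee_fin /f /h.
have := sqr_ge0 (g s - r * dg s) => H.
have : 0 <= r^-1 * (g s - r * dg s) ^+ 2.
  by rewrite mulr_ge0 ?sqr_ge0 ?invr_ge0 ?(ltW r0).
have E : r^-1 * r = 1 by rewrite mulVf// gt_eqF.
rewrite (_ : r^-1 * (g s - r * dg s) ^+ 2 = r^-1 * g s ^+ 2 + (r^-1 * r) * r * dg s ^+ 2
   - 2 * (r^-1 * r) * (g s * dg s)); last by ring.
by rewrite E; lra.
Qed.

End line_bound.

Section slices.
Context {R : realType} {n : nat}.
Local Notation rc := (@rV_cons R n).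

(** Enough regularity for the one-dimensional estimate on lines, and stable under
restriction to the hyperplanes of constant first coordinate ([C1c_slice]). *)
Definition C1c k (phi : 'rV[R]_k -> R) := [/\ continuous phi, bsupp phi,
  (forall i x, derivable phi x (delta_mx 0 i)) & forall i, continuous (partial i phi)].

Lemma rV_cons_linear (h t s : R) (x y : 'rV[R]_n) :
  rc (h * s + t, h *: x + y) = h *: rc (s, x) + rc (t, y).
Proof.
have E (u v : 'rV[R]_n.+1) i : (h *: u + v) 0 i = h * u 0 i + v 0 i by rewrite !mxE.
have E' (u v : 'rV[R]_n) i : (h *: u + v) 0 i = h * u 0 i + v 0 i by rewrite !mxE.
by apply/rowP => i; rewrite E; case: (unliftP ord0 i) => [j ->|->];
  rewrite ?rV_consS ?rV_cons0//= E'.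
Qed.

Lemma rV_cons_delta0 : rc (1, 0) = delta_mx 0 ord0.
Proof.
apply/rowP => i; rewrite [RHS]mxE eqxx /=.
by case: (unliftP ord0 i) => [j ->|->]; rewrite ?rV_consS ?rV_cons0//= mxE.
Qed.

Lemma rV_cons_deltaS j : rc (0, delta_mx 0 j) = delta_mx 0 (lift ord0 j).
Proof.
apply/rowP => i; rewrite [RHS]mxE eqxx /=.
case: (unliftP ord0 i) => [k ->|->]; rewrite ?rV_consS ?rV_cons0//= mxE eqxx/=.
by rewrite (inj_eq (@lift_inj _ _)).
Qed.

Lemma rV_cons_norm (t : R) (y : 'rV[R]_n) : `|t| <= `|rc (t, y)| /\ `|y| <= `|rc (t, y)|.
Proof.
split.
  by have := mx_norm_coord (rc (t, y)) ord0; rewrite rV_cons0.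
apply: mx_norm_le => // i.
by have := mx_norm_coord (rc (t, y)) (lift ord0 i); rewrite rV_consS.
Qed.

Lemma rV_cons_dist (t s : R) (x y : 'rV[R]_n) (e : R) : 0 <= e -> `|t - s| <= e -> `|x - y| <= e ->
  `|rc (t, x) - rc (s, y)| <= e.
Proof.
move=> e0 ts xy; apply: mx_norm_le => // i; rewrite rV_subE.
case: (unliftP ord0 i) => [j ->|->]; rewrite ?rV_consS ?rV_cons0//=.
by rewrite -rV_subE; apply: le_trans xy; exact: mx_norm_coord.
Qed.

Lemma continuous_slice (f : 'rV[R]_n.+1 -> R) (t : R) : continuous f ->
  continuous (fun y => f (rc (t, y))).
Proof.
move=> cf y.
have cr : {for y, continuous (fun y : 'rV[R]_n => rc (t, y))}.
  apply/(@cvgrPdist_le _ _ _ (nbhs (y : 'rV[R]_n))) => e e0.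
  have /(_ _ _ e0) := @cvgr_dist_le _ _ _ (nbhs (y : 'rV[R]_n)) _ id y (@cvg_id _ (nbhs (y : 'rV[R]_n))).
  apply: (@filterS _ (nbhs (y : 'rV[R]_n))) => y' /= hy.
  by apply: rV_cons_dist => //; rewrite ?subrr ?normr0 ltW.
exact: (continuous_comp cr (cf _)).
Qed.

Lemma continuous_fiber (f : 'rV[R]_n.+1 -> R) y : continuous f ->
  continuous (fun s : R => f (rc (s, y))).
Proof.
move=> cf s.
have cr : {for s, continuous (fun s : R => rc (s, y))}.
  apply/(@cvgrPdist_le _ _ _ (nbhs (s : R))) => e e0.
  have /(_ _ _ e0) := @cvgr_dist_le _ _ _ (nbhs (s : R)) _ id s (@cvg_id _ (nbhs (s : R))).
  apply: (@filterS _ (nbhs (s : R))) => s' /= hs.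
  by apply: rV_cons_dist => //; rewrite ?subrr ?normr0 ltW.
exact: (continuous_comp cr (cf _)).
Qed.

Lemma slice_derive (phi : 'rV[R]_n.+1 -> R) (t : R) y j :
  derivable phi (rc (t, y)) (delta_mx 0 (lift ord0 j)) ->
  derivable (fun y => phi (rc (t, y))) y (delta_mx 0 j) /\
  partial j (fun y => phi (rc (t, y))) y = partial (lift ord0 j) phi (rc (t, y)).
Proof.
move=> d.
have E : (fun h : R => h^-1 *: (phi (rc (t, h *: delta_mx 0 j + y)) - phi (rc (t, y)))) =
  (fun h => h^-1 *: (phi (h *: delta_mx 0 (lift ord0 j) + rc (t, y)) - phi (rc (t, y)))).
  apply/funext => h; rewrite -rV_cons_deltaS -rV_cons_linear.
  by rewrite mulr0 add0r.
split; first by rewrite /derivable E.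
by rewrite /partial /derive E.
Qed.

Lemma fiber_derive (phi : 'rV[R]_n.+1 -> R) y :
  (forall x, derivable phi x (delta_mx 0 ord0)) ->
  forall s : R, is_derive s (1 : R) (fun s => phi (rc (s, y))) (partial ord0 phi (rc (s, y))).
Proof.
move=> d s.
have h := is_derive_line (rc (0, y)) d s.
have E u : u *: delta_mx 0 ord0 + rc (0, y) = rc (u, y).
  by rewrite -rV_cons_delta0 -rV_cons_linear mulr1 addr0 scaler0 add0r.
rewrite E in h.
rewrite (_ : (fun s => _) = (fun t => phi (t *: delta_mx 0 ord0 + rc (0, y))))//.
by apply/funext => u; rewrite E.
Qed.

Lemma C1c_slice (phi : 'rV[R]_n.+1 -> R) t : C1c phi -> C1c (fun y => phi (rc (t, y))).
Proof.
move=> [cphi [M hM] dphi cd]; split.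
- exact: continuous_slice.
- exists M => y /hM; apply: le_trans; by case: (rV_cons_norm t y).
- by move=> i x; case: (slice_derive (dphi (lift ord0 i) (rc (t, x)))).
- move=> i; rewrite (_ : partial i _ = (fun y => partial (lift ord0 i) phi (rc (t, y)))).
    exact: continuous_slice.
  by apply/funext => y; case: (slice_derive (dphi (lift ord0 i) (rc (t, y)))).
Qed.

End slices.

Section small_sets.
Context {R : realType}.
Local Notation m n := (@borel_lebesgue R n).

(** The factor [r^2] makes the two terms homogeneous, so that estimates on balls
of radius [r] hold with constants free of [r]. *)
Definition energy n (r : R) (phi : 'rV[R]_n -> R) x : R :=
  phi x ^+ 2 + r ^+ 2 * \sum_(i < n) partial i phi x ^+ 2.

Lemma energy_ge0 n r (phi : 'rV[R]_n -> R) x : 0 <= energy r phi x.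
Proof.
by rewrite addr_ge0 ?sqr_ge0// mulr_ge0 ?sqr_ge0// sumr_ge0// => i _; exact: sqr_ge0.
Qed.

Lemma measurable_fun_slice n (f : 'rV[R]_n.+1 -> \bar R) (t : R) :
  measurable_fun setT f -> measurable_fun setT (fun y => f (rV_cons (t, y))).
Proof.
move=> mf; apply: (measurableT_comp mf).
exact: (measurableT_comp (@measurable_rV_cons R n) (pair1_measurable _)).
Qed.

(** Integrate [sqr_le_line_integral] over the lines orthogonal to the slice. *)
Lemma integral_slice_sqr_le n (r : R) (phi : 'rV[R]_n.+1 -> R) (t : R) :
  0 < r -> C1c phi ->
  (\int[m n]_y (phi (rV_cons (t, y)) ^+ 2)%:E <=
   \int[m n.+1]_x (r^-1 * phi x ^+ 2 + r * partial ord0 phi x ^+ 2)%:E)%E.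
Proof.
move=> r0 [cphi [M hM] dphi cd].
have mphi2 : measurable_fun setT (fun x => (phi x ^+ 2)%:E).
  by apply/measurable_EFinP; apply: measurable_funX; exact: continuous_rV_measurable.
pose k_ (x : 'rV[R]_n.+1) : R := r^-1 * phi x ^+ 2 + r * partial ord0 phi x ^+ 2.
have mk : measurable_fun setT (fun x => (k_ x)%:E).
  apply/measurable_EFinP; apply: measurable_funD; apply: measurable_funM.
  - exact: measurable_cst.
  - by apply: measurable_funX; exact: continuous_rV_measurable.
  - exact: measurable_cst.
  - by apply: measurable_funX; exact: continuous_rV_measurable.
have k0 x : (0 <= (k_ x)%:E)%E.
  by rewrite lee_fin addr_ge0// mulr_ge0 ?sqr_ge0 ?invr_ge0// ltW.
have sq0 y : setT y -> (0 <= (phi (rV_cons (t, y)) ^+ 2)%:E)%E.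
  by rewrite lee_fin sqr_ge0.
pose kc (p : measurableTypeR R * 'rV[R]_n) := (k_ (rV_cons p))%:E.
have mkc : measurable_fun setT kc.
  by apply: (measurableT_comp mk); exact: measurable_rV_cons.
have kc0 p : (0 <= kc p)%E by exact: k0.
rewrite (ge0_integral_borelS mk k0).
rewrite [leRHS](@fubini_tonelli _ _ _ _ _ lebesgue_measure (m n) kc mkc kc0).
have mG : measurable_fun setT (fun y => \int[lebesgue_measure]_s kc (s, y))%E.
  exact: (@measurable_fun_fubini_tonelli_G _ _ _ _ _ lebesgue_measure kc mkc kc0).
apply: (ge0_le_integral (m n) measurableT sq0 (measurable_fun_slice t mphi2) mG) => y _.
apply: (@sqr_le_line_integral R (fun s => phi (rV_cons (s, y)))
  (fun s => partial ord0 phi (rV_cons (s, y))) M r t r0).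
- by move=> s; apply: fiber_derive => x; exact: dphi.
- exact: continuous_fiber.
- move=> s Ms; apply/eqP; apply: contraTT Ms => /hM h; rewrite -leNgt.
  by apply: le_trans h; case: (rV_cons_norm s y).
Qed.

(** Induction on the dimension.  Slices of [E] of measure at most [d' r^n] fall
under the induction hypothesis for [e / 2] and use the derivatives along the
slice.  The parameters of the other slices form a set [T] of length at most
[(e / 2) r], by Fubini and the choice of [d]; each of these slices contributes at
most the integral of [phi^2 / r + r (d_0 phi)^2], so together at most [e / 2]
times the integral of [phi^2 + r^2 (d_0 phi)^2]. *)
Lemma small_set_energy n (e : R) : 0 < e -> exists2 d : R, 0 < d &
  forall (r : R) (phi : 'rV[R]_n -> R) E, 0 < r -> C1c phi -> measurable E ->
    (m n E <= (d * r ^+ n)%:E)%E ->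
    (\int[m n]_(x in E) (phi x ^+ 2)%:E <= e%:E * \int[m n]_x (energy r phi x)%:E)%E.
Proof.
elim: n e => [|n IHn] e e0.
  exists (1 / 2); first by lra.
  move=> r phi E r0 _ mE; rewrite expr0 mulr1 /= diracE => hE.
  have -> : E = set0.
    apply/seteqP; split => // x Ex; move: hE.
    rewrite mem_set; last by rewrite -(thinmx0 x).
    by rewrite lee_fin/=; lra.
  rewrite integral_set0; apply: mule_ge0; first by rewrite lee_fin ltW.
  by apply: integral_ge0 => x _; rewrite lee_fin energy_ge0.
have e20 : 0 < e / 2 by lra.
have [d' d'0 IH] := IHn _ e20.
exists (e / 2 * d'); first by rewrite mulr_gt0.
move=> r phi E r0 C1 mE hE.
have [cphi _ dphi cd] := C1.
have sq0 t y : (0 <= (phi (rV_cons (t, y)) ^+ 2)%:E)%E by rewrite lee_fin sqr_ge0.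
have mphi2 : measurable_fun setT (fun x => (phi x ^+ 2)%:E).
  by apply/measurable_EFinP; apply: measurable_funX; exact: continuous_rV_measurable.
have md2 i : measurable_fun setT (fun x => partial i phi x ^+ 2).
  by apply: measurable_funX; exact: continuous_rV_measurable.
pose Et t : set 'rV[R]_n := [set y | E (rV_cons (t, y))].
have mEt t : measurable (Et t).
  have := measurable_xsection t (measurable_slice mE).
  by rewrite /xsection/=; under eq_set do rewrite inE/=.
have mmE : measurable_fun (setT : set (measurableTypeR R)) (fun t => m n (Et t)).
  have := measurable_fun_xsection (m n) (measurable_slice mE).
  apply: eq_measurable_fun => t _ /=; congr (borel_lebesgue _ _).
  by apply/seteqP; split => y /=; rewrite /xsection/= inE.
pose c := d' * r ^+ n.
have c0 : 0 < c by rewrite mulr_gt0// exprn_gt0.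
pose T : set (measurableTypeR R) := [set t | (c%:E <= m n (Et t))%E].
have mT : measurable T.
  rewrite -[X in measurable X]setTI; apply: emeasurable_fun_c_infty => //.
(* [n_] is the energy along the slices, [k_] the energy across them divided
   by [r]. *)
pose n_ (x : 'rV[R]_n.+1) : R := phi x ^+ 2 + r ^+ 2 * \sum_(j < n) partial (lift ord0 j) phi x ^+ 2.
pose k_ (x : 'rV[R]_n.+1) : R := r^-1 * phi x ^+ 2 + r * partial ord0 phi x ^+ 2.
have mphiR : measurable_fun setT (fun x => phi x ^+ 2) by exact/measurable_EFinP.
have mn : measurable_fun setT (fun x => (n_ x)%:E).
  apply/measurable_EFinP; apply: measurable_funD => //.
  apply: measurable_funM; first exact: measurable_cst.
  by apply: measurable_sum => j; exact: md2.
have mk : measurable_fun setT (fun x => (k_ x)%:E).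
  apply/measurable_EFinP; apply: measurable_funD; apply: measurable_funM => //; exact: measurable_cst.
have n0 x : (0 <= (n_ x)%:E)%E.
  rewrite lee_fin addr_ge0 ?sqr_ge0// mulr_ge0 ?sqr_ge0// sumr_ge0// => i _; exact: sqr_ge0.
have k0 x : (0 <= (k_ x)%:E)%E.
  by rewrite lee_fin addr_ge0// mulr_ge0 ?sqr_ge0 ?invr_ge0// ltW.
pose K := (\int[m n.+1]_x (k_ x)%:E)%E.
have K0 : (0 <= K)%E by apply: integral_ge0 => x _.
have step t : (\int[m n]_(y in Et t) (phi (rV_cons (t, y)) ^+ 2)%:E <=
    (e / 2)%:E * \int[m n]_y (n_ (rV_cons (t, y)))%:E + K * (\1_T t)%:E)%E.
  have [tT|tT] := pselect (T t); last first.
    have hlt : (m n (Et t) <= c%:E)%E by rewrite leNgt; apply/negP => /ltW.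
    rewrite [X in (_ <= _ + K * X%:E)%E]indicE memNset// mule0 adde0.
    have nE y : n_ (rV_cons (t, y)) = energy r (fun y => phi (rV_cons (t, y))) y.
      rewrite /n_ /energy; congr (_ + _); congr (_ * _); apply: eq_bigr => j _.
      by case: (slice_derive (dphi (lift ord0 j) (rV_cons (t, y)))) => _ ->.
    under [X in (_ <= _ * X)%E]eq_integral do rewrite nE.
    exact: (IH r _ _ r0 (C1c_slice t C1) (mEt t) hlt).
  rewrite [X in (_ <= _ + K * X%:E)%E]indicE mem_set// mule1.
  apply: (@le_trans _ _ K); last first.
    by rewrite leeDr// mule_ge0 ?lee_fin ?(ltW e20)// integral_ge0.
  apply: (le_trans (ge0_subset_integral (m n) (mEt t) measurableT
    (measurable_fun_slice t mphi2) (fun y _ => sq0 t y) (@subsetT _ _))).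
  exact: integral_slice_sqr_le.
have lT : (lebesgue_measure T <= (e / 2 * r)%:E)%E.
  have : (c%:E * lebesgue_measure T <= (e / 2 * d' * r ^+ n.+1)%:E)%E.
    apply: le_trans hE; rewrite borel_lebesgueS//.
    have mET : measurable_fun T (fun t => m n (Et t)) by exact: measurable_funTS.
    apply: (@le_trans _ _ (\int[lebesgue_measure]_(t in T) m n (Et t))%E).
      rewrite -integral_cst//.
      have c0' t : T t -> (0 <= c%:E)%E by rewrite lee_fin (ltW c0).
      exact: (ge0_le_integral lebesgue_measure mT c0' (measurable_cst _) mET).
    have m0 t : setT t -> (0 <= m n (Et t))%E by [].
    exact: (ge0_subset_integral lebesgue_measure mT measurableT mmE m0 (@subsetT _ _)).
  have -> : (e / 2 * d' * r ^+ n.+1)%:E = (c%:E * (e / 2 * r)%:E)%E.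
    by rewrite -EFinM /c exprS; congr EFin; ring.
  by rewrite lee_pmul2l// lte_fin.
pose fE (x : 'rV[R]_n.+1) : \bar R := ((fun x => (phi x ^+ 2)%:E) \_ E) x.
have mfE : measurable_fun setT fE.
  by apply/(measurable_restrictT _ mE); exact: measurable_funTS.
have fE0 x : (0 <= fE x)%E by rewrite /fE patchE; case: ifP => // _; rewrite lee_fin sqr_ge0.
rewrite integral_mkcond (ge0_integral_borelS mfE fE0).
have E1 t : (\int[m n]_y fE (rV_cons (t, y)) =
    \int[m n]_(y in Et t) (phi (rV_cons (t, y)) ^+ 2)%:E)%E.
  rewrite [RHS]integral_mkcond; apply: eq_integral => y _.
  rewrite /fE !patchE; have [Ey|nEy] := pselect (E (rV_cons (t, y))).
    by rewrite !mem_set.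
  by rewrite !memNset.
pose nc (p : measurableTypeR R * 'rV[R]_n) := (n_ (rV_cons p))%:E.
have mnc : measurable_fun setT nc.
  by apply: (measurableT_comp mn); exact: measurable_rV_cons.
have nc0 p : (0 <= nc p)%E by exact: n0.
have mN : measurable_fun (setT : set (measurableTypeR R)) (fun t => \int[m n]_y nc (t, y))%E.
  exact: (@measurable_fun_fubini_tonelli_F _ _ _ _ _ (m n) nc mnc nc0).
have N0 t : setT t -> (0 <= \int[m n]_y nc (t, y))%E by move=> _; apply: integral_ge0.
pose fc (p : measurableTypeR R * 'rV[R]_n) := fE (rV_cons p).
have mfc : measurable_fun setT fc.
  by apply: (measurableT_comp mfE); exact: measurable_rV_cons.
have fc0 p : (0 <= fc p)%E by exact: fE0.
have mA : measurable_fun (setT : set (measurableTypeR R)) (fun t => \int[m n]_y fc (t, y))%E.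
  exact: (@measurable_fun_fubini_tonelli_F _ _ _ _ _ (m n) fc mfc fc0).
have A0 t : setT t -> (0 <= \int[m n]_y fc (t, y))%E by move=> _; apply: integral_ge0.
have eN0 t : setT t -> (0 <= (e / 2)%:E * \int[m n]_y nc (t, y))%E.
  by move=> Tt; rewrite mule_ge0 ?lee_fin ?(ltW e20)//; exact: N0.
have meN : measurable_fun (setT : set (measurableTypeR R))
    (fun t => (e / 2)%:E * \int[m n]_y nc (t, y))%E by exact: measurable_funeM.
have KT0 t : setT t -> (0 <= K * (\1_T t)%:E)%E.
  by move=> _; rewrite mule_ge0// lee_fin indicE.
have mI : measurable_fun (setT : set (measurableTypeR R)) (fun t => (\1_T t)%:E : \bar R).
  by apply/measurable_EFinP; exact: measurable_indic.
have I0 t : setT t -> (0 <= (\1_T t)%:E :> \bar R)%E by rewrite lee_fin indicE.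
have mKT : measurable_fun (setT : set (measurableTypeR R)) (fun t => K * (\1_T t)%:E)%E.
  exact: measurable_funeM.
apply: (@le_trans _ _ (\int[lebesgue_measure]_t
    ((e / 2)%:E * \int[m n]_y nc (t, y) + K * (\1_T t)%:E))%E).
  apply: (ge0_le_integral lebesgue_measure measurableT A0 mA).
    exact: (emeasurable_funD meN mKT).
  by move=> t _; rewrite [leLHS]E1; exact: step.
rewrite (ge0_integralD lebesgue_measure measurableT eN0 meN KT0 mKT).
rewrite (ge0_integralZl_EFin lebesgue_measure measurableT N0 mN (ltW e20)).
rewrite (ge0_integralZl lebesgue_measure measurableT mI I0 K0).
rewrite integral_indic// setIT -(ge0_integral_borelS mn n0).
apply: (@le_trans _ _ ((e / 2)%:E * \int[m n.+1]_x (n_ x)%:E + K * (e / 2 * r)%:E)%E).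
  by rewrite leeD2l// lee_wpmul2l.
have er0 : 0 <= e / 2 * r by rewrite mulr_ge0 ?ltW.
rewrite muleC [X in (_ + X <= _)%E]muleC /K.
have n0' x : setT x -> (0 <= (n_ x)%:E)%E by move=> _.
have k0' x : setT x -> (0 <= (k_ x)%:E)%E by move=> _.
rewrite muleC -(ge0_integralZl_EFin (m n.+1) measurableT n0' mn (ltW e20)).
rewrite -(ge0_integralZl_EFin (m n.+1) measurableT k0' mk er0).
have men : measurable_fun setT (fun x => (e / 2)%:E * (n_ x)%:E)%E by exact: measurable_funeM.
have mek : measurable_fun setT (fun x => (e / 2 * r)%:E * (k_ x)%:E)%E by exact: measurable_funeM.
have en0 x : setT x -> (0 <= (e / 2)%:E * (n_ x)%:E)%E.
  by move=> _; rewrite mule_ge0 ?lee_fin ?(ltW e20)// -lee_fin.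
have ek0 x : setT x -> (0 <= (e / 2 * r)%:E * (k_ x)%:E)%E.
  by move=> _; rewrite mule_ge0 ?lee_fin// -lee_fin.
rewrite -(ge0_integralD (m n.+1) measurableT en0 men ek0 mek).
have men' : measurable_fun setT (fun x => (energy r phi x)%:E).
  apply/measurable_EFinP; apply: measurable_funD => //.
  apply: measurable_funM; first exact: measurable_cst.
  by apply: measurable_sum => j; exact: md2.
have en0' x : setT x -> (0 <= (energy r phi x)%:E)%E by rewrite lee_fin energy_ge0.
rewrite -(ge0_integralZl_EFin (m n.+1) measurableT en0' men' (ltW e0)).
have sum0 x : setT x -> (0 <= (e / 2)%:E * (n_ x)%:E + (e / 2 * r)%:E * (k_ x)%:E)%E.
  by move=> Tx; rewrite adde_ge0//; [exact: en0|exact: ek0].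
apply: (ge0_le_integral (m n.+1) measurableT sum0 (emeasurable_funD men mek) (measurable_funeM _ men')).
move=> x _; rewrite -!EFinM -EFinD lee_fin /n_ /k_ /energy big_ord_recl.
set S := \sum_(i < n) _; set p := phi x ^+ 2; set q := partial ord0 phi x ^+ 2.
have S0 : 0 <= S by apply: sumr_ge0 => i _; exact: sqr_ge0.
have p0 : 0 <= p by exact: sqr_ge0.
have q0 : 0 <= q by exact: sqr_ge0.
have E2 : r * r^-1 = 1 by rewrite mulfV// gt_eqF.
rewrite (_ : e / 2 * (p + r ^+ 2 * S) + e / 2 * r * (r^-1 * p + r * q) =
  e / 2 * (p + r ^+ 2 * S) + e / 2 * ((r * r^-1) * p + r ^+ 2 * q)); last by ring.
rewrite E2 mul1r.
have rS : 0 <= r ^+ 2 * S by rewrite mulr_ge0 ?sqr_ge0.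
have rq : 0 <= r ^+ 2 * q by rewrite mulr_ge0 ?sqr_ge0.
rewrite -subr_ge0.
rewrite (_ : _ - _ = e / 2 * (r ^+ 2 * S) + e / 2 * (r ^+ 2 * q)); last by field.
by rewrite addr_ge0// mulr_ge0 ?(ltW e20).
Qed.

End small_sets.

(** * The Caccioppoli inequality *)

Section ae_integrals.
Context d {T : measurableType d} {R : realType} (nu : {measure set T -> \bar R}).

Lemma ae_le_Rintegral (D : set T) (f g : T -> R) : measurable D ->
  nu.-integrable D (EFin \o f) -> nu.-integrable D (EFin \o g) ->
  {ae nu, forall x, D x -> f x <= g x} ->
  \int[nu]_(x in D) f x <= \int[nu]_(x in D) g x.
Proof.
move=> mD intf intg [N [mN N0 fgN]].
have mDN : measurable (D `\` N) by exact: measurableD.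
rewrite /Rintegral (negligible_integral mN mD intf N0) (negligible_integral mN mD intg N0).
apply: le_Rintegral => //.
- exact: (integrableS mD mDN (@subIsetl _ _ _) intf).
- exact: (integrableS mD mDN (@subIsetl _ _ _) intg).
move=> x [Dx nNx]; apply: contrapT => /negP; rewrite -ltNge => gf.
by apply: nNx; apply: fgN => /(_ Dx); rewrite leNgt gf.
Qed.

Lemma ae_eq_Rintegral (D : set T) (f g : T -> R) : measurable D ->
  measurable_fun D f -> measurable_fun D g ->
  {ae nu, forall x, D x -> f x = g x} ->
  \int[nu]_(x in D) f x = \int[nu]_(x in D) g x.
Proof.
move=> mD mf mg fg; congr fine.
apply: ae_eq_integral => //; [exact/measurable_EFinP|exact/measurable_EFinP|].
by apply: (@filterS _ (almost_everywhere nu) _ _ _ _ fg) => x h Dx; rewrite /= h.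
Qed.

End ae_integrals.

Section cutoff.
Context {R : realType} {n : nat}.
Local Notation V := 'rV[R]_n.
Variable r : R.
Hypothesis r0 : 0 < r.

(** The function [exp (- 1 / (1/3 - |x|^2 / r^2))] inside the ball of squared
radius [r^2 / 3]. It is at least [exp (- 12)] on the half ball, where
[|x|^2 / r^2 < 1 / 4]. *)
Definition cutoff : V -> R := flat_bump 0 (1 / 3) (r ^+ 2)^-1.

Let r2 : 0 < r ^+ 2. Proof. exact: exprn_gt0. Qed.

Lemma cutoff_testfun : testfun cutoff.
Proof. by apply: testfun_flat_bump; rewrite invr_gt0. Qed.

Lemma cutoff_ge0 x : 0 <= cutoff x. Proof. exact: flat_ge0. Qed.

Lemma cutoff_le1 x : cutoff x <= 1. Proof. exact: flat0_le1. Qed.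

Let arg_gt0 (x : V) : 0 < 1 / 3 - (r ^+ 2)^-1 * nsq x -> nsq x <= r ^+ 2 / 3.
Proof. by rewrite subr_gt0 => /ltW; rewrite ler_pdivrMl// mul1r. Qed.

Lemma cutoff_supp x : cutoff x != 0 -> nsq x <= r ^+ 2 / 3.
Proof.
rewrite /cutoff /flat_bump /flat; case: ifPn => [/arg_gt0//|_].
by rewrite eqxx.
Qed.

Lemma cutoff_lower x : nsq x < (r / 2) ^+ 2 -> flat 0 (1 / 12) <= cutoff x.
Proof.
move=> h; apply: flat0_le.
have : (r ^+ 2)^-1 * nsq x <= 1 / 4.
  rewrite ler_pdivrMl//; apply: le_trans (ltW h) _.
  by rewrite !expr2; lra.
lra.
Qed.

Lemma cutoff_partial i x : `|partial i cutoff x| <= 4 / r.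
Proof.
have [_] := is_derive_flat_bump 0 (1 / 3) (r ^+ 2)^-1 x i.
rewrite /partial /cutoff => ->.
rewrite mul0r sub0r mulNr normrN /flat_bump.
have b0 : 0 <= 4 / r by rewrite divr_ge0 ?(ltW r0).
have nq : 0 <= (r ^+ 2)^-1 * nsq x by rewrite mulr_ge0 ?nsq_ge0 ?invr_ge0 ?(ltW r2).
have [h|h] := ltP 0 (1 / 3 - (r ^+ 2)^-1 * nsq x); last first.
  by rewrite /flat ltNge h/= mul0r normr0.
have xi : `|x 0 i| <= r.
  apply: le_trans (mx_norm_coord x i) _; apply: mx_norm_nsq; first exact: ltW.
  by apply: le_trans (arg_gt0 h) _; rewrite ler_pdivrMr// ler_pMr//; lra.
have f2 : `|flat 2 (1 / 3 - (r ^+ 2)^-1 * nsq x)| <= 2.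
  apply: le_trans (flat_le _ _) _; rewrite (ger0_norm (ltW h)).
  rewrite (_ : (3`!)%:R = 6 :> R)//.
  lra.
rewrite normrM; apply: (@le_trans _ _ (2 * (2 * (r ^+ 2)^-1 * r))).
  apply: ler_pM => //; rewrite normrM; apply: ler_pM => //.
  by rewrite ger0_norm// mulr_ge0// invr_ge0 ltW.
rewrite (_ : 2 * (2 * (r ^+ 2)^-1 * r) = 4 / r)//.
by rewrite expr2 invfM; field; rewrite gt_eqF.
Qed.

End cutoff.

Section pointwise_ellipticity.
Context {R : realType}.

(** Young's inequality, from the square of [s |p| - b]. *)
Lemma young_lower (s p y b : R) : 0 < s -> `|y| <= b ->
  - (s * p ^+ 2 + b ^+ 2 / s) <= 2 * (p * y).
Proof.
move=> s0 yb.
have h1 : - (`|p| * b) <= p * y.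
  rewrite lerNl; apply: le_trans (ler_norm _) _.
  by rewrite normrN normrM ler_wpM2l.
have : 0 <= (s * `|p| - b) ^+ 2 / s by rewrite divr_ge0 ?sqr_ge0 ?(ltW s0).
rewrite (_ : _ / s = s * `|p| ^+ 2 + b ^+ 2 / s - 2 * (`|p| * b)); last first.
  by field; rewrite gt_eqF.
by rewrite real_normK ?num_real//; lra.
Qed.

(** The pointwise integrand of the Caccioppoli inequality.  Here [t], [g], [q],
[s] stand for the values at a point of the cutoff, the gradient of the
subsolution, the gradient of the cutoff and the subsolution.  Ellipticity bounds
the main term below, and the mixed terms are absorbed by Young's inequality with
weight [lam / (2 n)], so that their sum over [n^2] pairs of indices costs half of
the main term. *)
Lemma elliptic_lower n (lam Lam K s t : R) (a : 'M[R]_n) (g q : 'I_n -> R) :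
  (0 < n)%N -> 0 < lam -> 0 <= Lam ->
  (forall xi : 'rV[R]_n, lam * enorm xi ^+ 2 <=
     \sum_(i < n) \sum_(j < n) a i j * xi 0 i * xi 0 j) ->
  (forall i j, `|a i j| <= Lam) -> (forall j, `|q j| <= K) ->
  lam / 2 * (\sum_(i < n) (t * g i) ^+ 2) -
    2 * n%:R ^+ 3 * (Lam * K) ^+ 2 / lam * s ^+ 2 <=
  \sum_(i < n) \sum_(j < n) a i j * g i * (t ^+ 2 * g j + 2 * t * q j * s).
Proof.
move=> n0 lam0 Lam0 ell aL qK.
have nR : 0 < n%:R :> R by rewrite ltr0n.
pose b := Lam * K * `|s|.
pose sg := lam / (2 * n%:R).
have sg0 : 0 < sg by rewrite divr_gt0// mulr_gt0.
have E : \sum_(i < n) \sum_(j < n) a i j * g i * (t ^+ 2 * g j + 2 * t * q j * s) =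
   \sum_(i < n) \sum_(j < n) a i j * (t * g i) * (t * g j) +
   \sum_(i < n) \sum_(j < n) 2 * (t * g i * (a i j * q j * s)).
  rewrite -big_split/=; apply: eq_bigr => i _; rewrite -big_split/=.
  by apply: eq_bigr => j _; ring.
have h1 : lam * (\sum_(i < n) (t * g i) ^+ 2) <=
    \sum_(i < n) \sum_(j < n) a i j * (t * g i) * (t * g j).
  have := ell (\row_i (t * g i)).
  rewrite /enorm sqr_sqrtr; last by apply: sumr_ge0 => i _; exact: sqr_ge0.
  under eq_bigr do rewrite mxE.
  by under [X in _ <= X -> _]eq_bigr do under eq_bigr do rewrite !mxE.
have h2 : \sum_(i < n) \sum_(j < n) - (sg * (t * g i) ^+ 2 + b ^+ 2 / sg) <=
    \sum_(i < n) \sum_(j < n) 2 * (t * g i * (a i j * q j * s)).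
  apply: ler_sum => i _; apply: ler_sum => j _; apply: young_lower => //.
  by rewrite !normrM /b ler_wpM2r// ler_pM.
have h3 : \sum_(i < n) \sum_(j < n) - (sg * (t * g i) ^+ 2 + b ^+ 2 / sg) =
    - (lam / 2 * (\sum_(i < n) (t * g i) ^+ 2)) -
    2 * n%:R ^+ 3 * (Lam * K) ^+ 2 / lam * s ^+ 2.
  under eq_bigr do rewrite sumr_const card_ord -mulr_natl mulrN mulrDr.
  rewrite sumrN big_split/= sumr_const card_ord -[_ *+ n]mulr_natl opprD.
  congr (_ - _).
    rewrite mulr_sumr; congr (- _); apply: eq_bigr => i _.
    by rewrite /sg; field; rewrite gt_eqF.
  rewrite /b /sg exprMn real_normK ?num_real//.
  by field; rewrite !gt_eqF.
by rewrite E; move: h1 h2; rewrite h3; lra.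
Qed.

End pointwise_ellipticity.

Section caccioppoli.
Context {R : realType} {n : nat}.
Local Notation V := 'rV[R]_n.
Local Notation mu := (lebesgue R n).
Implicit Types (f g h u v : V -> R) (x : V) (k : nat).
Hypothesis n0 : (0 < n)%N.
Variables (lam Lam r : R).
Hypotheses (lam0 : 0 < lam) (lamLam : lam <= Lam) (r0 : 0 < r).

Let D : set (Rn R n) := @eball R n r.

Let mD : measurable D.
Proof. by apply: borel_Rn_measurable; exact: measurable_eball. Qed.

Let Lam0 : 0 < Lam. Proof. exact: lt_le_trans lamLam. Qed.

Let eta : V -> R := cutoff r.

Let teta : testfun eta. Proof. exact: cutoff_testfun. Qed.

Let eta1 x : `|eta x| <= 1.
Proof. by rewrite ger0_norm ?cutoff_le1 ?cutoff_ge0. Qed.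

Let sqI f : L2 D f -> sqint D f = (\int[mu]_(x in D) f x ^+ 2)%:E.
Proof.
move=> [mf ff]; rewrite /Rintegral fineK//.
exact: integrable_fin_num (sqr_integrable mD mf ff).
Qed.

(** The constant of [elliptic_lower] for the gradient bound [4 / r] of the cutoff,
up to the factor [r^-2]. *)
Definition energy_const : R := 2 * n%:R ^+ 3 * (Lam * 4) ^+ 2 / lam.

(** Test the subsolution inequality with [eta^2 u] and integrate the pointwise
bound [elliptic_lower]. *)
Lemma caccioppoli (a : V -> 'M[R]_n) u :
  uniformly_elliptic (@eball R n r) lam Lam a -> subsolution (@eball R n r) a u ->
  nonneg_on (@eball R n r) u ->
  \sum_(i < n) \int[mu]_(x in D) (eta x * weak_partial D i u x) ^+ 2 <=
  2 * energy_const / lam / r ^+ 2 * \int[mu]_(x in D) u x ^+ 2.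
Proof.
move=> [ma ella] [Hu subu] nnu; have [Lu _] := Hu.
have wu i := weak_partialP i Hu.
pose G i := weak_partial D i u.
have LG i : L2 D (G i) := (wu i).1.
pose zeta x := eta x * eta x.
have tz : testfun zeta := testfunM teta.1 teta.
have zsupp x : zeta x != 0 -> nsq x <= r ^+ 2 / 3.
  by rewrite mulf_eq0 negb_or => /andP[/cutoff_supp] h _; exact: h.
pose v x := zeta x * u x.
have Hv : H10 (@eball R n r) v by exact: cutoff_H10.
have nnv : nonneg_on (@eball R n r) v.
  apply: (@filterS _ (almost_everywhere mu) _ _ _ _ nnu) => x h Dx.
  by rewrite mulr_ge0// ?h// mulr_ge0// cutoff_ge0.
have {subu} sub := subu _ Hv nnv.
have wv j := weak_partialP j Hv.1.
pose W j := weak_partial D j v.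
have LW j : L2 D (W j) := (wv j).1.
have WE : {ae mu, forall x, forall j, D x ->
    W j x = eta x ^+ 2 * G j x + 2 * eta x * partial j eta x * u x}.
  have Wj j : {ae mu, forall x, D x ->
      W j x = eta x ^+ 2 * G j x + 2 * eta x * partial j eta x * u x}.
    have ae := weak_partial_unique n0 r0 (wv j) (is_weak_partialM r0 Lu (wu j) tz).
    apply: (@filterS _ (almost_everywhere mu) _ _ _ _ ae) => x h Dx.
    rewrite /W h// /zeta partialM.
    + by rewrite /G; ring.
    + by move=> y; exact: smooth_derivable teta.1.
    + by move=> y; exact: smooth_derivable teta.1.
  exact: filter_forall.
(* The bound on the coefficients holds almost everywhere only; truncating them
   makes every integrand below integrable without changing the integrals. *)
pose a' (x : V) (i j : 'I_n) : R := Num.max (- Lam) (Num.min Lam (a x i j)).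
have ma' i j : measurable_fun D (fun x => a' x i j).
  apply: measurable_maxr; first exact: measurable_cst.
  by apply: measurable_minr; [exact: measurable_cst|exact: ma].
have a'L x i j : `|a' x i j| <= Lam.
  rewrite ler_norml /a' le_max lexx/= ge_max ge_min lexx/= andbT.
  by rewrite (le_trans _ (ltW Lam0))// oppr_le0 ltW.
have a'E x i j : `|a x i j| <= Lam -> a' x i j = a x i j.
  by rewrite ler_norml => /andP[h1 h2]; rewrite /a' min_r// max_r.
pose E0 (x : V) : R := \sum_(i < n) \sum_(j < n) a x i j * G i x * W j x.
pose E1 (x : V) : R := \sum_(i < n) \sum_(j < n) a' x i j * G i x * W j x.
have mE0 : measurable_fun D E0.
  apply: measurable_sum => i; apply: measurable_sum => j.
  exact: (measurable_funM (measurable_funM (ma i j) (LG i).1) (LW j).1).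
have mE1 : measurable_fun D E1.
  apply: measurable_sum => i; apply: measurable_sum => j.
  exact: (measurable_funM (measurable_funM (ma' i j) (LG i).1) (LW j).1).
have intE1 : mu.-integrable D (EFin \o E1).
  rewrite (_ : EFin \o E1 = (fun x =>
    \sum_(i < n) \sum_(j < n) (a' x i j * G i x * W j x)%:E)%E); last first.
    by apply/funext => x; rewrite /= -sumEFin; apply: eq_bigr => i _; rewrite -sumEFin.
  apply: (integrable_sum mD) => i _; apply: (integrable_sum mD) => j _.
  have h := integrable_mulM mD (L2_mul_integrable r0 (LG i) (LW j)) (ma' i j) (ltW Lam0)
    (fun x _ => a'L x i j).
  rewrite (_ : (fun x => _) = EFin \o (fun x => G i x * W j x * a' x i j)); first exact: h.
  by apply/funext => x /=; congr EFin; rewrite [RHS]mulrC mulrA.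
have aL : {ae mu, forall x, D x -> forall i j, `|a x i j| <= Lam}.
  case: ella => N [mN N0 sub0]; exists N; split; [exact: mN|exact: N0|].
  move=> x nx; apply: sub0 => /= h; apply: nx => /= Dx; exact: (h Dx).2.
have E01ae : {ae mu, forall x, D x -> E0 x = E1 x}.
  case: aL => N [mN N0 sub0]; exists N; split; [exact: mN|exact: N0|].
  move=> x nx; apply: sub0 => /= h; apply: nx => /= Dx.
  by apply: eq_bigr => i _; apply: eq_bigr => j _; rewrite a'E//; exact: h.
have E01 : \int[mu]_(x in D) E0 x = \int[mu]_(x in D) E1 x.
  exact: (ae_eq_Rintegral mD mE0 mE1 E01ae).
pose C := energy_const / r ^+ 2.
have CE : C = 2 * n%:R ^+ 3 * (Lam * (4 / r)) ^+ 2 / lam.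
  by rewrite /C /energy_const; field; rewrite !gt_eqF.
have LtG i : L2 D (fun x => eta x * G i x).
  exact: (L2_bounded_mul r0 (testfun_measurableD (r:=r) teta) eta1 (LG i)).
have sqint_int f : L2 D f -> mu.-integrable D (EFin \o (fun x => f x ^+ 2)).
  by move=> [mf ff]; exact: sqr_integrable.
pose L (x : V) : R := lam / 2 * (\sum_(i < n) (eta x * G i x) ^+ 2) - C * u x ^+ 2.
have intS : mu.-integrable D (EFin \o (fun x => \sum_(i < n) (eta x * G i x) ^+ 2)).
  rewrite (_ : EFin \o _ = (fun x => \sum_(i < n) ((eta x * G i x) ^+ 2)%:E)%E); last first.
    by apply/funext => x; rewrite /= -sumEFin.
  by apply: (integrable_sum mD) => i _; exact: (sqint_int _ (LtG i)).
have intu := sqint_int _ Lu.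
have intL : mu.-integrable D (EFin \o L).
  exact: (integrableB mD (integrableZl mD (lam / 2) intS) (integrableZl mD C intu)).
have LE1 : {ae mu, forall x, D x -> L x <= E1 x}.
  apply: (@filterS2 _ (almost_everywhere mu) _ _ _ _ _ ella WE) => x h hW Dx.
  have [ell aLx] := h Dx.
  rewrite /L CE /E1.
  under [leRHS]eq_bigr do under eq_bigr do rewrite a'E// hW//.
  apply: elliptic_lower => //; first exact: ltW.
    by move=> xi; case/andP: (ell xi).
  by move=> j; exact: cutoff_partial.
have := ae_le_Rintegral mD intL intE1 LE1.
rewrite -E01 => /le_trans/(_ sub).
rewrite /L (RintegralB mD (integrableZl mD (lam / 2) intS) (integrableZl mD C intu)).
rewrite (RintegralZl _ mD intS) (RintegralZl _ mD intu).
have -> : \int[mu]_(x in D) (\sum_(i < n) (eta x * G i x) ^+ 2) =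
    \sum_(i < n) \int[mu]_(x in D) (eta x * G i x) ^+ 2.
  rewrite /Rintegral sum_fine; last first.
    by move=> i _; exact: (integrable_fin_num mD (sqint_int _ (LtG i))).
  congr fine; rewrite -(integral_sum mD (fun i => sqint_int _ (LtG i))).
  by apply: eq_integral => x _; rewrite /= sumEFin.
rewrite subr_le0 => H.
rewrite (_ : 2 * energy_const / lam / r ^+ 2 = (lam / 2)^-1 * C); last first.
  by rewrite /C; field; rewrite !gt_eqF.
by rewrite -mulrA ler_pdivlMl// divr_gt0.
Qed.

(** The terms come from [(eta u)^2 <= u^2], from [caccioppoli] after
[(a + b)^2 <= 2 a^2 + 2 b^2], and from [n] gradient components of the cutoff, each
with square at most [16 / r^2]. *)
Definition total_const : R := 1 + 4 * energy_const / lam + 32 * n%:R.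

Lemma cutoff_energy (a : V -> 'M[R]_n) u :
  uniformly_elliptic (@eball R n r) lam Lam a -> subsolution (@eball R n r) a u ->
  nonneg_on (@eball R n r) u ->
  (sqint D (fun x => (eta x * u x)%R) + (r ^+ 2)%:E * \sum_(i < n) sqint D
     (fun x => (eta x * weak_partial D i u x + partial i eta x * u x)%R) <=
   total_const%:E * sqint D u)%E.
Proof.
move=> ella subu nnu; have Hu := subu.1; have [Lu _] := Hu.
have wu i := weak_partialP i Hu.
have LtG i : L2 D (fun x => eta x * weak_partial D i u x).
  exact: (L2_bounded_mul r0 (testfun_measurableD (r:=r) teta) eta1 (wu i).1).
have Ldu i : L2 D (fun x => partial i eta x * u x).
  apply: (L2_bounded_mul r0 _ _ Lu); last exact: cutoff_partial.
  exact: (testfun_measurableD (r:=r) (testfun_partial i teta)).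
have Ltu : L2 D (fun x => eta x * u x).
  exact: (L2_bounded_mul r0 (testfun_measurableD (r:=r) teta) eta1 Lu).
have LDG i : L2 D (fun x => eta x * weak_partial D i u x + partial i eta x * u x).
  have := L2_lin r0 1 1 (LtG i) (Ldu i).
  by under eq_fun do rewrite !mul1r.
rewrite (sqI Ltu) (sqI Lu); under eq_bigr do rewrite (sqI (LDG _)).
rewrite sumEFin -!EFinM -EFinD lee_fin.
set I := \int[mu]_(x in D) u x ^+ 2.
have I0 : 0 <= I by apply: Rintegral_ge0 => x _; exact: sqr_ge0.
have b0 : \int[mu]_(x in D) (eta x * u x) ^+ 2 <= I.
  rewrite -lee_fin -(sqI Ltu) -(sqI Lu); apply: (le_sqint mD Ltu.1 Lu.1) => x _.
  by rewrite normrM ler_piMl.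
have bi i : \int[mu]_(x in D) (eta x * weak_partial D i u x + partial i eta x * u x) ^+ 2 <=
    2 * \int[mu]_(x in D) (eta x * weak_partial D i u x) ^+ 2 + 32 / r ^+ 2 * I.
  rewrite -lee_fin EFinD !EFinM -(sqI (LDG i)) -(sqI (LtG i)) -(sqI Lu).
  have p0 : 0 <= 32 / r ^+ 2 by rewrite divr_ge0 ?sqr_ge0.
  apply: (sqint_lin mD (LtG i).1 Lu.1 (LDG i).1 _ p0) => // x _.
  have hq : (partial i eta x) ^+ 2 <= (4 / r) ^+ 2.
    rewrite -real_normK ?num_real// ler_pXn2r ?nnegrE ?cutoff_partial//.
    by rewrite divr_ge0 ?(ltW r0).
  have hq' : (partial i eta x) ^+ 2 * u x ^+ 2 <= 16 / r ^+ 2 * u x ^+ 2.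
    rewrite ler_wpM2r ?sqr_ge0//; apply: le_trans hq _.
    by rewrite expr_div_n -natrX.
  rewrite -exprMn in hq'.
  rewrite (_ : 32 / r ^+ 2 * u x ^+ 2 = 2 * (16 / r ^+ 2 * u x ^+ 2)); last by ring.
  have := sqr_ge0 (eta x * weak_partial D i u x - partial i eta x * u x).
  move: hq'; set c := 16 / _ * _; rewrite !expr2; lra.
have cac := caccioppoli ella subu nnu; rewrite -/I in cac.
set S := \sum_(i < n) _ in cac.
have : \sum_(i < n) \int[mu]_(x in D) (eta x * weak_partial D i u x + partial i eta x * u x) ^+ 2
   <= 2 * S + n%:R * (32 / r ^+ 2 * I).
  apply: le_trans (ler_sum _ (fun i _ => bi i)) _.
  by rewrite big_split/= -mulr_sumr sumr_const card_ord -[_ *+ n]mulr_natl.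
move=> hS.
have r2 : 0 < r ^+ 2 by exact: exprn_gt0.
have := ler_wpM2l (ltW r2) hS.
have := ler_wpM2l (ltW r2) cac.
have -> : r ^+ 2 * (2 * energy_const / lam / r ^+ 2 * I) = 2 * energy_const / lam * I.
  by field; rewrite !gt_eqF.
rewrite mulrDr [r ^+ 2 * (2 * S)]mulrCA.
have -> : r ^+ 2 * (n%:R * (32 / r ^+ 2 * I)) = 32 * n%:R * I.
  by field; rewrite gt_eqF.
have -> : total_const * I = I + 2 * (2 * energy_const / lam * I) + 32 * n%:R * I.
  by rewrite /total_const; ring.
lra.
Qed.

End caccioppoli.

(** * Decay of the level truncation *)

Section energy_of_test_functions.
Context {R : realType} {n : nat}.
Local Notation V := 'rV[R]_n.
Local Notation mu := (lebesgue R n).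
Local Notation m := (@borel_lebesgue R n).
Implicit Types (f g h u v : V -> R) (x : V) (k : nat).
Variables (r : R).
Hypotheses (r0 : 0 < r).

Let D : set (Rn R n) := @eball R n r.

Let mD : measurable D.
Proof. by apply: borel_Rn_measurable; exact: measurable_eball. Qed.

Lemma C1c_testfun f : testfun f -> C1c f.
Proof.
move=> [sf bf]; split; [exact: smooth_continuous|exact: bf| |].
- by move=> i x; exact: smooth_derivable.
- by move=> i; apply: smooth_continuous; exact: smooth_partial.
Qed.

Let measurable_smooth f : smooth f -> measurable_fun (setT : set V) f.
Proof. by move=> sf; exact: continuous_rV_measurable (smooth_continuous sf). Qed.

Lemma integral_energy phi : test_function (@eball R n r) phi ->
  (\int[m]_x (energy r phi x)%:E =
   sqint D phi + (r ^+ 2)%:E * \sum_(i < n) sqint D (partial i phi))%E.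
Proof.
move=> /test_functionP[tphi phiD dphiD].
have [sphi _] := tphi.
have me : measurable_fun (setT : set V) (fun x => (energy r phi x)%:E).
  apply/measurable_EFinP; apply: measurable_funD.
    by apply: measurable_funX; exact: measurable_smooth.
  apply: measurable_funM; first exact: measurable_cst.
  apply: measurable_sum => i; apply: measurable_funX; apply: measurable_smooth.
  exact: smooth_partial.
have e0 x : (0 <= (energy r phi x)%:E)%E by rewrite lee_fin energy_ge0.
rewrite -(ge0_integral_lebesgueE measurableT me e0).
have -> : (\int[mu]_x (energy r phi x)%:E = \int[mu]_(x in D) (energy r phi x)%:E)%E.
  rewrite [RHS]integral_mkcond; congr (integral _ _ _); apply/funext => x.
  rewrite patchE; case: ifPn => //; rewrite notin_setE => nDx.
  rewrite /energy (_ : phi x = 0); last by apply: contrapT => /eqP/phiD.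
  rewrite big1; first by rewrite expr0n/= mulr0 addr0.
  move=> i _; rewrite (_ : partial i phi x = 0) ?expr0n//.
  by apply: contrapT => /eqP/dphiD.
have mdphi i : measurable_fun D (partial i phi).
  by apply: testfun_measurableD; exact: testfun_partial.
have sq0 f x : D x -> (0 <= (f x ^+ 2)%:E)%E by move=> _; rewrite lee_fin sqr_ge0.
have ms : measurable_fun D (fun x => \sum_(i < n) (partial i phi x ^+ 2)%:E)%E.
  by apply: emeasurable_sum => i; exact: measurable_sqr.
have s0 x : D x -> (0 <= \sum_(i < n) (partial i phi x ^+ 2)%:E)%E.
  by move=> Dx; apply: sume_ge0 => i _; exact: sq0.
have mrs : measurable_fun D (fun x => (r ^+ 2)%:E * \sum_(i < n) (partial i phi x ^+ 2)%:E)%E.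
  exact: measurable_funeM.
have rs0 x : D x -> (0 <= (r ^+ 2)%:E * \sum_(i < n) (partial i phi x ^+ 2)%:E)%E.
  by move=> Dx; rewrite mule_ge0 ?lee_fin ?sqr_ge0//; exact: s0.
rewrite (_ : (fun x => (energy r phi x)%:E) = (fun x => (phi x ^+ 2)%:E +
    (r ^+ 2)%:E * \sum_(i < n) (partial i phi x ^+ 2)%:E)%E); last first.
  by apply/funext => x; rewrite sumEFin -EFinM -EFinD.
rewrite (ge0_integralD mu mD (sq0 phi) (measurable_sqr (testfun_measurableD tphi)) rs0 mrs).
rewrite (ge0_integralZl_EFin mu mD s0 ms (sqr_ge0 r)).
congr (_ + _ * _)%E.
exact: (ge0_integral_sum mu mD (fun i => measurable_sqr (mdphi i)) (fun i => sq0 (partial i phi))).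
Qed.

End energy_of_test_functions.

Section small_sets_see_little.
Context {R : realType} {n : nat}.
Local Notation V := 'rV[R]_n.
Local Notation mu := (lebesgue R n).
Local Notation m := (@borel_lebesgue R n).
Implicit Types (f g h u v : V -> R) (x : V) (k : nat).
Hypothesis n0 : (0 < n)%N.
Variables (lam Lam r : R).
Hypotheses (lam0 : 0 < lam) (lamLam : lam <= Lam) (r0 : 0 < r).

Let D : set (Rn R n) := @eball R n r.

Let mD : measurable D.
Proof. by apply: borel_Rn_measurable; exact: measurable_eball. Qed.

Local Notation eta := (@cutoff R n r).

Let Q f : R := fine (sqint D f).

Let QE f : L2 D f -> sqint D f = (Q f)%:E.
Proof.
move=> [mf ff]; rewrite /Q fineK//; apply/fin_numPlt.
by rewrite ff andbT (lt_le_trans _ (sqint_ge0 _ _))// ltNy0.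
Qed.

(** Cover [U] by a Borel set of measure at most [d r^n], apply the small-set
estimate to test functions approximating [eta u], and pass to the limit using
the energy bound. *)
Lemma cutoff_small_set (a : V -> 'M[R]_n) u (e d : R) (U : set (Rn R n)) :
  uniformly_elliptic (@eball R n r) lam Lam a -> subsolution (@eball R n r) a u ->
  nonneg_on (@eball R n r) u -> 0 < e -> 0 < d ->
  (forall phi (E : set V), C1c phi -> measurable E -> (m E <= (d * r ^+ n)%:E)%E ->
    (\int[m]_(x in E) (phi x ^+ 2)%:E <= e%:E * \int[m]_x (energy r phi x)%:E)%E) ->
  measurable U -> U `<=` D -> (mu U <= (d / 2 * r ^+ n)%:E)%E ->
  (sqint U (fun x => eta x * u x)%R <= (4 * e * @total_const R n lam Lam)%:E * sqint D u)%E.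
Proof.
move=> ella subu nnu e0 d0 small mU UD muU.
have Hu := subu.1; have [Lu _] := Hu.
have wu i := weak_partialP i Hu.
pose w (x : V) : R := eta x * u x.
pose G i (x : V) : R := eta x * weak_partial D i u x + partial i eta x * u x.
have teta : testfun eta := cutoff_testfun r0.
have eta1 x : `|eta x| <= 1 by rewrite ger0_norm ?cutoff_le1 ?cutoff_ge0.
have Lw : L2 D w.
  exact: (L2_bounded_mul r0 (testfun_measurableD (r:=r) teta) eta1 Lu).
have LG i : L2 D (G i) := (is_weak_partialM r0 Lu (wu i) teta).1.
have dr0 : 0 < d / 2 * r ^+ n by rewrite mulr_gt0 ?divr_gt0 ?exprn_gt0.
have [B [mB UB mBle]] := lebesgue_outer_approx dr0 (le_lt_trans muU (ltry _)).
have {}mBle : (m B <= (d * r ^+ n)%:E)%E.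
  apply: le_trans mBle _; apply: le_trans (leeD2r _ muU) _.
  by rewrite -EFinD lee_fin -mulrDl -splitr.
have approx (t : R) : 0 < t -> exists phi, [/\ test_function (@eball R n r) phi,
    (sqint D (fun x => phi x - w x)%R <= t%:E)%E &
    forall i, (sqint D (fun x => partial i phi x - G i x)%R <= t%:E)%E].
  move=> t0; have [phi [tphi cphi cdphi]] :=
    cutoff_approx n0 r0 Lu wu teta (@cutoff_supp R n r r0).
  have n1 : \forall k \near \oo, (sqint D (fun x => phi k x - w x)%R <= t%:E)%E.
    by move/(ecvg0P (fun=> sqint_ge0 _ _)) : cphi => /(_ _ t0).
  have n2 : \forall k \near \oo, forall i,
      (sqint D (fun x => partial i (phi k) x - G i x)%R <= t%:E)%E.
    apply: filter_forall => i.
    by move/(ecvg0P (fun=> sqint_ge0 _ _)) : (cdphi i) => /(_ _ t0).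
  near \oo => k; exists (phi k); split; first exact: tphi.
  - by near: k.
  - by near: k.
rewrite (QE Lu).
set I := Q u; set C := @total_const R n lam Lam.
have en : Q w + r ^+ 2 * \sum_(i < n) Q (G i) <= C * I.
  have := cutoff_energy n0 lam0 lamLam r0 ella subu nnu.
  under eq_bigr do rewrite (QE (LG _)).
  by rewrite (QE Lw) (QE Lu) sumEFin -!EFinM -EFinD lee_fin.
(* [K t] collects all errors made when [phi] and its gradient are within [t] of
   [eta u] and its gradient in squared norm. *)
pose K : R := 2 + 4 * e * (1 + r ^+ 2 * n%:R).
have K0 : 0 < K.
  rewrite /K ltr_pwDl// mulr_ge0// ?mulr_ge0 ?(ltW e0)//.
  by rewrite addr_ge0// mulr_ge0 ?sqr_ge0.
apply/lee_addgt0Pr => s s0; pose t := s / K.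
have t0 : 0 < t by exact: divr_gt0.
have [phi [tphi aphi adphi]] := approx _ t0.
have [tf phiD dphiD] := test_functionP tphi.
have Lphi : L2 D phi := L2_testfun r0 tf.
have Ldphi i : L2 D (partial i phi) := L2_testfun r0 (testfun_partial i tf).
have Ldiff f g : L2 D f -> L2 D g -> L2 D (fun x => f x - g x).
  move=> Lf Lg; have := L2_lin r0 1 (-1) Lf Lg.
  by under eq_fun do rewrite mul1r mulN1r.
have two f g : L2 D f -> L2 D g -> Q f <= 2 * Q g + 2 * Q (fun x => f x - g x).
  move=> Lf Lg; have Lfg := Ldiff _ _ Lf Lg.
  rewrite -lee_fin EFinD !EFinM -(QE Lf) -(QE Lg) -(QE Lfg).
  apply: (sqint_lin mD Lg.1 Lfg.1 Lf.1 (ler0n R 2) (ler0n R 2)) => x _.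
  by have := sqr_ge0 (g x - (f x - g x)); rewrite !expr2; lra.
have q1 : Q phi <= 2 * Q w + 2 * t.
  apply: le_trans (two _ _ Lphi Lw) _; rewrite lerD2l ler_wpM2l//.
  by rewrite -lee_fin -(QE (Ldiff _ _ Lphi Lw)).
have q2 i : Q (partial i phi) <= 2 * Q (G i) + 2 * t.
  apply: le_trans (two _ _ (Ldphi i) (LG i)) _; rewrite lerD2l ler_wpM2l//.
  by rewrite -lee_fin -(QE (Ldiff _ _ (Ldphi i) (LG i))).
have UphiE : (sqint U phi <= (e * (2 * (C * I) + 2 * t * (1 + r ^+ 2 * n%:R)))%:E)%E.
  have sq0 x : (0 <= (phi x ^+ 2)%:E)%E by rewrite lee_fin sqr_ge0.
  have mphi : measurable_fun (B : set V) (fun x => (phi x ^+ 2)%:E).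
    apply/measurable_EFinP; apply: measurable_funX; apply: measurable_funTS.
    exact: continuous_rV_measurable (smooth_continuous tf.1).
  have mphi' : measurable_fun (B : set (Rn R n)) (fun x => (phi x ^+ 2)%:E).
    apply: measurable_sqr; apply: measurable_funTS; exact: (smooth_measurable tf.1).
  apply: (@le_trans _ _ (\int[mu]_(x in B) (phi x ^+ 2)%:E)%E).
    exact: (ge0_subset_integral mu mU (borel_Rn_measurable mB) mphi' (fun x _ => sq0 x) UB).
  rewrite (ge0_integral_lebesgueE mB mphi sq0).
  apply: le_trans (small _ _ (C1c_testfun tf) mB mBle) _.
  rewrite (integral_energy r0 tphi) (QE Lphi).
  under eq_bigr do rewrite (QE (Ldphi _)).
  rewrite sumEFin -!EFinM lee_fin ler_wpM2l ?(ltW e0)//.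
  have : r ^+ 2 * \sum_(i < n) Q (partial i phi) <=
      r ^+ 2 * (2 * (\sum_(i < n) Q (G i)) + n%:R * (2 * t)).
    rewrite ler_wpM2l ?sqr_ge0//; apply: le_trans (ler_sum _ (fun i _ => q2 i)) _.
    by rewrite big_split/= -mulr_sumr sumr_const card_ord -[_ *+ n]mulr_natl.
  move: en q1; set S := \sum_(i < n) Q (G i).
  rewrite (_ : r ^+ 2 * (2 * S + n%:R * (2 * t)) = 2 * (r ^+ 2 * S) + 2 * t * (r ^+ 2 * n%:R)).
    lra.
  by ring.
have mUf f : L2 D f -> measurable_fun U f by move=> [mf _]; exact: (measurable_funS mD UD mf).
have Ldw := Ldiff _ _ Lphi Lw.
have : (sqint U w <= 2%:E * sqint U phi + 2%:E * sqint U (fun x => phi x - w x)%R)%E.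
  apply: (sqint_lin mU (mUf _ Lphi) (mUf _ Ldw) (mUf _ Lw) (ler0n R 2) (ler0n R 2)) => x _.
  by have := sqr_ge0 (phi x + (phi x - w x)); rewrite !expr2; lra.
move=> /le_trans; apply.
have Ut : (sqint U (fun x => phi x - w x)%R <= t%:E)%E.
  apply: le_trans aphi.
  by apply: (ge0_subset_integral mu mU mD (measurable_sqr Ldw.1) _ UD) => x _; rewrite lee_fin sqr_ge0.
apply: (@le_trans _ _ (2%:E * (e * (2 * (C * I) + 2 * t * (1 + r ^+ 2 * n%:R)))%:E + 2%:E * t%:E)%E).
  by apply: leeD; rewrite lee_pmul2l.
rewrite -!EFinM -!EFinD lee_fin (_ : s = t * K); last by rewrite /t divfK// gt_eqF.
by rewrite /K le_eqVlt; apply/orP; left; apply/eqP; ring.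
Unshelve. all: by end_near.
Qed.

End small_sets_see_little.

Section level_decay.
Context {R : realType} {n : nat}.
Local Notation V := 'rV[R]_n.
Local Notation mu := (lebesgue R n).
Local Notation m := (@borel_lebesgue R n).
Implicit Types (f g h u v : V -> R) (x : V) (k : nat).
Hypothesis n0 : (0 < n)%N.

Lemma chebyshev_sqint (U : set (Rn R n)) f (c : R) : measurable U ->
  measurable_fun U f -> 0 <= c -> (forall x, U x -> c <= f x) ->
  ((c ^+ 2)%:E * mu U <= sqint U f)%E.
Proof.
move=> mU mf c0 cf; rewrite -integral_cst//.
apply: (ge0_le_integral mu mU _ (measurable_cst _) (measurable_sqr mf)).
- by move=> x _; rewrite lee_fin sqr_ge0.
- move=> x Ux; rewrite lee_fin ler_pXn2r ?nnegrE ?cf//.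
  by rewrite (le_trans c0)// cf.
Qed.

Lemma sqint_restrict_le (D U : set (Rn R n)) f g (c : R) : 0 <= c ->
  measurable D -> measurable U -> measurable_fun D f -> measurable_fun U g ->
  (forall x, D x -> ~ U x -> f x = 0) ->
  (forall x, D x -> U x -> c * f x ^+ 2 <= g x ^+ 2) ->
  (c%:E * sqint D f <= sqint U g)%E.
Proof.
move=> c0 mD mU mf mg f0 fg.
have sq0 h x : (0 <= (h x ^+ 2)%:E)%E by rewrite lee_fin sqr_ge0.
rewrite /sqint -(ge0_integralZl_EFin mu mD (fun x _ => sq0 f x) (measurable_sqr mf) c0).
rewrite [leLHS]integral_mkcond [leRHS]integral_mkcond.
have mF : measurable_fun (setT : set (Rn R n)) ((fun x => c%:E * (f x ^+ 2)%:E)%E \_ D).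
  by apply: (measurable_restrictT _ mD).1; apply: measurable_funeM; exact: measurable_sqr.
have mG : measurable_fun (setT : set (Rn R n)) ((fun x => (g x ^+ 2)%:E)%E \_ U).
  by apply: (measurable_restrictT _ mU).1; exact: measurable_sqr.
have F0 x : setT x -> (0 <= ((fun x => c%:E * (f x ^+ 2)%:E)%E \_ D) x)%E.
  by move=> _; rewrite patchE; case: ifP => // _; rewrite mule_ge0.
apply: (ge0_le_integral mu measurableT F0 mF mG) => x _.
rewrite !patchE; case: ifPn => [/set_mem Dx|_]; last by case: ifP.
case: ifPn => [/set_mem Ux|]; first by rewrite -EFinM lee_fin fg.
by rewrite notin_setE => nUx; rewrite (f0 x Dx nUx) expr0n mule0.
Qed.

Lemma total_const_ge1 (lam Lam : R) : 0 < lam -> 1 <= @total_const R n lam Lam.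
Proof.
move=> lam0; have lam0' := ltW lam0.
have ec0 : 0 <= @energy_const R n lam Lam.
  by rewrite /energy_const divr_ge0// mulr_ge0 ?sqr_ge0.
rewrite /total_const -addrA lerDl addr_ge0//.
by rewrite divr_ge0// mulr_ge0.
Qed.

(** The truncation at level [A M] is controlled on the half ball by [eta u / c] on
[{u > A M}], where [c] is the lower bound of the cutoff on the half ball; this
set is small by Chebyshev's inequality. *)
Lemma level_decay (lam Lam : R) : 0 < lam -> lam <= Lam ->
  exists A : R, 1 < A /\
    forall (r : R) (a : V -> 'M[R]_n) u, 0 < r ->
      uniformly_elliptic (@eball R n r) lam Lam a ->
      subsolution (@eball R n r) a u -> nonneg_on (@eball R n r) u ->
      Num.sqrt (integral_mean (@eball R n (r / 2)) (fun x => Num.max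
        (u x - A * Num.sqrt (integral_mean (@eball R n r) (fun x => u x ^+ 2))) 0 ^+ 2)) <=
      1 / 2 * Num.sqrt (integral_mean (@eball R n r) (fun x => u x ^+ 2)).
Proof.
move=> lam0 lamLam.
pose c : R := flat 0 (1 / 12).
have c0 : 0 < c by apply: flat0_gt0; rewrite divr_gt0.
pose C := @total_const R n lam Lam.
have C0 : 0 < C := lt_le_trans ltr01 (total_const_ge1 Lam lam0).
have nR : 0 < n%:R :> R by rewrite ltr0n.
pose N : R := (2 * n%:R) ^+ n.
have N0 : 0 < N by rewrite exprn_gt0// mulr_gt0.
(* [4 e C] is the factor lost by [cutoff_small_set], [c^-2] by dividing by the
   cutoff and [N] by comparing the volumes; the product is to be a quarter. *)
pose e := c ^+ 2 / (16 * C * N).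
have e0 : 0 < e by rewrite divr_gt0 ?exprn_gt0// !mulr_gt0.
have [d d0 small] := @small_set_energy R n e e0.
(* The ball has measure at most [(2 r)^n], so that [2^n / A^2 <= d / 2] is what
   Chebyshev's inequality requires. *)
pose A : R := 1 + 2 ^+ n.+1 / d.
have A1 : 1 < A by rewrite /A ltrDl divr_gt0// exprn_gt0.
have A0 : 0 < A := lt_trans ltr01 A1.
have Ad : 2 ^+ n <= d / 2 * A ^+ 2.
  have : 2 ^+ n.+1 / d <= A ^+ 2.
    apply: (@le_trans _ _ A); first by rewrite /A lerDr.
    by rewrite expr2 ler_pMr// ltW.
  rewrite ler_pdivrMr// exprS => h.
  by rewrite mulrAC ler_pdivlMr// mulrC [d * _]mulrC.
exists A; split; first exact: A1.
move=> r a u r0 ella subu nnu.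
pose M : R := Num.sqrt (integral_mean (@eball R n r) (fun x => u x ^+ 2)).
rewrite -/M.
have Lu : L2 (@eball R n r) u := subu.1.1.
pose D : set (Rn R n) := @eball R n r.
pose D' : set (Rn R n) := @eball R n (r / 2).
have r20 : 0 < r / 2 by exact: divr_gt0.
have mD : measurable D by apply: borel_Rn_measurable; exact: measurable_eball.
have mD' : measurable D' by apply: borel_Rn_measurable; exact: measurable_eball.
have D'D : D' `<=` D.
  by move=> x; rewrite /D' /D /eball/= => /lt_trans; apply; rewrite ltr_pdivrMr// ltr_pMr// ltr1n.
pose I := fine (sqint D u).
have IE : sqint D u = I%:E.
  rewrite /I fineK//; apply/fin_numPlt.
  by rewrite (lt_le_trans _ (sqint_ge0 _ _))// Lu.2.
have I0 : 0 <= I by rewrite fine_ge0// sqint_ge0.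
pose v (x : V) : R := Num.max (u x - A * M) 0.
pose U : set (Rn R n) := D `&` [set x | A * M < u x].
have UD : U `<=` D by exact: subIsetl.
have mU : measurable U.
  rewrite /U (_ : [set x | _] = u @^-1` `]A * M, +oo[%classic).
    exact: (Lu.1 mD _ (measurable_itv _)).
  by apply/seteqP; split => x /=; rewrite in_itv/= andbT.
have lebfin (s : R) : 0 < s -> exists2 b : R, mu (@eball R n s) = b%:E &
    (2 * (s / n%:R)) ^+ n <= b <= (2 * s) ^+ n.
  move=> s0; have h1 := @lebesgue_eball_ge R n s n0 s0.
  have h2 := @lebesgue_eball_le R n s s0.
  exists (fine (mu (@eball R n s))).
    by rewrite fineK// ge0_fin_numE// (le_lt_trans h2)// ltry.
  by rewrite -!lee_fin fineK ?h1 ?h2// ge0_fin_numE// (le_lt_trans h2)// ltry.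
have [b bE /andP[b_lo b_hi]] := lebfin _ r0.
have [b' b'E /andP[b'_lo _]] := lebfin _ r20.
have b0 : 0 < b.
  by apply: lt_le_trans b_lo; rewrite exprn_gt0// mulr_gt0// divr_gt0.
have b'0 : 0 < b'.
  by apply: lt_le_trans b'_lo; rewrite exprn_gt0// mulr_gt0// divr_gt0.
have bb' : b <= N * b'.
  apply: le_trans b_hi _; apply: le_trans (ler_wpM2l (ltW N0) b'_lo).
  rewrite /N -exprMn le_eqVlt; apply/orP; left; apply/eqP; congr (_ ^+ _).
  by field; rewrite gt_eqF.
have meanE : integral_mean D (fun x => u x ^+ 2) = b^-1 * I.
  by rewrite /integral_mean /D bE.
have M0 : 0 <= M by exact: sqrtr_ge0.
have M2 : M ^+ 2 = b^-1 * I.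
  rewrite /M -/D meanE sqr_sqrtr// mulr_ge0// invr_ge0; exact: ltW.
pose w (x : V) : R := @cutoff R n r x * u x.
have teta : testfun (@cutoff R n r) := cutoff_testfun r0.
have eta1 x : `|@cutoff R n r x| <= 1 by rewrite ger0_norm ?cutoff_le1 ?cutoff_ge0.
have Lw : L2 D w.
  exact: (L2_bounded_mul r0 (testfun_measurableD (r:=r) teta) eta1 Lu).
have mUu : measurable_fun U u := measurable_funS mD UD Lu.1.
have mUw : measurable_fun U w := measurable_funS mD UD Lw.1.
have Uw : (sqint U w <= (4 * e * C * I)%:E)%E.
  (* If [M = 0] Chebyshev's inequality says nothing, but then [u] vanishes almost
     everywhere. *)
  have [M00|Mn0] := eqVneq M 0.
    apply: (@le_trans _ _ (sqint D u)).
      apply: (@le_trans _ _ (sqint U u)).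
        apply: (le_sqint mU mUw mUu) => x _.
        by rewrite normrM ler_piMl.
      apply: (ge0_subset_integral mu mU mD (measurable_sqr Lu.1) _ UD) => x _.
      by rewrite lee_fin sqr_ge0.
    have I00 : I = 0.
      move: M2; rewrite M00 expr0n/= => /esym/eqP.
      by rewrite mulf_eq0 invr_eq0 gt_eqF//= => /eqP.
    by rewrite IE I00 mulr0.
  have Mp : 0 < M by rewrite lt_def Mn0.
  rewrite EFinM -IE.
  apply: (cutoff_small_set n0 lam0 lamLam r0 ella subu nnu e0 d0 _ mU UD).
    by move=> phi E; exact: small.
  have muUD : (mu U <= mu D)%E by apply: le_measure; rewrite ?inE.
  have muUf : mu U = (fine (mu U))%:E.
    by rewrite fineK// ge0_fin_numE// (le_lt_trans muUD)// bE ltry.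
  have AM0 : 0 <= A * M by rewrite mulr_ge0// ltW.
  have := chebyshev_sqint mU mUu AM0 (fun x Ux => ltW Ux.2).
  have sUD : (sqint U u <= sqint D u)%E.
    apply: (ge0_subset_integral mu mU mD (measurable_sqr Lu.1) _ UD) => x _.
    by rewrite lee_fin sqr_ge0.
  move=> /le_trans/(_ sUD); rewrite IE muUf -EFinM !lee_fin.
  set p := fine _ => hp.
  have {}hp : A ^+ 2 * p <= b.
    have : M ^+ 2 * (A ^+ 2 * p) <= M ^+ 2 * b.
      rewrite mulrA -exprMn [M * A]mulrC; apply: le_trans hp _.
      by rewrite M2 mulrAC mulVf ?mul1r// gt_eqF.
    by rewrite ler_pM2l// exprn_gt0.
  have A2 : 0 < A ^+ 2 by exact: exprn_gt0.
  rewrite -(ler_pM2l A2); apply: le_trans hp _; apply: le_trans b_hi _.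
  rewrite exprMn mulrA [A ^+ 2 * _]mulrC ler_wpM2r// exprn_ge0//; exact: ltW.
have mv : measurable_fun D' v.
  apply: measurable_maxr; last exact: measurable_cst.
  apply: measurable_funB; last exact: measurable_cst.
  exact: (measurable_funS mD D'D Lu.1).
have vw : ((c ^+ 2)%:E * sqint D' v <= sqint U w)%E.
  apply: (sqint_restrict_le (sqr_ge0 c) mD' mU mv mUw).
    move=> x D'x nUx; rewrite /v max_r// subr_le0 leNgt; apply/negP => ux.
    by apply: nUx; split=> //; exact: D'D.
  move=> x D'x [_ /= ux]; rewrite -exprMn ler_pXn2r ?nnegrE.
  - rewrite /v max_l; last by rewrite subr_ge0 ltW.
    have AM0 : 0 <= A * M by rewrite mulr_ge0// ltW.
    apply: ler_pM; [exact: ltW|by rewrite subr_ge0 ltW| |by rewrite gerBl].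
    apply: cutoff_lower; move: D'x; rewrite /D' eballE//.
  - by [].
  - by rewrite mulr_ge0 ?(ltW c0)// /v le_max lexx orbT.
  - rewrite mulr_ge0 ?cutoff_ge0//; apply: le_trans (ltW ux).
    by rewrite mulr_ge0// ltW.
have vfin : sqint D' v = (fine (sqint D' v))%:E.
  have := le_trans vw Uw; case: (sqint D' v) (sqint_ge0 D' v) => [//||//] _.
  by rewrite gt0_muley ?leye_eq// lte_fin exprn_gt0.
have key : fine (sqint D' v) <= I / (4 * N).
  have := le_trans vw Uw; rewrite vfin -EFinM lee_fin => h.
  have c2 : 0 < c ^+ 2 by exact: exprn_gt0.
  rewrite -(ler_pM2l c2); apply: le_trans h _.
  rewrite /e le_eqVlt; apply/orP; left; apply/eqP; field.
  by rewrite !gt_eqF.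
rewrite (_ : 1 / 2 * M = Num.sqrt (1 / 4 * (b^-1 * I))).
  apply: ler_wsqrtr; rewrite /integral_mean b'E -/(fine _).
  rewrite -[X in _ * X]/(fine (sqint D' v)) /=.
  rewrite ler_pdivrMl//; apply: le_trans key _.
  rewrite ler_pdivrMr ?mulr_gt0//.
  rewrite (_ : b' * _ * _ = (N * b') / b * I); last by field; rewrite gt_eqF.
  by rewrite ler_peMl// ler_pdivlMr// mul1r.
rewrite (_ : 1 / 4 = (1 / 2) ^+ 2); last by rewrite expr2; lra.
rewrite -M2 -exprMn sqrtr_sqr ger0_norm// mulr_ge0//.
Qed.

End level_decay.

Theorem lemma3 (R : realType) (n : nat) (lam Lam : R) :
  (2 <= n)%N -> 0 < lam -> lam <= Lam ->
  exists A : R, 1 < A /\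
    (forall (a : 'rV[R]_n -> 'M[R]_n) (u : 'rV[R]_n -> R),
      uniformly_elliptic (eball 1) lam Lam a ->
      subsolution (eball 1) a u -> nonneg_on (eball 1) u ->
      let m := Num.sqrt (integral_mean (eball 1) (fun x => u x ^+ 2)) in
      let v := fun x => Num.max (u x - A * m) 0 in
      Num.sqrt (integral_mean (eball (1 / 2)) (fun x => v x ^+ 2)) <=
      1 / 2 * Num.sqrt (integral_mean (eball 1) (fun x => u x ^+ 2))) /\
    (forall (r : R) (a : 'rV[R]_n -> 'M[R]_n) (u : 'rV[R]_n -> R),
      0 < r ->
      uniformly_elliptic (eball r) lam Lam a ->
      subsolution (eball r) a u -> nonneg_on (eball r) u ->
      let m := Num.sqrt (integral_mean (eball r) (fun x => u x ^+ 2)) in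
      let v := fun x => Num.max (u x - A * m) 0 in
      Num.sqrt (integral_mean (eball (r / 2)) (fun x => v x ^+ 2)) <=
      1 / 2 * Num.sqrt (integral_mean (eball r) (fun x => u x ^+ 2))).
Proof.
move=> n2 lam0 lamLam; have n0 : (0 < n)%N by exact: leq_trans n2.
have [A [A1 decay]] := @level_decay R n n0 lam Lam lam0 lamLam.
exists A; split; [exact: A1|split].
- by move=> a u ella subu nnu; exact: (decay 1 a u ltr01 ella subu nnu).
- by move=> r a u r0 ella subu nnu; exact: (decay r a u r0 ella subu nnu).
Qed.
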